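(* For all integers $m\ge 2$ and $k\ge 1$, $\pi_m^{Lip}(J^k(\mathbb{R}))=0$.
   Context: Lipschitz homotopy groups: for a metric space $X$, $\pi_m^{Lip}(X)$ is defined in the same way as the usual homotopy group $\pi_m(X)$, except that the maps $\mathbb{S}^m\to X$ and the homotopies $\mathbb{S}^m\times[0,1]\to X$ are required to be Lipschitz. Jet space: for $f\in C^k(\mathbb{R})$ and $x_0\in\mathbb{R}$, the $k$-jet $j^k_{x_0}(f)$ is the class of $f$ under the relation of having the same $k$-th order Taylor polynomial at $x_0$; $J^k(\mathbb{R})$ is the set of all $k$-jets at all points, identified with $\mathbb{R}^{k+2}$ by $j^k_{x_0}(f)\leftrightarrow(x,u_k,\dots,u_0)=(x_0,f^{(k)}(x_0),\dots,f(x_0))$. The horizontal bundle is framed by $X^{(k)}=\frac{\partial}{\partial x}+u_k\frac{\partial}{\partial u_{k-1}}+\cdots+u_1\frac{\partial}{\partial u_0}$ and $\frac{\partial}{\partial u_k}$, declared orthonormal. A path is horizontal if it is absolutely continuous (as a map into Euclidean space) and its derivative lies a.e. in the horizontal bundle; its length is the integral of the norm of its derivative. $J^k(\mathbb{R})$ carries the Carnot-Carathéodory metric $d_{cc}$: $d_{cc}(p,q)$ is the infimum of lengths of horizontal paths from $p$ to $q$. *)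

(* Defs.v *)
From HB Require Import structures.
From mathcomp Require Import all_boot all_order all_algebra.
From mathcomp Require Import all_classical all_reals all_analysis.

Set Implicit Arguments.
Unset Strict Implicit.
Unset Printing Implicit Defensive.

Import Order.TTheory GRing.Theory Num.Theory.
Import numFieldNormedType.Exports.

Local Open Scope classical_set_scope.
Local Open Scope ring_scope.

(* The library norm on ['rV[R]_n] is the sup norm, hence this one. *)
Definition enorm (R : realType) (n : nat) (v : 'rV[R]_n) : R :=
  Num.sqrt (\sum_(i < n) v 0 i ^+ 2).

(** * Lipschitz homotopy groups *)

Definition sphere (R : realType) (m : nat) : set 'rV[R]_m.+1 :=
  [set p | enorm p = 1].
Arguments sphere : clear implicits.

Lemma sphere_base_subproof (R : realType) (m : nat) :
  (delta_mx 0 0 : 'rV[R]_m.+1) \in sphere R m.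
Proof.
rewrite inE /sphere /= /enorm (bigD1 ord0) //= mxE !eqxx /= expr1n.
rewrite big1 ?addr0 ?sqrtr1 // => i /negPf i0.
by rewrite mxE i0 andbF expr0n.
Qed.

Definition sphere_base (R : realType) (m : nat) : sphere R m :=
  exist (fun p => p \in sphere R m) _ (@sphere_base_subproof R m).
Arguments sphere_base : clear implicits.

Definition unit_interval (R : realType) : set R := `[0, 1].
Arguments unit_interval : clear implicits.

Definition sphere_dist (R : realType) (m : nat) (p q : sphere R m) : R :=
  enorm (val p - val q).

Definition cylinder_dist (R : realType) (m : nat)
    (p q : sphere R m * unit_interval R) : R :=
  Num.sqrt (sphere_dist p.1 q.1 ^+ 2 + (val p.2 - val q.2) ^+ 2).

(* Distances on the target are extended-real valued, so that an infimum of
   lengths can be used without first proving it finite; a Lipschitz bound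
   forces the distances involved to be finite. *)
Definition is_lipschitz (R : realType) (S T : Type)
    (dS : S -> S -> R) (dT : T -> T -> \bar R) (f : S -> T) : Prop :=
  exists L : R, forall p q, (dT (f p) (f q) <= (L * dS p q)%:E)%E.

Definition based_lipschitz (R : realType) (m : nat) (T : Type)
    (d : T -> T -> \bar R) (x0 : T) (f : sphere R m -> T) : Prop :=
  is_lipschitz (@sphere_dist R m) d f /\ f (sphere_base R m) = x0.

Definition lipschitz_homotopic (R : realType) (m : nat) (T : Type)
    (d : T -> T -> \bar R) (x0 : T) (f g : sphere R m -> T) : Prop :=
  exists H : sphere R m * unit_interval R -> T,
    [/\ is_lipschitz (@cylinder_dist R m) d H,
        forall p (t : unit_interval R), val t = 0 -> H (p, t) = f p,
        forall p (t : unit_interval R), val t = 1 -> H (p, t) = g p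
      & forall t, H (sphere_base R m, t) = x0].

Definition lipschitz_class (R : realType) (m : nat) (T : Type)
    (d : T -> T -> \bar R) (x0 : T) (f : sphere R m -> T) :
    set (sphere R m -> T) :=
  [set g | based_lipschitz d x0 g /\ lipschitz_homotopic d x0 f g].

Definition lipschitz_pi (R : realType) (m : nat) (T : Type)
    (d : T -> T -> \bar R) (x0 : T) : set (set (sphere R m -> T)) :=
  [set lipschitz_class d x0 f | f in [set f | based_lipschitz d x0 f]].
Arguments lipschitz_pi {R} m {T} d x0.

(* The neutral element of the homotopy group is the class of the constant map,
   so the group is zero exactly when this is its only element. *)
Definition lipschitz_pi_trivial (R : realType) (m : nat) (T : Type)
    (d : T -> T -> \bar R) (x0 : T) : Prop :=
  lipschitz_pi m d x0 = [set lipschitz_class d x0 (fun _ : sphere R m => x0)].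
Arguments lipschitz_pi_trivial {R} m {T} d x0.

(** * The jet space with its Carnot-Caratheodory metric *)

(* Coordinates (x, u_k, ..., u_0): index 0 is x, and index i >= 1 is
   u_(k + 1 - i); thus index 1 is u_k and index k + 1 is u_0. *)
Definition jet_space (R : realType) (k : nat) := 'rV[R]_k.+2.
Arguments jet_space : clear implicits.

Definition idx_x (k : nat) : 'I_k.+2 := ord0.
Definition idx_uk (k : nat) : 'I_k.+2 := lift ord0 ord0.

(* X^(k) = d/dx + u_k d/du_(k-1) + ... + u_1 d/du_0: at index i >= 2 the
   coefficient is u_(k + 2 - i), which is coordinate i - 1. *)
Definition frame_X (R : realType) (k : nat) (p : jet_space R k) :
    'rV[R]_k.+2 :=
  \row_(i < k.+2)
    (if i == idx_x k then 1
     else if i == idx_uk k then 0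
     else p 0 (inord i.-1)).

Definition frame_U (R : realType) (k : nat) : 'rV[R]_k.+2 :=
  delta_mx 0 (idx_uk k).
Arguments frame_U : clear implicits.

Definition horizontal (R : realType) (k : nat) (p : jet_space R k)
    (v : 'rV[R]_k.+2) : Prop :=
  exists a b : R, v = a *: frame_X p + b *: frame_U R k.

(* The coefficients of a horizontal vector in the frame are its components
   along x and u_k; see [hnorm_frame]. *)
Definition hnorm (R : realType) (k : nat) (v : 'rV[R]_k.+2) : R :=
  Num.sqrt (v 0 (idx_x k) ^+ 2 + v 0 (idx_uk k) ^+ 2).

Lemma hnorm_frame (R : realType) (k : nat) (p : jet_space R k) (a b : R) :
  hnorm (a *: frame_X p + b *: frame_U R k) = Num.sqrt (a ^+ 2 + b ^+ 2).
Proof.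
by rewrite /hnorm !mxE /= mulr1 !mulr0 addr0 add0r mulr1.
Qed.

Definition absolutely_continuous (R : realType) (n : nat) (a b : R)
    (f : R -> 'rV[R]_n) : Prop :=
  forall e : R, 0 < e -> exists2 r : R, 0 < r &
    forall (N : nat) (s t : 'I_N -> R),
      (forall i, [/\ a <= s i, s i <= t i & t i <= b]) ->
      trivIset setT (fun i => `]s i, t i[%classic) ->
      \sum_(i < N) (t i - s i) < r ->
      \sum_(i < N) enorm (f (t i) - f (s i)) < e.

Definition horizontal_path (R : realType) (k : nat) (a b : R)
    (g : R -> jet_space R k) : Prop :=
  [/\ a <= b, absolutely_continuous a b g
    & {ae @lebesgue_measure R, forall t, t \in `[a, b] ->
        derivable (g : R -> 'rV[R]_k.+2) t 1 /\
        horizontal (g t) (derive1 (g : R -> 'rV[R]_k.+2) t)}].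

Definition path_length (R : realType) (k : nat) (a b : R)
    (g : R -> jet_space R k) : \bar R :=
  (\int[@lebesgue_measure R]_(t in `[a, b])
     (hnorm (derive1 (g : R -> 'rV[R]_k.+2) t))%:E)%E.

Definition dcc (R : realType) (k : nat) (p q : jet_space R k) : \bar R :=
  ereal_inf [set l | exists a b g,
    [/\ horizontal_path a b g, g a = p, g b = q & l = path_length a b g]].

(* Main.v *)
Require Import Defs.
From HB Require Import structures.
From mathcomp Require Import all_boot all_order all_algebra finmap.
From mathcomp Require Import all_classical all_reals all_analysis.
From mathcomp Require Import measurable_realfun ring lra.

(* A Lipschitz map of the sphere into the jet space lifts, through the collapse
   of the unit ball of R^m onto the sphere, to a Lipschitz map F on R^m that is
   constant on the exterior Z of the ball. Along a horizontal path of length l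
   the coordinates satisfy |du_(i-1) - u_i dx| <= C l^2, so on R^m the 1-form
   dF_(i+1) - F_i dF_0 vanishes to second order, and by a two-dimensional sewing
   argument the 1-forms A dF_0 and A dF_1 are exact for every A in the closed
   lattice generated by the coordinates of F. Hence F behaves like a map that
   factors through a tree.

   The height h of the tree is the largest L-Lipschitz function of this lattice
   that vanishes on Z. Since the forms theta(h) dF_i are exact, F takes a single
   value at all points of height <= s that are adherent to a given component of
   {h > s}. Sending each point p of height > s to the value of F on the rim of
   its component, and letting s decrease from L to 0, contracts F to a constant.
   This is Lipschitz in s because a path in the tree costs at most the drop in
   height (a Perron-type barrier argument), and Lipschitz in the point of the
   sphere because along an arc the contracted value changes only after the arc
   has met the rim. *)

Set Implicit Arguments.
Unset Strict Implicit.
Unset Printing Implicit Defensive.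

Import Order.TTheory GRing.Theory Num.Theory.
Import numFieldNormedType.Exports.

Local Open Scope classical_set_scope.
Local Open Scope ring_scope.

(** * Sewing *)

(** The obstacle is that F is merely Lipschitz and that no tree is given. Forms A dB are therefore
    handled through the increments [A p * (B q - B p)], and exactness means a primitive up to o(|p -
    q|), a notion compatible with bisecting segments. The lift from the sphere to R^m provides these
    segments. Order two is the critical order for triangles: cutting one into four halves its
    diameter h, and 4 (h/2)^2 = h^2, so a defect o(h^2) vanishes in the limit whereas O(h^2) need
    not. The condition k >= 1 provides a coordinate F_2 with dF_2 = F_1 dF_0, hence the exactness of
    both F_1 dF_0 and F_0 dF_1, on which the lattice is built. The condition m >= 2 makes Z
    connected, so that primitives are constant on it. The tree itself is never constructed.
    Components of superlevel sets of h stand for its branches, and the pseudo-distance [dist]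
    induced by the lattice stands for its metric; it dominates the pulled back distance [D].
    Maximality of h replaces both geodesics and connectedness of sublevel sets. *)

Lemma nested_limit (R : realType) (u e : nat -> R) :
  (forall n k, u n - e n <= u k + e k) ->
  exists l, forall n, `|u n - l| <= e n.
Proof.
move=> ue; pose A := [set x | exists n, x = u n - e n].
have A0 : A !=set0 by exists (u 0%N - e 0%N); exists 0%N.
have Aub k : ubound A (u k + e k) by move=> _ [n ->].
exists (sup A) => n; rewrite ler_distlC; apply/andP; split.
  by apply: ub_le_sup; [exists (u 0%N + e 0%N); exact: Aub|exists n].
by apply: ge_sup => //; exact: Aub.
Qed.

Lemma le_eps (R : realFieldType) (x c : R) : 0 <= c ->
  (forall e, 0 < e -> x <= c * e) -> x <= 0.
Proof.
move=> c0 H; rewrite leNgt; apply/negP => x0.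
have c1 : 0 < c + 1 by lra.
have e0 : 0 < x / (2 * (c + 1)) by rewrite divr_gt0//; lra.
have /(_ _ e0) := H.
have -> : c * (x / (2 * (c + 1))) = (c / (c + 1)) * (x / 2) by field; lra.
move=> h; have : c / (c + 1) <= 1 by rewrite ler_pdivrMr; lra.
nra.
Qed.

Lemma exp2_gt (R : realType) (x d : R) : 0 < d -> exists n, x < 2 ^+ n * d.
Proof.
move=> d0; have d1 := divr_gt0 d0 (ltr_pwDr ltr01 (normr_ge0 x)).
have [n _ h] := near_infty_natSinv_lt (PosNum d1).
have /= := h n (leqnn n); rewrite ltr_pdivlMr; last by have := normr_ge0 x; lra.
rewrite -ltr_pdivlMl; last by rewrite invr_gt0 ltr0n.
rewrite invrK => {}h.
exists n.+1; rewrite (@lt_trans _ _ (n.+1%:R * d))//.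
  by have := ler_norm x; lra.
rewrite ltr_pM2r// -natrX ltr_nat; exact: ltn_expl.
Qed.

Section Midpoint.
Context (R : realType) (V : normedModType R).
Implicit Types (p q r : V).

Definition mid p q : V := 2^-1 *: (p + q).

Lemma midC p q : mid p q = mid q p.
Proof. by rewrite /mid addrC. Qed.

Let half_norm (v : V) : `|2^-1 *: v| = `|v| / 2.
Proof. by rewrite normrZ ger0_norm ?invr_ge0// mulrC. Qed.

Lemma mid_subl p q : p - mid p q = 2^-1 *: (p - q).
Proof.
rewrite /mid -[X in X - _](scale1r) scalerDr opprD addrA -scalerBl scalerBr.
by congr (_ *: _ - _); field.
Qed.

Lemma mid_distl p q : `|p - mid p q| = `|p - q| / 2.
Proof. by rewrite mid_subl half_norm. Qed.

Lemma mid_distr p q : `|mid p q - q| = `|p - q| / 2.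
Proof. by rewrite distrC midC mid_distl distrC. Qed.

Lemma mid_mid p q r : `|mid p q - mid p r| = `|q - r| / 2.
Proof.
by rewrite /mid -scalerBr half_norm opprD addrACA subrr add0r.
Qed.

Definition mid_closed (C : set V) := forall p q, C p -> C q -> C (mid p q).

(* A function that is locally [K]-Lipschitz up to an arbitrarily small error
   is [K]-Lipschitz: subdivide. *)
Lemma local_lipschitz (C : set V) (W : normedModType R) (g : V -> W) (K : R) :
  mid_closed C ->
  (forall e, 0 < e -> exists2 d, 0 < d & forall p q, C p -> C q -> `|p - q| < d ->
     `|g p - g q| <= (K + e) * `|p - q|) ->
  forall p q, C p -> C q -> `|g p - g q| <= K * `|p - q|.
Proof.
move=> mC H p q Cp Cq; rewrite -subr_le0.
apply: (@le_eps _ _ `|p - q|) => // e e0.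
have [d d0 {}H] := H e e0.
suff : forall n p q, C p -> C q -> `|p - q| < 2 ^+ n * d ->
    `|g p - g q| <= (K + e) * `|p - q|.
  have [n pqn] := exp2_gt `|p - q| d0; move=> /(_ n p q Cp Cq pqn); lra.
elim=> [{}p {}q {}Cp {}Cq|n IH {}p {}q {}Cp {}Cq]; first by rewrite expr0 mul1r; exact: H.
rewrite exprS => pqn; have Cm := mC _ _ Cp Cq.
rewrite (le_trans (ler_distD (g (mid p q)) _ _))//.
have := IH _ _ Cp Cm; have := IH _ _ Cm Cq.
rewrite mid_distl mid_distr => /(_ ltac:(lra)) h1 /(_ ltac:(lra)) h2; lra.
Qed.

End Midpoint.

Section Sewing.
Context (R : realType) (V : normedModType R).
Implicit Types (p q r : V) (Xi : V -> V -> R).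

(** The boundary sum over a triangle is o(h^2), uniformly in the triangle. Degenerate triangles are
    included: they give [Xi p p = 0] and antisymmetry up to o(h^2). *)
Definition almost_closed Xi := forall e, 0 < e -> exists2 d, 0 < d &
  forall h p q r, h < d -> `|p - q| <= h -> `|q - r| <= h -> `|p - r| <= h ->
    `|Xi p q + Xi q r - Xi p r| <= e * h ^+ 2.

Fixpoint dyadic_sum Xi n p q : R := if n is n'.+1 then
  dyadic_sum Xi n' p (mid p q) + dyadic_sum Xi n' (mid p q) q else Xi p q.

(** Each bisection halves the length and doubles the number of pieces, so the successive errors are
    [e * h ^+ 2] times 1, 1/2, 1/4, and so on. *)
Lemma dyadic_sum0 Xi e d h n p q : 0 < e ->
  (forall h p q r, h < d -> `|p - q| <= h -> `|q - r| <= h -> `|p - r| <= h ->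
    `|Xi p q + Xi q r - Xi p r| <= e * h ^+ 2) ->
  `|p - q| <= h -> h < d ->
  `|dyadic_sum Xi n p q - Xi p q| <= 2 * e * h ^+ 2.
Proof.
move=> e0 H; elim: n p q h => [|n IH] p q h pq hd /=.
  by rewrite subrr normr0; have := sqr_ge0 h; nra.
have h0 : 0 <= h by rewrite (le_trans _ pq).
have := IH p (mid p q) (h / 2); have := IH (mid p q) q (h / 2).
have := H h p (mid p q) q hd; rewrite mid_distl mid_distr.
move=> /(_ ltac:(lra) ltac:(lra) ltac:(lra)) h1 /(_ ltac:(lra) ltac:(lra)) h2.
move=> /(_ ltac:(lra) ltac:(lra)) h3.
set a := dyadic_sum _ _ _ _ in h3 *; set b := dyadic_sum _ _ _ _ in h2 *.
have -> : a + b - Xi p q = (a - Xi p (mid p q)) + (b - Xi (mid p q) q) +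
  (Xi p (mid p q) + Xi (mid p q) q - Xi p q) by ring.
rewrite (le_trans (ler_normD _ _))// (le_trans (lerD (ler_normD _ _) (lexx _)))//.
have -> : 2 * e * h ^+ 2 = 2 * e * (h / 2) ^+ 2 + 2 * e * (h / 2) ^+ 2 + e * h ^+ 2 by field.
lra.
Qed.

(** Each of the [2 ^+ n] pieces has length at most [h / 2 ^+ n], which is below [d] even when [h] is
    not, so [dyadic_sum0] applies piece by piece. *)
Lemma dyadic_sumD Xi e d h n k p q : 0 < e ->
  (forall h p q r, h < d -> `|p - q| <= h -> `|q - r| <= h -> `|p - r| <= h ->
    `|Xi p q + Xi q r - Xi p r| <= e * h ^+ 2) ->
  `|p - q| <= h -> h < 2 ^+ n * d ->
  `|dyadic_sum Xi (n + k) p q - dyadic_sum Xi n p q| <= 2 * e * h ^+ 2 / 2 ^+ n.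
Proof.
move=> e0 H; elim: n p q h => [|n IH] p q h pq hd /=.
  by rewrite expr0 mul1r in hd; rewrite expr0 divr1; apply: dyadic_sum0 hd.
rewrite exprS in hd.
have := IH p (mid p q) (h / 2); have := IH (mid p q) q (h / 2).
rewrite mid_distl mid_distr.
move=> /(_ ltac:(lra) ltac:(lra)) h2 /(_ ltac:(lra) ltac:(lra)) h3.
rewrite opprD addrACA (le_trans (ler_normD _ _))// (le_trans (lerD h3 h2))//.
rewrite (exprS 2 n); have ? : 2 ^+ n != 0 :> R by rewrite expf_neq0.
by rewrite le_eqVlt; apply/orP; left; apply/eqP; field.
Qed.

(** [I] is the integral of [Xi] along segments. Additivity is recorded at midpoints, which is what
    the subdivision of a triangle into four uses. *)
Lemma dyadic_limit Xi : almost_closed Xi -> exists I : V -> V -> R,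
  [/\ forall p q, I p q = I p (mid p q) + I (mid p q) q,
      forall e, 0 < e -> exists2 d, 0 < d & forall p q h, `|p - q| <= h -> h < d ->
        `|I p q - Xi p q| <= 2 * e * h ^+ 2
    & (forall p q, Xi p q = - Xi q p) -> forall p q, I p q = - I q p].
Proof.
move=> H.
have /choice[I0 hI0] : forall pq : V * V, exists l, forall e, 0 < e ->
    exists N, forall n, (N <= n)%N -> `|dyadic_sum Xi n pq.1 pq.2 - l| <= e.
  move=> [p q] /=; have [d d0 H1] := H 1 ltr01.
  have [N hN] := exp2_gt `|p - q| d0.
  pose u n := dyadic_sum Xi (N + n) p q.
  pose e (n : nat) := 2 * 1 * `|p - q| ^+ 2 / 2 ^+ (N + n) : R.
  have key n k : `|u (n + k)%N - u n| <= e n.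
    rewrite /u addnA; apply: (dyadic_sumD _ ltr01 H1) => //.
    rewrite (lt_le_trans hN)// ler_pM2r// ler_eXn2l ?leq_addr// ltr1n//.
  have e_ge0 n : 0 <= e n.
    by rewrite /e divr_ge0 ?exprn_ge0// !mulr_ge0// exprn_ge0.
  have [l hl] : exists l, forall n, `|u n - l| <= e n.
    apply: nested_limit => n k; have := e_ge0 n; have := e_ge0 k.
    have [nk|/ltnW nk] := leqP n k.
      by have := key n (k - n)%N; rewrite subnKC// ler_norml => /andP[]; lra.
    by have := key k (n - k)%N; rewrite subnKC// ler_norml => /andP[]; lra.
  exists l => eps eps0.
  have [M hM] := exp2_gt (2 * 1 * `|p - q| ^+ 2) eps0.
  exists (N + M)%N => n nNM; have := hl (n - N)%N.
  rewrite /u /e subnKC ?(leq_trans _ nNM) ?leq_addr// => /le_trans; apply.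
  rewrite ler_pdivrMr ?exprn_gt0// (le_trans (ltW hM))// mulrC ler_pM2l//.
  by rewrite ler_eXn2l ?(leq_trans _ nNM) ?leq_addl// ltr1n.
pose I p q := I0 (p, q); exists I; split.
- move=> p q; apply/eqP; rewrite -subr_eq0 -normr_le0.
  apply: (@le_eps _ _ 3) => // e e0.
  have [N1 h1] := hI0 (p, q) e e0; have [N2 h2] := hI0 (p, mid p q) e e0.
  have [N3 h3] := hI0 (mid p q, q) e e0.
  pose n := maxn N1 (maxn N2 N3).
  have {}h1 := h1 n.+1 (leqW (leq_maxl _ _)).
  have {}h2 := h2 n (leq_trans (leq_maxl _ _) (leq_maxr _ _)).
  have {}h3 := h3 n (leq_trans (leq_maxr _ _) (leq_maxr _ _)).
  rewrite /= in h1 h2 h3; rewrite -/(I p q) in h1.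
  rewrite -/(I p (mid p q)) in h2; rewrite -/(I (mid p q) q) in h3.
  move: h1 h2 h3; rewrite !ler_norml => /andP[? ?] /andP[? ?] /andP[? ?].
  by apply/andP; split; lra.
- move=> e e0; have [d d0 Hd] := H e e0; exists d => // p q h pqh hd.
  rewrite -subr_le0; apply: (@le_eps _ _ 1) => // e' e'0.
  have [N hN] := hI0 (p, q) e' e'0; have {hN} := hN N (leqnn _).
  have := dyadic_sum0 N e0 Hd pqh hd; rewrite /= -/(I p q) !ler_norml.
  move=> /andP[? ?] /andP[? ?].
  rewrite mul1r lerBlDr ler_norml; apply/andP; split; lra.
- move=> anti.
  have antiS n p q : dyadic_sum Xi n p q = - dyadic_sum Xi n q p.
    elim: n p q => [//|n IH] p q /=.
    by rewrite opprD (IH p) (IH _ q) midC addrC.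
  move=> p q; apply/eqP; rewrite -subr_eq0 -normr_le0.
  apply: (@le_eps _ _ 2) => // e e0.
  have [N1 h1] := hI0 (p, q) e e0; have [N2 h2] := hI0 (q, p) e e0.
  have {}h1 := h1 _ (leq_maxl N1 N2); have {}h2 := h2 _ (leq_maxr N1 N2).
  move: h1 h2; rewrite /= -/(I p q) -/(I q p) antiS !ler_norml.
  by move=> /andP[? ?] /andP[? ?]; apply/andP; split; lra.
Qed.

(** Goursat's argument. [J] is the integral around a triangle and [Jmid] splits it into four
    triangles of half the size; since [4 * (h / 2) ^+ 2 = h ^+ 2], the bound known at small scale
    holds at every scale. Hence [J] vanishes and integration from 0 is a potential. *)
Lemma sewing_antisym Xi : almost_closed Xi -> (forall p q, Xi p q = - Xi q p) ->
  exists P : V -> R, forall e, 0 < e -> exists2 d, 0 < d &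
    forall p q, `|p - q| < d -> `|P q - P p - Xi p q| <= e * `|p - q| ^+ 2.
Proof.
move=> H anti; have [I [Imid IXi /(_ anti) Ianti]] := dyadic_limit H.
pose J p q r := I p q + I q r - I p r.
have Jmid p q r : J p q r = J p (mid p q) (mid p r) + J (mid p q) q (mid q r)
    + J (mid p r) (mid q r) r - J (mid p q) (mid p r) (mid q r).
  by rewrite /J (Imid p q) (Imid q r) (Imid p r); ring.
have J0 p q r : J p q r = 0.
  apply/eqP; rewrite -normr_le0.
  pose h := `|p - q| + `|q - r| + `|p - r|.
  apply: (@le_eps _ _ (7 * h ^+ 2)) => [|e e0]; first by have := sqr_ge0 h; nra.
  have [d1 d10 H1] := H e e0; have [d2 d20 H2] := IXi e e0.
  pose d := Num.min d1 d2; have d0 : 0 < d by rewrite lt_min d10.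
  have [n hn] := exp2_gt h d0.
  (* The factor 7 is one [e] for the defect of [Xi] and [2 * e] for each of the three sides. *)
  suff : forall n p q r h, `|p - q| <= h -> `|q - r| <= h -> `|p - r| <= h ->
      h < 2 ^+ n * d -> `|J p q r| <= 7 * e * h ^+ 2.
    move=> /(_ n p q r h); have := normr_ge0 (p - q); have := normr_ge0 (q - r).
    have := normr_ge0 (p - r); rewrite /h => ? ? ?.
    by move=> /(_ ltac:(lra) ltac:(lra) ltac:(lra) hn); nra.
  elim=> [|m IH] {}p {}q {}r {hn}h pq qr pr.
    rewrite expr0 mul1r lt_min => /andP[hd1 hd2].
    have := H1 _ _ _ _ hd1 pq qr pr; have := H2 _ _ _ pq hd2.
    have := H2 _ _ _ qr hd2; have := H2 _ _ _ pr hd2.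
    rewrite /J !ler_norml => /andP[? ?] /andP[? ?] /andP[? ?] /andP[? ?].
    by apply/andP; split; lra.
  rewrite exprS => hd; rewrite Jmid.
  have := IH p (mid p q) (mid p r) (h / 2).
  have := IH (mid p q) q (mid q r) (h / 2).
  have := IH (mid p r) (mid q r) r (h / 2).
  have := IH (mid p q) (mid p r) (mid q r) (h / 2).
  rewrite !mid_distl !mid_distr !mid_mid.
  have -> : `|mid p q - mid q r| = `|p - r| / 2 by rewrite midC mid_mid.
  have -> : `|mid p r - mid q r| = `|p - q| / 2.
    by rewrite midC (midC q) mid_mid.
  do 4 (move=> /(_ ltac:(lra) ltac:(lra) ltac:(lra) ltac:(lra)) ?).
  have -> : 7 * e * h ^+ 2 = 4 * (7 * e * (h / 2) ^+ 2) by field.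
  rewrite (le_trans (ler_normB _ _))// (le_trans (lerD (ler_normD _ _) (lexx _)))//.
  rewrite (le_trans (lerD (lerD (ler_normD _ _) (lexx _)) (lexx _)))//; lra.
exists (I 0) => e e0; have e20 : 0 < e / 2 by rewrite divr_gt0.
have [d d0 Hd] := IXi _ e20; exists d => // p q pq.
have := Hd p q _ (lexx _) pq.
have := J0 0 p q; rewrite /J => ?; have -> : I 0 q - I 0 p = I p q by lra.
by have -> : 2 * (e / 2) = e by field.
Qed.

(** The triangle [p], [q], [p] shows that [Xi] is antisymmetric up to o(h^2), so passing to its
    antisymmetric part costs less than the error linear in [|p - q|] granted here. *)
Lemma sewing Xi : almost_closed Xi -> exists P : V -> R,
  forall e, 0 < e -> exists2 d, 0 < d &
    forall p q, `|p - q| < d -> `|P q - P p - Xi p q| <= e * `|p - q|.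
Proof.
move=> H; pose Y p q := (Xi p q - Xi q p) / 2.
have [|p q|P HP] := @sewing_antisym Y; last 1 first.
- exists P => e e0; have [d d0 Hd] := HP e e0; have [d' d'0 Hd'] := H e e0.
  exists (Num.min 2^-1 (Num.min d d')) => [|p q].
    by rewrite !lt_min invr_gt0 ltr0n d0 d'0.
  rewrite !lt_min => /andP[pq1 /andP[/Hd h1 pqd']].
  have X0 : Xi p p = 0.
    apply/eqP; rewrite -normr_le0; have := Hd' 0 p p p d'0.
    by rewrite subrr normr0 lexx expr0n mulr0 addrK => /(_ isT isT isT).
  have := Hd' _ p q p pqd' (lexx _); rewrite (distrC q p) subrr normr0 X0 subr0.
  move=> /(_ (lexx _) (normr_ge0 _)) h2; move: h1 h2; rewrite /Y.
  have := normr_ge0 (p - q); set h := `|p - q| in pq1 pqd' *; rewrite !ler_norml.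
  move=> h0 /andP[? ?] /andP[? ?]; have : e * h ^+ 2 <= e * (h / 2) by rewrite ler_pM2l//; nra.
  by move=> ?; apply/andP; split; lra.
- move=> e e0; have [d d0 Hd] := H e e0; exists d => // h p q r hd pq qr pr.
  have := Hd h p q r hd pq qr pr; have := Hd h r q p hd.
  rewrite (distrC r q) (distrC q p) (distrC r p).
  move=> /(_ qr pq pr); rewrite /Y !ler_norml => /andP[? ?] /andP[? ?].
  by apply/andP; split; lra.
- by rewrite /Y; lra.
Qed.

End Sewing.

(** * Primitives of one-forms *)

Lemma natSinv_small (R : realType) (e : R) : 0 < e -> exists n, n.+1%:R^-1 < e.
Proof.
move=> e0; have [n _ h] := near_infty_natSinv_lt (PosNum e0).
by exists n; exact: (h n (leqnn n)).
Qed.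

Section Primitives.
Context (R : realType) (V : normedModType R).
Implicit Types (p q r : V) (A B G P : V -> R) (K M : R).

Definition lip K (g : V -> R) := forall p q, `|g p - g q| <= K * `|p - q|.

(* [P] is a primitive of the 1-form [A dB]. *)
Definition prim A B P := forall e, 0 < e -> exists2 d, 0 < d & forall p q,
  `|p - q| < d -> `|P q - P p - A p * (B q - B p)| <= e * `|p - q|.

Definition has_prim A B := exists P, prim A B P.

Lemma prim_add A A' B P P' : prim A B P -> prim A' B P' ->
  prim (fun p => A p + A' p) B (fun p => P p + P' p).
Proof.
move=> H H' e e0; have e20 : 0 < e / 2 by rewrite divr_gt0.
have [d d0 Hd] := H _ e20; have [d' d'0 Hd'] := H' _ e20.
exists (Num.min d d') => [|p q]; first by rewrite lt_min d0.
rewrite lt_min => /andP[/Hd + /Hd']; rewrite !ler_norml => /andP[? ?] /andP[? ?].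
by apply/andP; split; lra.
Qed.

Lemma prim_scale (c : R) A B P : prim A B P ->
  prim (fun p => c * A p) B (fun p => c * P p).
Proof.
move=> H e e0; have e20 : 0 < e / (`|c| + 1) by rewrite divr_gt0// ltr_pwDr.
have [d d0 Hd] := H _ e20; exists d => // p q /Hd h.
have -> : c * P q - c * P p - c * A p * (B q - B p) =
  c * (P q - P p - A p * (B q - B p)) by ring.
rewrite normrM (le_trans (ler_wpM2l _ h))//.
have -> : `|c| * (e / (`|c| + 1) * `|p - q|) = (`|c| / (`|c| + 1)) * (e * `|p - q|).
  by field; have := normr_ge0 c; lra.
apply: ler_piMl; first by rewrite mulr_ge0// ltW.
by rewrite ler_pdivrMr ?ltr_pwDr// mul1r lerDl.
Qed.

Lemma prim_sub A A' B P P' : prim A B P -> prim A' B P' ->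
  prim (fun p => A p - A' p) B (fun p => P p - P' p).
Proof.
move=> H /(prim_scale (-1)) /(prim_add H).
have -> : (fun p => A p + -1 * A' p) = (fun p => A p - A' p).
  by apply/funext => p; rewrite mulN1r.
have -> // : (fun p => P p + -1 * P' p) = (fun p => P p - P' p).
by apply/funext => p; rewrite mulN1r.
Qed.

Lemma prim_id B : prim (fun=> 1) B B.
Proof.
by move=> e e0; exists 1 => // p q _; rewrite mul1r subrr normr0 mulr_ge0// ltW.
Qed.

Lemma prim_shift A B P c : prim A B P -> prim A B (fun p => P p - c).
Proof.
move=> H e e0; have [d d0 Hd] := H _ e0; exists d => // p q /Hd.
by have -> : P q - c - (P p - c) = P q - P p by ring.
Qed.

(** The increments of [P] are [A p * (B q - B p)] up to o(|p - q|), and closure under midpoints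
    keeps the subdivision inside the set where [A] is bounded. *)
Lemma prim_lip C A B P K M : lip K B -> prim A B P -> mid_closed C ->
  (forall p, C p -> `|A p| <= M) ->
  forall p q, C p -> C q -> `|P p - P q| <= M * K * `|p - q|.
Proof.
move=> BK HP mC AM; apply: (@local_lipschitz _ _ C R^o P) => // e e0.
have [d d0 Hd] := HP _ e0; exists d => // p q Cp Cq /[dup] pqd.
move=> /Hd h; have {}AM := AM p Cp; have {}BK := BK q p.
have h' : `|A p * (B q - B p)| <= M * (K * `|p - q|).
  by rewrite normrM (distrC p q) ler_pM.
suff g : `|P q - P p| <= (M * K + e) * `|p - q| by rewrite [leLHS]distrC.
move: h h'; rewrite !ler_norml => /andP[? ?] /andP[? ?].
by apply/andP; split; lra.
Qed.

Lemma mid_closedT : mid_closed [set: V]. Proof. by []. Qed.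

(** Formally [dA = a dG], so the exterior product of dA and dB is [a] times that of dG and dB, which
    vanishes because [G dB] is exact. Sewing turns this into a statement without derivatives. *)
Lemma has_prim_chain A (a : V -> R) B G K C : lip K B -> has_prim G B ->
  (forall p q, `|A q - A p - a p * (G q - G p)| <= C * `|p - q| ^+ 2) ->
  (forall p, `|a p| <= C) -> lip C a -> has_prim A B.
Proof.
move=> BK [P HP] HA aC alip.
(* The second summand is a second-order correction, as for integrals of controlled paths. With it
   the defect on a triangle is the O(h^2) remainder of [A] times [B r - B q], plus [a q - a p] times
   the o(h) error of [P]. *)
pose X p q := A p * (B q - B p) + a p * (P q - P p - G p * (B q - B p)).
have [e e0|Q HQ] := @sewing _ _ X; last first.
  exists Q => e e0; have [d d0 Hd] := HQ _ (divr_gt0 e0 (ltr0n R 2)).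
  have C0 : 0 <= C by rewrite (le_trans (normr_ge0 _) (aC 0)).
  have [d' d'0 Hd'] := prim_scale C HP e0.
  have [d2 d20 Hd2] := prim_scale C HP (divr_gt0 e0 (ltr0n R 2)).
  exists (Num.min d d2) => [|p q]; first by rewrite lt_min d0.
  rewrite lt_min => /andP[/Hd h1 /Hd2 h2]; rewrite /X in h1.
  set E := P q - P p - G p * (B q - B p) in h1.
  have : `|a p * E| <= e / 2 * `|p - q|.
    rewrite (le_trans _ h2)// /E normrM (_ : C * P q - _ - _ = C * E); last by rewrite /E; ring.
    by rewrite normrM (ger0_norm C0) ler_wpM2r.
  move: h1; rewrite !ler_norml => /andP[? ?] /andP[? ?]; apply/andP; split; lra.
have C0 : 0 <= C by rewrite (le_trans (normr_ge0 _) (aC 0)).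
have K0 : 0 <= `|K| by [].
pose e1 := e / 2 / (C + 1); have e10 : 0 < e1 by rewrite !divr_gt0//; lra.
have [d d0 Hd] := HP _ e10.
pose d1 := e / 2 / (C * `|K| + 1).
have CK : 0 <= C * `|K| by rewrite mulr_ge0.
have d10 : 0 < d1 by rewrite !divr_gt0//; lra.
exists (Num.min d d1) => [|h p q r]; first by rewrite lt_min d0.
rewrite lt_min => /andP[hd hd1] pq qr pr.
have h0 : 0 <= h by rewrite (le_trans _ pq).
have := Hd q r (le_lt_trans qr hd).
set E := P r - P q - G q * (B r - B q) => HE.
have -> : X p q + X q r - X p r =
    (A q - A p - a p * (G q - G p)) * (B r - B q) + (a q - a p) * E.
  by rewrite /X /E; ring.
have i1 : `|A q - A p - a p * (G q - G p)| <= C * h ^+ 2.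
  by rewrite (le_trans (HA p q))// ler_wpM2l// ler_sqr// nnegrE.
have i2 : `|B r - B q| <= `|K| * h.
  rewrite (le_trans (BK r q))// distrC (le_trans (ler_wpM2r _ (ler_norm K)))//.
  by rewrite ler_wpM2l.
have i3 : `|a q - a p| <= C * h.
  by rewrite (le_trans (alip q p))// distrC ler_wpM2l.
have i4 : `|E| <= e1 * h by rewrite (le_trans HE)// ler_wpM2l// ltW.
rewrite (le_trans (ler_normD _ _))// !normrM.
rewrite (le_trans (lerD (ler_pM _ _ i1 i2) (ler_pM _ _ i3 i4)))//.
have k1 : d1 * (C * `|K|) <= e / 2.
  rewrite /d1 -[X in _ <= X]mulr1 -mulrA ler_wpM2l ?divr_ge0 ?ltW//.
  by rewrite mulrC ltr_pdivrMr; lra.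
have k2 : e1 * C <= e / 2.
  rewrite /e1 -[X in _ <= X]mulr1 -mulrA ler_wpM2l ?divr_ge0 ?ltW//.
  by rewrite mulrC ltr_pdivrMr; lra.
have -> : C * h ^+ 2 * (`|K| * h) + C * h * (e1 * h) = h ^+ 2 * (h * (C * `|K|) + e1 * C).
  by ring.
rewrite mulrC ler_wpM2r ?sqr_ge0//.
have : h * (C * `|K|) <= d1 * (C * `|K|) by rewrite ler_wpM2r// ltW.
lra.
Qed.

(** By [prim_lip] the primitives of two close approximations differ by a function with a small
    Lipschitz constant. Normalized to vanish at 0 they converge, and [diffP] controls the limit in
    Lipschitz seminorm, which preserves errors o(|p - q|). *)
Lemma has_prim_unif A B K : lip K B ->
  (forall e, 0 < e -> exists2 A', has_prim A' B & forall p, `|A' p - A p| <= e) ->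
  has_prim A B.
Proof.
move=> BK H.
pose eps (n : nat) : R := n.+1%:R^-1.
have eps0 n : 0 < eps n by rewrite invr_gt0 ltr0n.
have /choice[F HF] : forall n, exists AP : (V -> R) * (V -> R),
    [/\ prim AP.1 B AP.2, forall p, `|AP.1 p - A p| <= eps n & AP.2 0 = 0].
  move=> n; have [A' [P' HP'] HA'] := H _ (eps0 n).
  exists (A', fun p => P' p - P' 0); split => //=; last by rewrite subrr.
  exact: prim_shift.
pose An n := (F n).1; pose Pn n := (F n).2.
have K0 : 0 <= `|K| by [].
have BK' : lip `|K| B.
  by move=> p q; rewrite (le_trans (BK p q))// ler_wpM2r// ler_norm.
have diff n m p q : `|(Pn n p - Pn m p) - (Pn n q - Pn m q)| <=
    (eps n + eps m) * `|K| * `|p - q|.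
  have [Hn An_le _] := HF n; have [Hm Am_le _] := HF m.
  apply: (prim_lip BK' (prim_sub Hn Hm) mid_closedT) => // r _.
  have := An_le r; have := Am_le r; rewrite !ler_norml => /andP[? ?] /andP[? ?].
  by apply/andP; split; lra.
have /choice[P HP] : forall q, exists l, forall n, `|Pn n q - l| <= eps n * `|K| * `|q|.
  move=> q; apply: nested_limit => n m; have := diff n m q 0.
  have [_ _ n0] := HF n; have [_ _ m0] := HF m.
  rewrite /Pn n0 m0 !subr0 ler_norml.
  by move=> /andP[]; lra.
have diffP n p q : `|(Pn n p - P p) - (Pn n q - P q)| <= eps n * `|K| * `|p - q|.
  rewrite -subr_le0.
  apply: (@le_eps _ _ (`|K| * `|p - q| + `|K| * `|p| + `|K| * `|q|)) => [|e e0].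
    by rewrite !addr_ge0 ?mulr_ge0.
  have [m me] := natSinv_small e0; rewrite -/(eps m) in me.
  have := diff n m p q; have := HP p m; have := HP q m.
  have i1 : eps m * `|K| * `|q| <= e * `|K| * `|q| by rewrite !ler_wpM2r// ltW.
  have i2 : eps m * `|K| * `|p| <= e * `|K| * `|p| by rewrite !ler_wpM2r// ltW.
  have i3 : eps m * `|K| * `|p - q| <= e * `|K| * `|p - q|.
    by rewrite !ler_wpM2r// ltW.
  rewrite !ler_norml => /andP[? ?] /andP[? ?] /andP[? ?].
  by rewrite lerBlDr ler_norml; apply/andP; split; lra.
exists P => e e0.
have e1 : 0 < e / 2 / (2 * `|K| + 1) by rewrite !divr_gt0//; lra.
have [n ne] := natSinv_small e1; rewrite -/(eps n) in ne.
have [Hn An_le _] := HF n; have [d d0 Hd] := Hn _ (divr_gt0 e0 (ltr0n R 2)).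
exists d => // p q /Hd h1; have h2 := diffP n p q.
have : `|(An n p - A p) * (B q - B p)| <= eps n * (`|K| * `|p - q|).
  by rewrite normrM (distrC p q); apply: ler_pM => //; exact: An_le.
have : (eps n * `|K| * 2) * `|p - q| <= e / 2 * `|p - q|.
  rewrite ler_wpM2r//; have := eps0 n.
  have : eps n * (2 * `|K| + 1) <= e / 2 by rewrite -ler_pdivlMr ?ltW//; lra.
  lra.
move: h1 h2; rewrite -/(An n) -/(Pn n) !ler_norml => /andP[? ?] /andP[? ?] ? /andP[? ?].
by apply/andP; split; lra.
Qed.

End Primitives.

(** * A lattice of functions with primitives *)

Lemma sqr_gap (R : realType) (a b h : R) : 0 <= a -> 0 <= b -> 0 <= h ->
  a ^+ 2 = b ^+ 2 + h ^+ 2 -> a - b <= h.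
Proof. by move=> *; rewrite leNgt; apply/negP => ?; nra. Qed.

(** * A smooth approximation of the absolute value *)

Section SmoothAbs.
Context (R : realType) (h : R) (h0 : 0 < h).
Implicit Types s t : R.

(** Stays within [h] of the absolute value and has the second-order bounds ([sabs_taylor],
    [sabs_slope_lip]) required by [has_prim_chain]. *)
Definition sabs s := Num.sqrt (s ^+ 2 + h ^+ 2).

Lemma sabs_sqr s : sabs s ^+ 2 = s ^+ 2 + h ^+ 2.
Proof. by rewrite sqr_sqrtr// addr_ge0// sqr_ge0. Qed.

Lemma sabs_ge s : h <= sabs s.
Proof.
rewrite -(@ler_pXn2r _ 2)// ?nnegrE ?sqrtr_ge0//; last by rewrite ltW.
by rewrite sabs_sqr lerDr sqr_ge0.
Qed.

Lemma sabs_gt0 s : 0 < sabs s. Proof. exact: lt_le_trans (sabs_ge s). Qed.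

Lemma sabs_ge_norm s : `|s| <= sabs s.
Proof.
rewrite -(@ler_pXn2r _ 2)// ?nnegrE ?sqrtr_ge0//.
by rewrite sabs_sqr real_normK ?num_real// lerDl sqr_ge0.
Qed.

Lemma sabs_approx s : `|sabs s - `|s| | <= h.
Proof.
rewrite ger0_norm ?subr_ge0 ?sabs_ge_norm//.
have := sabs_sqr s; have := sabs_gt0 s; have := normr_ge0 s.
have : `|s| ^+ 2 = s ^+ 2 by rewrite real_normK ?num_real.
by move=> e ? ? E; apply: sqr_gap; rewrite ?E ?e// ?ltW.
Qed.

Lemma sabs_slope_le1 s : `|s / sabs s| <= 1.
Proof.
by rewrite normrM normfV (gtr0_norm (sabs_gt0 s)) ler_pdivrMr ?sabs_gt0// mul1r sabs_ge_norm.
Qed.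

Lemma sabs_lip s t : `|sabs t - sabs s| <= `|t - s|.
Proof.
have := sabs_sqr s; have := sabs_sqr t; have := sabs_gt0 s; have := sabs_gt0 t.
have := sabs_ge_norm s; have := sabs_ge_norm t.
set a : R := sabs s; set b : R := sabs t => h1 h2 h3 h4 h5 h6.
have e : (b - a) * (b + a) = (t - s) * (t + s) by rewrite -!subr_sqr; lra.
have ba : 0 < b + a by lra.
rewrite -(ler_pM2r ba) -[X in _ * X <= _](gtr0_norm ba) -normrM e normrM ler_wpM2l//.
rewrite (le_trans (ler_normD _ _))//; lra.
Qed.

Lemma sabs_taylor s t : `|sabs t - sabs s - s / sabs s * (t - s)| <= h^-1 * (t - s) ^+ 2.
Proof.
have := sabs_sqr s; have := sabs_sqr t; have := sabs_gt0 s; have := sabs_gt0 t.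
have := sabs_ge s; have l := sabs_lip s t.
set a : R := sabs s in l *; set b : R := sabs t in l * => ha b0 a0 eb ea.
have -> : b - a - s / a * (t - s) = ((t - s) ^+ 2 - (b - a) ^+ 2) / (2 * a).
  have : b ^+ 2 - a ^+ 2 = t ^+ 2 - s ^+ 2 by lra.
  move=> e; have {}e : (b - a) ^+ 2 = t ^+ 2 - s ^+ 2 + 2 * a ^+ 2 - 2 * a * b.
    have -> : (b - a) ^+ 2 = b ^+ 2 - a ^+ 2 + 2 * a ^+ 2 - 2 * a * b by ring.
    by rewrite e.
  by rewrite e; field; lra.
have l2 : (b - a) ^+ 2 <= (t - s) ^+ 2.
  by rewrite -[X in X <= _]real_normK ?num_real// -[X in _ <= X]real_normK ?num_real// ler_pXn2r// nnegrE.
rewrite ger0_norm; last by rewrite divr_ge0//; lra.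
rewrite ler_pdivrMr; last by lra.
have h' : 1 <= h^-1 * a by rewrite mulrC ler_pdivlMr// mul1r.
have := sqr_ge0 (b - a); have := sqr_ge0 (t - s).
have -> : h^-1 * (t - s) ^+ 2 * (2 * a) = 2 * (t - s) ^+ 2 * (h^-1 * a) by ring.
nra.
Qed.

Lemma sabs_slope_lip s t : `|t / sabs t - s / sabs s| <= 2 * h^-1 * `|t - s|.
Proof.
have := sabs_gt0 s; have := sabs_gt0 t; have := sabs_ge s; have := sabs_ge t.
have l := sabs_lip s t; have ls := sabs_slope_le1 s.
set a : R := sabs s in ls l *; set b : R := sabs t in l *.
move=> hb ha b0 a0; rewrite -/a in ls.
have -> : t / b - s / a = ((t - s) - s / a * (b - a)) / b by field; lra.
rewrite normrM normfV (gtr0_norm b0) ler_pdivrMr//.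
have h' : 1 <= h^-1 * b by rewrite mulrC ler_pdivlMr// mul1r.
rewrite (le_trans (ler_normB _ _))// normrM.
have : `|s / a| * `|b - a| <= 1 * `|t - s| by rewrite ler_pM.
have -> : 2 * h^-1 * `|t - s| * b = 2 * `|t - s| * (h^-1 * b) by ring.
have := normr_ge0 (t - s); nra.
Qed.

End SmoothAbs.

(** * The lattice of functions whose form against a fixed [B] is exact *)

Section Tame.
Context (R : realType) (V : normedModType R).
Context (B : V -> R) (K : R) (BK : lip K B).
Implicit Types A : V -> R.

Definition nice A := exists M, (forall p, `|A p| <= M) /\ lip M A.

Lemma nice_pos A : nice A -> exists M, [/\ 0 < M, forall p, `|A p| <= M & lip M A].
Proof.
move=> [M [AM Al]]; exists (`|M| + 1); split; first by rewrite ltr_pwDr.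
  by move=> p; rewrite (le_trans (AM p))// (le_trans (ler_norm _))// lerDl.
move=> p q; rewrite (le_trans (Al p q))// ler_wpM2r//.
by rewrite (le_trans (ler_norm _))// lerDl.
Qed.

Lemma nice_cst c : nice (fun=> c).
Proof. by exists `|c|; split=> // p q; rewrite subrr normr0 mulr_ge0. Qed.

Lemma nice_add A A' : nice A -> nice A' -> nice (fun p => A p + A' p).
Proof.
move=> [M [AM Al]] [M' [AM' Al']]; exists (M + M'); split.
  by move=> p; rewrite (le_trans (ler_normD _ _))// lerD.
move=> p q; by rewrite opprD addrACA mulrDl (le_trans (ler_normD _ _))// lerD.
Qed.

Lemma nice_mul A A' : nice A -> nice A' -> nice (fun p => A p * A' p).
Proof.
move=> /nice_pos[M [M0 AM Al]] /nice_pos[M' [M'0 AM' Al']].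
exists (M * M' + M * M'); split.
  by move=> p; rewrite normrM (le_trans (ler_pM _ _ (AM p) (AM' p)))// lerDl mulr_ge0 ?ltW.
move=> p q.
have -> : A p * A' p - A q * A' q = A p * (A' p - A' q) + (A p - A q) * A' q by ring.
rewrite (le_trans (ler_normD _ _))// !normrM mulrDl lerD//.
  by rewrite -mulrA ler_pM//; exact: Al'.
by rewrite mulrAC ler_pM//; exact: Al.
Qed.

Lemma nice_comp (phi : R -> R) A : (forall s t, `|phi s - phi t| <= `|s - t|) ->
  nice A -> nice (phi \o A).
Proof.
move=> Hphi [M [AM Al]]; exists (M + `|phi 0|); split.
  move=> p /=; have := Hphi (A p) 0; rewrite subr0 => h.
  rewrite -[phi (A p)](subrK (phi 0)) (le_trans (ler_normD _ _))// lerD2r.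
  exact: le_trans h (AM p).
move=> p q /=; rewrite (le_trans (Hphi _ _))// (le_trans (Al _ _))//.
by rewrite ler_wpM2r// lerDl.
Qed.

Definition adm A := nice A /\ has_prim A B.

Lemma adm_cst c : adm (fun=> c).
Proof.
split; first exact: nice_cst.
exists (fun p => c * B p); have := prim_scale c (prim_id B).
by rewrite (_ : (fun=> c * 1) = fun=> c) //; apply/funext => ?; rewrite mulr1.
Qed.

Lemma adm_add A A' : adm A -> adm A' -> adm (fun p => A p + A' p).
Proof.
move=> [nA [P HP]] [nA' [P' HP']]; split; first exact: nice_add.
by exists (fun p => P p + P' p); exact: prim_add.
Qed.

Lemma adm_scale c A : adm A -> adm (fun p => c * A p).
Proof.
move=> [nA [P HP]]; split; first exact: nice_mul (nice_cst c) nA.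
by exists (fun p => c * P p); exact: prim_scale.
Qed.

Lemma adm_opp A : adm A -> adm (fun p => - A p).
Proof.
move=> /(adm_scale (-1)).
by rewrite (_ : (fun p => _ * _) = fun p => - A p)//; apply/funext => p; rewrite mulN1r.
Qed.

Lemma adm_sub A A' : adm A -> adm A' -> adm (fun p => A p - A' p).
Proof. by move=> hA /adm_opp; exact: adm_add. Qed.

(** The chain rule with slope [2 * A]; products then follow by polarization. *)
Lemma adm_sqr A : adm A -> adm (fun p => A p ^+ 2).
Proof.
move=> [/[dup] nA /nice_pos[M [M0 AM Al]] hA]; split.
  by under eq_fun do rewrite expr2; exact: nice_mul.
apply: (has_prim_chain (a := fun p => 2 * A p) (G := A) (K := K) (C := 2 * M + M ^+ 2) BK hA).
- move=> p q.
  have -> : A q ^+ 2 - A p ^+ 2 - 2 * A p * (A q - A p) = (A p - A q) ^+ 2 by ring.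
  rewrite ger0_norm ?sqr_ge0//.
  have -> : (A p - A q) ^+ 2 = `|A p - A q| ^+ 2 by rewrite real_normK ?num_real.
  rewrite (@le_trans _ _ ((M * `|p - q|) ^+ 2))//.
    by rewrite ler_pXn2r ?nnegrE ?mulr_ge0// ?(ltW M0)//; exact: Al.
  by rewrite exprMn ler_wpM2r ?sqr_ge0// lerDr; lra.
- move=> p; rewrite normrM ger0_norm// (le_trans (ler_wpM2l _ (AM p)))// lerDl.
  exact: sqr_ge0.
- move=> p q; rewrite -mulrBr normrM ger0_norm//.
  have : 2 * `|A p - A q| <= 2 * (M * `|p - q|) by rewrite ler_wpM2l//; exact: Al.
  have : 0 <= M ^+ 2 * `|p - q| by rewrite mulr_ge0// sqr_ge0.
  lra.
Qed.

Lemma adm_mul A A' : adm A -> adm A' -> adm (fun p => A p * A' p).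
Proof.
move=> hA hA'; have := adm_scale (2^-1) (adm_sub (adm_sqr (adm_add hA hA'))
  (adm_add (adm_sqr hA) (adm_sqr hA'))).
rewrite (_ : (fun p => _) = fun p => A p * A' p)//.
by apply/funext => p; field.
Qed.

(** The step from an algebra to a lattice: the chain rule applies to [sabs e], and letting [e] tend
    to 0 is a uniform limit. *)
Lemma adm_abs A : adm A -> adm (fun p => `|A p|).
Proof.
move=> [/[dup] nA /nice_pos[M [M0 AM Al]] hA]; split.
  apply: (@nice_comp (fun s => `|s|)) => // s t; exact: ler_dist_dist.
apply: (has_prim_unif BK) => e e0; exists (sabs e \o A); last first.
  by move=> p /=; exact: sabs_approx.
have ei : 0 < e^-1 by rewrite invr_gt0.
apply: (has_prim_chain (a := fun p => A p / sabs e (A p)) (G := A) (K := K)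
  (C := 1 + 2 * e^-1 * M + e^-1 * M ^+ 2) BK hA).
- move=> p q /=; rewrite (le_trans (sabs_taylor e0 _ _))//.
  have -> : (A q - A p) ^+ 2 = `|A p - A q| ^+ 2 by rewrite real_normK ?num_real//; ring.
  have h : `|A p - A q| ^+ 2 <= (M * `|p - q|) ^+ 2.
    by rewrite ler_pXn2r ?nnegrE ?mulr_ge0// ?(ltW M0)//; exact: Al.
  rewrite (le_trans (ler_wpM2l (ltW ei) h))// exprMn mulrA ler_wpM2r ?sqr_ge0//.
  rewrite lerDr addr_ge0// mulr_ge0// ?(ltW M0)// mulr_ge0// ltW//.
- move=> p; rewrite (le_trans (sabs_slope_le1 e0 _))// -addrA lerDl.
  have [? ?] := (ltW ei, ltW M0); by rewrite addr_ge0// ?mulr_ge0.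
- move=> p q; rewrite (le_trans (sabs_slope_lip e0 _ _))//.
  have : 2 * e^-1 * `|A p - A q| <= 2 * e^-1 * (M * `|p - q|).
    by rewrite ler_wpM2l ?mulr_ge0// ?(ltW ei)//; exact: Al.
  have : 0 <= e^-1 * M ^+ 2 * `|p - q| by rewrite !mulr_ge0// ?(ltW ei)// ?sqr_ge0// ltW.
  have := normr_ge0 (p - q); lra.
Qed.

Lemma adm_max A A' : adm A -> adm A' -> adm (fun p => Num.max (A p) (A' p)).
Proof.
move=> hA hA'; have := adm_scale (2^-1) (adm_add (adm_add hA hA') (adm_abs (adm_sub hA hA'))).
rewrite (_ : (fun p => _) = fun p => Num.max (A p) (A' p))//.
by apply/funext => p; rewrite maxr_absE mulrC.
Qed.

Lemma adm_min A A' : adm A -> adm A' -> adm (fun p => Num.min (A p) (A' p)).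
Proof.
move=> hA hA'; have := adm_opp (adm_max (adm_opp hA) (adm_opp hA')).
rewrite (_ : (fun p => _) = fun p => Num.min (A p) (A' p))//.
by apply/funext => p; rewrite oppr_max !opprK.
Qed.

Lemma adm_unif A : nice A ->
  (forall e, 0 < e -> exists2 A', adm A' & forall p, `|A' p - A p| <= e) -> adm A.
Proof.
move=> nA H; split=> //; apply: (has_prim_unif BK) => e /H[A' [_ hA'] h].
by exists A'.
Qed.

End Tame.

Lemma prim_quad (R : realType) (V : normedModType R) (A B P : V -> R) M :
  (forall p q, `|P q - P p - A p * (B q - B p)| <= M * `|p - q| ^+ 2) ->
  prim A B P.
Proof.
move=> H e e0; have d0 : 0 < e / (`|M| + 1) by rewrite divr_gt0// ltr_pwDr.
exists (e / (`|M| + 1)) => // p q; rewrite ltr_pdivlMr ?ltr_pwDr// => h.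
rewrite (le_trans (H p q))// expr2 mulrA ler_wpM2r//.
have := ler_norm M; have := normr_ge0 (p - q); nra.
Qed.

Lemma first_exit (R : realType) (T : R -> Prop) : T 0 -> ~ T 1 ->
  (forall t, 0 <= t -> t <= 1 -> T t -> exists2 r, 0 < r &
    forall s, 0 <= s -> s <= 1 -> `|s - t| < r -> T s) ->
  exists t, [/\ 0 < t, t <= 1, ~ T t & forall s, 0 <= s -> s < t -> T s].
Proof.
move=> T0 T1 To.
pose E := [set t | 0 <= t <= 1 /\ forall s, 0 <= s -> s <= t -> T s].
have E0 : E 0.
  split=> [|s s0 s1]; first by rewrite lexx ler01.
  by have -> : s = 0 by apply/eqP; rewrite eq_le s1.
have hE : has_sup E by split; [exists 0|exists 1 => t [/andP[]]].
have c0 : 0 <= sup E by exact: sup_upper_bound.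
have c1 : sup E <= 1 by apply: ge_sup; [exists 0|move=> t [/andP[]]].
have below s : 0 <= s -> s < sup E -> T s.
  move=> s0 sE; have [|t [t01 Ht]] := @sup_adherent _ _ (sup E - s) _ hE.
    by rewrite subr_gt0.
  by rewrite subKr => st; apply: Ht => //; exact: ltW.
have nT : ~ T (sup E).
  move=> Tc; have [r r0 Hr] := To _ c0 c1 Tc.
  have [c1'|c1'] := ltP (sup E) 1; last first.
    by apply: T1; have <- : sup E = 1 by apply/eqP; rewrite eq_le c1.
  pose t := Num.min 1 (sup E + r / 2).
  have t1 : t <= 1 by rewrite ge_min lexx.
  have tr : t <= sup E + r / 2 by rewrite ge_min lexx orbT.
  have ct : sup E < t by rewrite lt_min c1' ltrDl divr_gt0.
  suff /(sup_upper_bound hE) : E t by move=> ?; lra.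
  split=> [|s s0 st]; first by apply/andP; split; lra.
  have [/(below _ s0)//|cs] := ltP s (sup E).
  by apply: Hr => //; [lra|rewrite ger0_norm; lra].
exists (sup E); split => //; rewrite lt_neqAle c0 andbT.
by apply/eqP => e; apply: nT; rewrite -e.
Qed.

(** * Segments, open sets and gluing of primitives *)

Section Segments.
Context (R : realType) (V : normedModType R).
Implicit Types (W : set V) (a b p : V).

Definition metric_open W := forall a, W a -> exists2 r, 0 < r & forall b, `|b - a| < r -> W b.

Definition adherent W q := forall e, 0 < e -> exists2 v, W v & `|v - q| < e.

Definition pt a b (t : R) := a + t *: (b - a).

Lemma pt0 a b : pt a b 0 = a. Proof. by rewrite /pt scale0r addr0. Qed.

Lemma pt1 a b : pt a b 1 = b. Proof. by rewrite /pt scale1r addrC subrK. Qed.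

Lemma pt_dist a b s t : `|pt a b s - pt a b t| = `|s - t| * `|a - b|.
Proof. by rewrite /pt opprD addrACA subrr add0r -scalerBl normrZ (distrC b). Qed.

Lemma pt_norm r p a b t : 0 <= t -> t <= 1 -> `|a - p| < r -> `|b - p| < r ->
  `|pt a b t - p| < r.
Proof.
move=> t0 t1 ha hb.
have -> : pt a b t - p = (1 - t) *: (a - p) + t *: (b - p).
  rewrite /pt (addrAC a) scalerBl scale1r -[RHS]addrA; congr (_ + _).
  by rewrite [RHS]addrC -scalerBr opprB addrA subrK.
rewrite (le_lt_trans (ler_normD _ _))// !normrZ (ger0_norm t0) ger0_norm ?subr_ge0//.
have [->|t0'] := eqVneq t 0; first by rewrite subr0 mul1r mul0r addr0.
have {}t0 : 0 < t by rewrite lt_neqAle eq_sym t0'.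
have : t * `|b - p| < t * r by rewrite ltr_pM2l.
have : (1 - t) * `|a - p| <= (1 - t) * r by rewrite ler_wpM2l ?subr_ge0// ltW.
lra.
Qed.

Lemma mid_pt a b s t : mid (pt a b s) (pt a b t) = pt a b ((s + t) / 2).
Proof.
rewrite /mid /pt addrACA -scalerDl [LHS]scalerDr scalerA (mulrC _ (s + t)).
congr (_ + _).
by rewrite -mulr2n -[a *+ 2]scaler_nat scalerA mulVf ?scale1r ?pnatr_eq0.
Qed.

Lemma mid_closed_seg a b : mid_closed [set pt a b t | t in `[0, 1]].
Proof.
move=> _ _ [s + <-] [t + <-]; rewrite /= !in_itv/= => /andP[? ?] /andP[? ?].
exists ((s + t) / 2); last by rewrite mid_pt.
by rewrite /= in_itv/=; apply/andP; split; lra.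
Qed.

Lemma mid_closed_ball p r : mid_closed [set v | `|v - p| < r].
Proof.
move=> a b ha hb /=; have -> : mid a b = pt a b 2^-1.
  by have := mid_pt a b 0 1; rewrite pt0 pt1 add0r mul1r.
by apply: pt_norm => //; lra.
Qed.

Lemma seg_exit W a b : metric_open W -> W a -> ~ W b -> exists z,
  [/\ ~ W z, adherent W z, `|a - z| <= `|a - b| & `|b - z| <= `|a - b|].
Proof.
move=> oW Wa Wb; pose T t := W (pt a b t).
have [||t t0 t1 /oW[r r0 Hr]|t [t0 t1 nT HT]] := @first_exit _ T.
- by rewrite /T pt0.
- by rewrite /T pt1.
- exists (r / (`|a - b| + 1)) => [|s _ _]; first by rewrite divr_gt0// ltr_pwDr.
  rewrite ltr_pdivlMr ?ltr_pwDr// => st; apply: Hr; rewrite pt_dist.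
  by rewrite (le_lt_trans _ st)// ler_wpM2l// lerDl.
exists (pt a b t); split => //.
- move=> e e0; pose s := Num.max 0 (t - e / 2 / (`|a - b| + 1)).
  have ab1 : 0 < `|a - b| + 1 by rewrite ltr_pwDr.
  have st : s < t by rewrite gt_max t0/= ltrBlDr ltrDl !divr_gt0.
  have s0 : 0 <= s by rewrite le_max lexx.
  exists (pt a b s); first exact: HT.
  rewrite pt_dist distrC gtr0_norm ?subr_gt0//.
  have : t - s <= e / 2 / (`|a - b| + 1) by rewrite lerBlDr -lerBlDl le_max lexx orbT.
  rewrite ler_pdivlMr// => h.
  have : (t - s) * `|a - b| <= (t - s) * (`|a - b| + 1).
    by rewrite ler_wpM2l ?lerDl// subr_ge0 ltW.
  lra.
- rewrite -{1}(pt0 a b) pt_dist sub0r normrN gtr0_norm//.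
  by rewrite ler_piMl.
- rewrite -{1}(pt1 a b) pt_dist ger0_norm ?subr_ge0//.
  by rewrite ler_piMl// gerBl ltW.
Qed.

Lemma prim_const (C : set V) A B P K : lip K B -> prim A B P -> mid_closed C ->
  (forall p, C p -> A p = 0) -> forall p q, C p -> C q -> P p = P q.
Proof.
move=> BK HP mC A0 p q Cp Cq; apply/eqP; rewrite -subr_eq0 -normr_le0.
rewrite (le_trans (prim_lip (M := 0) BK HP mC _ Cp Cq))// ?mul0r// => r Cr.
by rewrite A0// normr0.
Qed.

(** [A] vanishes near the boundary of [W], so [P] is locally constant there. The cochain equal to
    the increment of [P] when it starts in [W], and to 0 otherwise, is then exactly additive on
    triangles of size below [k / 2]. *)
Lemma has_prim_glue W A B K k : lip K B -> 0 < k -> has_prim A B ->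
  (forall a b, W a -> ~ W b -> `|a - b| < k -> A a = 0 /\ A b = 0) ->
  has_prim (fun p => if `[<W p>] then A p else 0) B.
Proof.
move=> BK k0 [P HP] collar.
pose X p q := if `[<W p>] then P q - P p else 0.
have [e e0|Q HQ] := @sewing _ _ X; last first.
  exists Q => e e0; have [d d0 Hd] := HQ _ (divr_gt0 e0 (ltr0n R 2)).
  have [d' d'0 Hd'] := HP _ (divr_gt0 e0 (ltr0n R 2)).
  exists (Num.min d d') => [|p q]; first by rewrite lt_min d0.
  rewrite lt_min => /andP[/Hd + /Hd']; rewrite /X.
  have := normr_ge0 (p - q); case: asboolP => _; rewrite !ler_norml.
    by move=> ? /andP[? ?] /andP[? ?]; apply/andP; split; lra.
  by move=> ? /andP[? ?] /andP[? ?]; apply/andP; split; nra.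
exists (k / 2) => [|h p q r hk pq qr pr]; first by rewrite divr_gt0.
have h0 : 0 <= h by rewrite (le_trans _ pq).
have key a b : W a -> ~ W b -> `|a - b| <= h ->
    forall c c', `|c - a| <= h -> `|c' - a| <= h -> P c = P c'.
  move=> Wa Wb ab c c' ca c'a.
  apply: (prim_const BK HP (@mid_closed_ball a (k / 2))) => [v /= va||]; last 2 first.
  - exact: le_lt_trans hk.
  - exact: le_lt_trans hk.
  have [Wv|Wv] := pselect (W v); last first.
    by apply: (collar a v Wa Wv _).2; rewrite distrC; lra.
  apply: (collar v b Wv Wb _).1; have := ler_distD a v b; lra.
suff -> : X p q + X q r - X p r = 0 by rewrite normr0 mulr_ge0 ?sqr_ge0// ltW.
have ? : `|q - p| <= h by rewrite distrC.
have ? : `|r - p| <= h by rewrite distrC.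
have ? : `|r - q| <= h by rewrite distrC.
have ? (v : V) : `|v - v| <= h by rewrite subrr normr0.
have alleq a b : W a -> ~ W b -> `|a - b| <= h -> `|p - a| <= h -> `|q - a| <= h ->
    `|r - a| <= h -> P p = P r /\ P q = P r.
  by move=> Wa Wb ab pa qa ra; split; apply: (key a b).
rewrite /X; case: asboolP => Wp; case: asboolP => Wq.
- by ring.
- by have [-> ->] : P p = P r /\ P q = P r; [exact: (alleq p q)|ring].
- by have [_ ->] : P p = P r /\ P q = P r; [exact: (alleq q p)|ring].
- by ring.
Qed.

End Segments.

(** Joined by a polygonal path inside the superlevel set at level [c]. Polygons are convenient
    because two primitives are compared along a segment by bisection. *)
Inductive conn (R : realType) (V : normedModType R) (h : V -> R) (c : R) (p : V) : V -> Prop :=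
| conn0 : c <= h p -> conn h c p p
| connS a b : conn h c p a -> (forall t, 0 <= t -> t <= 1 -> c <= h (pt a b t)) ->
    conn h c p b.

Section Conn.
Context (R : realType) (V : normedModType R) (h : V -> R).

Lemma conn_end c p q : conn h c p q -> c <= h q.
Proof. by case=> // a b _ /(_ 1); rewrite pt1; apply. Qed.

Lemma conn_start c p q : conn h c p q -> c <= h p.
Proof. by elim. Qed.

Lemma conn_le c c' p q : c' <= c -> conn h c p q -> conn h c' p q.
Proof.
move=> cc; elim=> [cp|a b _ IH H]; first by apply: conn0; exact: le_trans cp.
by apply: connS IH _ => t t0 t1; exact: le_trans (H t t0 t1).
Qed.

Lemma conn_sym c p q : conn h c p q -> conn h c q p.
Proof.
elim=> [cp|a b pa ap ab]; first exact: conn0.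
have bb : conn h c b b by apply: conn0; have := ab 1; rewrite pt1; apply.
suff ba : conn h c b a by elim: ap ba => // u v _ IH uv /IH bu; exact: connS uv.
apply: (connS bb) => t t0 t1.
have -> : pt b a t = pt a b (1 - t).
  rewrite /pt scalerBl scale1r -[in RHS]scalerN opprB addrA.
  by rewrite [X in _ = X + _]addrC subrK.
by apply: ab; lra.
Qed.

Lemma conn_trans c p q r : conn h c p q -> conn h c q r -> conn h c p r.
Proof. by move=> pq; elim=> // a b _ pa; exact: connS. Qed.

End Conn.

(** * Exact forms for the coordinates of a horizontal map *)

Section Horizontal.
Context (R : realType) (V : normedModType R) (N : nat) (F : nat -> V -> R) (C : R).
Hypothesis N3 : (2 < N)%N.
Hypothesis Fbd : forall i, (i < N)%N -> forall p, `|F i p| <= C.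
Hypothesis Flip : forall i, (i < N)%N -> lip C (F i).
Hypothesis Fhor : forall i, (0 < i)%N -> (i.+1 < N)%N -> forall p q,
  `|F i.+1 q - F i.+1 p - F i p * (F 0%N q - F 0%N p)| <= C * `|p - q| ^+ 2.

(** Two coordinates suffice: for [0 < i], [dF_(i+1) = F_i dF_0] turns [A dF_(i+1)] into
    [(A * F_i) dF_0], and products stay tame; see [tame_has_prim]. *)
Definition tame A := adm (F 0%N) A /\ adm (F 1%N) A.

Let N0 : (0 < N)%N. Proof. exact: leq_trans N3. Qed.
Let N1 : (1 < N)%N. Proof. exact: leq_trans N3. Qed.
Let F0lip := Flip N0.
Let F1lip := Flip N1.

Lemma tame_cst c : tame (fun=> c).
Proof. by split; exact: adm_cst. Qed.

Lemma tame_add A A' : tame A -> tame A' -> tame (fun p => A p + A' p).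
Proof. by move=> [? ?] [? ?]; split; exact: adm_add. Qed.

Lemma tame_scale c A : tame A -> tame (fun p => c * A p).
Proof. by move=> [? ?]; split; exact: adm_scale. Qed.

Lemma tame_sub A A' : tame A -> tame A' -> tame (fun p => A p - A' p).
Proof. by move=> [? ?] [? ?]; split; exact: adm_sub. Qed.

Lemma tame_abs A : tame A -> tame (fun p => `|A p|).
Proof. by move=> [? ?]; split; [exact: (adm_abs F0lip)|exact: (adm_abs F1lip)]. Qed.

Lemma tame_mul A A' : tame A -> tame A' -> tame (fun p => A p * A' p).
Proof. by move=> [? ?] [? ?]; split; [exact: (adm_mul F0lip)|exact: (adm_mul F1lip)]. Qed.

Lemma tame_max A A' : tame A -> tame A' -> tame (fun p => Num.max (A p) (A' p)).
Proof. by move=> [? ?] [? ?]; split; [exact: (adm_max F0lip)|exact: (adm_max F1lip)]. Qed.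

Lemma tame_min A A' : tame A -> tame A' -> tame (fun p => Num.min (A p) (A' p)).
Proof. by move=> [? ?] [? ?]; split; [exact: (adm_min F0lip)|exact: (adm_min F1lip)]. Qed.

Lemma tame_unif A : nice A ->
  (forall e, 0 < e -> exists2 A', tame A' & forall p, `|A' p - A p| <= e) -> tame A.
Proof.
by move=> nA H; split; [apply: (adm_unif F0lip)|apply: (adm_unif F1lip)] => // e /H[A' [? ?]];
  exists A'.
Qed.

Lemma tame_nice A : tame A -> nice A. Proof. by case=> -[]. Qed.

Let C0 : 0 <= C. Proof. by rewrite (le_trans _ (Fbd N0 0)). Qed.

Let Fnice i : (i < N)%N -> nice (F i).
Proof. by move=> iN; exists C; split; [exact: Fbd|exact: Flip]. Qed.

Let lipsq i p q : (i < N)%N -> `|(F i q - F i p) ^+ 2| <= C ^+ 2 * `|p - q| ^+ 2.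
Proof.
move=> iN; rewrite normrX -exprMn ler_pXn2r ?nnegrE ?mulr_ge0//.
by rewrite distrC; exact: Flip.
Qed.

(** The third coordinate starts everything: [F 2] is a primitive of [F_1 dF_0]. Every coordinate
    from index 2 on has differential [F_i dF_0], and the chain rule reduces it to [F 0]. *)
Lemma tame_coord i : (i < N)%N -> tame (F i).
Proof.
have h00 : adm (F 0%N) (F 0%N).
  split; first exact: Fnice.
  exists (fun p => 2^-1 * F 0%N p ^+ 2); apply: (prim_quad (M := C ^+ 2)) => p q.
  have := lipsq p q N0.
  have -> : 2^-1 * F 0%N q ^+ 2 - 2^-1 * F 0%N p ^+ 2 - F 0%N p * (F 0%N q - F 0%N p) =
    2^-1 * (F 0%N q - F 0%N p) ^+ 2 by field.
  move=> h; rewrite normrM (@ger0_norm _ 2^-1)// ?invr_ge0//.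
  by have := normr_ge0 ((F 0%N q - F 0%N p) ^+ 2); lra.
have h11 : adm (F 1%N) (F 1%N).
  split; first exact: Fnice.
  exists (fun p => 2^-1 * F 1%N p ^+ 2); apply: (prim_quad (M := C ^+ 2)) => p q.
  have := lipsq p q N1.
  have -> : 2^-1 * F 1%N q ^+ 2 - 2^-1 * F 1%N p ^+ 2 - F 1%N p * (F 1%N q - F 1%N p) =
    2^-1 * (F 1%N q - F 1%N p) ^+ 2 by field.
  move=> h; rewrite normrM (@ger0_norm _ 2^-1)// ?invr_ge0//.
  by have := normr_ge0 ((F 1%N q - F 1%N p) ^+ 2); lra.
have h01 : adm (F 0%N) (F 1%N).
  split; first exact: Fnice.
  by exists (F 2%N); apply: (prim_quad (M := C)) => p q; exact: Fhor.
(* integration by parts: [x du = d(x u) - du_(k-1)] *)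
have h10 : adm (F 1%N) (F 0%N).
  split; first exact: Fnice.
  exists (fun p => F 0%N p * F 1%N p - F 2%N p).
  apply: (prim_quad (M := C ^+ 2 + C)) => p q.
  have := Fhor (ltn0Sn 0) N3 p q.
  have : `|(F 1%N q - F 1%N p) * (F 0%N q - F 0%N p)| <= C ^+ 2 * `|p - q| ^+ 2.
    rewrite normrM -exprMn expr2; apply: ler_pM => //.
      by rewrite distrC; exact: F1lip.
    by rewrite distrC; exact: F0lip.
  have := normr_ge0 ((F 1%N q - F 1%N p) * (F 0%N q - F 0%N p)).
  rewrite !ler_norml => _ /andP[? ?] /andP[? ?]; apply/andP; split; lra.
case: i => [|[|i]] iN; first by split.
  by split.
have i1N : (i.+1 < N)%N by exact: ltnW.
split; (split; first exact: Fnice).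
  by apply: (has_prim_chain (G := F 0%N) (a := F i.+1) F0lip h00.2) => [p q|p|p q];
    [exact: Fhor|exact: Fbd|exact: Flip].
by apply: (has_prim_chain (G := F 0%N) (a := F i.+1) F1lip h10.2) => [p q|p|p q];
  [exact: Fhor|exact: Fbd|exact: Flip].
Qed.

Lemma tame_has_prim A i : (i < N)%N -> tame A -> has_prim A (F i).
Proof.
case: i => [|[|i]] iN tA; first exact: tA.1.2.
  exact: tA.2.2.
have i1N : (i.+1 < N)%N by exact: ltnW.
have [[_ [P HP]] _] := tame_mul tA (tame_coord i1N).
have [M [M0 AM _]] := nice_pos (tame_nice tA).
exists P => e e0.
have [d d0 Hd] := HP _ (divr_gt0 e0 (ltr0n R 2)).
have C1 : 0 < M * C + 1 by rewrite ltr_pwDr// mulr_ge0// ltW.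
exists (Num.min d (e / 2 / (M * C + 1))) => [|p q].
  by rewrite lt_min d0 !divr_gt0.
rewrite lt_min => /andP[/Hd h1]; rewrite ltr_pdivlMr// => h2.
have h3 : `|A p * (F i.+2 q - F i.+2 p - F i.+1 p * (F 0%N q - F 0%N p))| <=
    M * (C * `|p - q| ^+ 2) by rewrite normrM ler_pM//; exact: Fhor.
have h4 : M * (C * `|p - q| ^+ 2) <= e / 2 * `|p - q|.
  have -> : M * (C * `|p - q| ^+ 2) = (`|p - q| * (M * C)) * `|p - q| by ring.
  by rewrite ler_wpM2r//; have := normr_ge0 (p - q); lra.
move: h1 h3; rewrite !ler_norml => /andP[? ?] /andP[? ?]; apply/andP; split; lra.
Qed.

(** * The height *)

Section Height.
Context (D : V -> V -> R) (L : R) (Z : set V) (o : V).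
Hypothesis D_ge0 : forall p q, 0 <= D p q.
Hypothesis D_tri : forall p q r, D p r <= D p q + D q r.
Hypothesis D_lip : forall p q, D p q <= L * `|p - q|.
Hypothesis D_sep : forall e, 0 < e -> exists M, forall p q,
  D p q <= M * (\sum_(i < N) `|F i p - F i q|) + e.
Hypothesis L0 : 0 < L.
Hypothesis Zo : Z o.
Hypothesis FZ : forall z i, Z z -> (i < N)%N -> F i z = F i o.
Hypothesis Z_near : forall p, exists2 z, Z z & `|p - z| <= 1.
Hypothesis Z_net : forall e, 0 < e -> exists s : seq V, forall q, ~ Z q ->
  exists2 z, z \in s & `|q - z| < e.

Definition admissible A := [/\ tame A, lip L A & forall z, Z z -> A z = A o].

Lemma nice_ptd K A : lip K A -> (forall z, Z z -> A z = A o) -> nice A.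
Proof.
move=> Al AZ; have AK : lip `|K| A.
  by move=> p q; rewrite (le_trans (Al p q))// ler_wpM2r// ler_norm.
exists (`|A o| + `|K|); split.
  move=> p; have [z Zz pz] := Z_near p.
  rewrite -(AZ z Zz) -[A p](subrK (A z)) addrC (le_trans (ler_normD _ _))// lerD2l.
  by rewrite (le_trans (AK p z))// ler_piMr.
by move=> p q; rewrite (le_trans (AK p q))// ler_wpM2r// lerDr.
Qed.

Lemma admissible_max A A' : admissible A -> admissible A' ->
  admissible (fun p => Num.max (A p) (A' p)).
Proof.
move=> [tA lA ZA] [tA' lA' ZA']; split; first exact: tame_max.
  move=> p q; have := lA p q; have := lA' p q.
  rewrite !ler_norml => /andP[? ?] /andP[? ?]; rewrite !maxEle.
  by case: ifP => ?; case: ifP => ?; apply/andP; split; lra.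
by move=> z Zz; rewrite ZA// ZA'.
Qed.

Lemma admissible_subc A c : admissible A -> admissible (fun p => A p - c).
Proof.
move=> [tA lA ZA]; split; first exact/tame_sub/tame_cst.
  by move=> p q; rewrite opprB addrA subrK; exact: lA.
by move=> z Zz; rewrite ZA.
Qed.

Lemma admissible0 : admissible (fun=> 0).
Proof.
split; [exact: tame_cst| |by []].
by move=> p q; rewrite subrr normr0 mulr_ge0// ltW.
Qed.

(** The smallest pseudo-distance for which all admissible functions are 1-Lipschitz; it plays the
    role of the metric of the tree. *)
Definition dist p q := sup [set r | exists2 A, admissible A & r = A q - A p].

Let dist_has_sup p q : has_sup [set r | exists2 A, admissible A & r = A q - A p].
Proof.
split; first by exists (0 - 0), (fun=> 0) => //; exact: admissible0.
exists (L * `|q - p|) => _ [A [_ lA _] ->].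
by rewrite (le_trans (ler_norm _)).
Qed.

Lemma le_dist A p q : admissible A -> A q - A p <= dist p q.
Proof. by move=> hA; apply: (sup_upper_bound (dist_has_sup p q)); exists A. Qed.

Lemma dist_approx e p q : 0 < e ->
  exists2 A, admissible A & dist p q - e < A q - A p.
Proof.
move=> e0; have [_ [A hA ->] h] := sup_adherent e0 (dist_has_sup p q).
by exists A.
Qed.

Lemma dist_ge0 p q : 0 <= dist p q.
Proof. by have := le_dist p q admissible0; rewrite subrr. Qed.

Lemma distxx p : dist p p = 0.
Proof.
apply/eqP; rewrite eq_le dist_ge0 andbT; apply: ge_sup => [|_ [A _ ->]].
  exact: (dist_has_sup p p).1.
by rewrite subrr.
Qed.

Lemma lip_dist p : lip L (dist p).
Proof.
have key q q' : dist p q - dist p q' <= L * `|q - q'|.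
  rewrite lerBlDr; apply: ge_sup => [|_ [A hA ->]]; first exact: (dist_has_sup p q).1.
  have := le_dist p q' hA; case: hA => _ /(_ q q') + _.
  by rewrite ler_norml => /andP[_ ?]; lra.
move=> q q'; rewrite ler_norml key andbT lerNl opprB distrC; exact: key.
Qed.

Lemma dist_Z p z : Z z -> dist p z = dist p o.
Proof.
move=> Zz; congr (sup _); apply/seteqP; split => r [A hA ->]; exists A => //;
  by case: (hA) => _ _ /(_ z Zz) ->.
Qed.

(** The supremum is a uniform limit of finite maxima of admissible functions: [Z_net] gives finitely
    many test points off [Z], the point [o] represents all of [Z], and the common Lipschitz constant
    [L] covers the rest. *)
Lemma admissible_dist p : admissible (dist p).
Proof.
split; [|exact: lip_dist|exact: dist_Z].
apply: tame_unif; first by apply: nice_ptd; [exact: lip_dist|exact: dist_Z].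
move=> e e0.
have fin (s : seq V) : exists A, [/\ admissible A, forall q, A q <= dist p q &
    forall z, z \in s -> dist p z - e / 2 <= A z].
  elim: s => [|z s [A [hA Ale HA]]].
    exists (fun q => 0 - 0); split => //; first exact: admissible_subc admissible0.
    by move=> q; rewrite subrr dist_ge0.
  have [A' hA' HA'] := dist_approx p z (divr_gt0 e0 (ltr0n R 2)).
  exists (fun q => Num.max (A q) (A' q - A' p)); split.
  - exact/admissible_max/admissible_subc.
  - by move=> q; rewrite ge_max Ale le_dist.
  - move=> y; rewrite inE le_max => /orP[/eqP->|/HA ->//].
    by rewrite (ltW HA') orbT.
(* Moving to the net point costs [e / 4] for [A] and [e / 4] for [dist p]; the approximation at the
   net point costs [e / 2]. *)
have r0 : 0 < e / 4 / L by rewrite !divr_gt0.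
have [s Hs] := Z_net r0; have [A [[tA lA ZA] Ale HA]] := fin (o :: s).
exists A => // q; rewrite ler0_norm ?subr_le0// opprB.
have [Zq|/Hs[z zs]] := pselect (Z q).
  have := HA o; rewrite inE eqxx => /(_ isT); rewrite ZA// dist_Z//; lra.
rewrite ltr_pdivlMr// mulrC => qz; have := HA z; rewrite inE zs orbT => /(_ isT).
have := lA q z; have := lip_dist p q z; rewrite !ler_norml => /andP[_ ?] /andP[? _]; lra.
Qed.

Let E p q := \sum_(i < N) `|F i p - F i q|.

Let E_Z z q : Z z -> E z q = E o q.
Proof. by move=> Zz; apply: eq_bigr => i _; rewrite FZ. Qed.

Let E_Zr z q : Z q -> E z q = E z o.
Proof. by move=> Zz; apply: eq_bigr => i _; rewrite [F i q]FZ. Qed.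

Lemma D_Z z z' : Z z -> Z z' -> D z z' = 0.
Proof.
move=> Zz Zz'; apply/eqP; rewrite eq_le D_ge0 andbT.
apply: (@le_eps _ _ 1) => // e /D_sep[M /(_ z z')].
by rewrite -/(E z z') E_Z// E_Zr// {1}/E big1 ?mulr0 ?add0r ?mul1r// => i _; rewrite subrr normr0.
Qed.

Lemma Dxx p : D p p = 0.
Proof.
by apply/eqP; rewrite eq_le D_ge0 andbT (le_trans (D_lip p p))// subrr normr0 mulr0.
Qed.

Let lip_D p : lip L (D p).
Proof.
move=> q q'; have := D_tri p q q'; have := D_tri p q' q; have := D_lip q q'.
have := D_lip q' q; rewrite (distrC q' q) ler_norml => *; apply/andP; split; lra.
Qed.

Let D_Zr p z : Z z -> D p z = D p o.
Proof.
move=> Zz; have := D_tri p z o; have := D_tri p o z.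
rewrite (D_Z Zz Zo) (D_Z Zo Zz) !addr0 => ? ?.
by apply/eqP; rewrite eq_le; apply/andP.
Qed.

Let tame_E z : tame (E z).
Proof.
have key m : (m <= N)%N -> tame (fun q => \sum_(i < m) `|F i z - F i q|).
  elim: m => [_|m IH mN].
    by under eq_fun do rewrite big_ord0; exact: tame_cst.
  under eq_fun do rewrite big_ord_recr/=.
  apply: tame_add; first exact/IH/ltnW.
  by apply: tame_abs; apply: tame_sub; [exact: tame_cst|exact: tame_coord].
exact: key.
Qed.

Let lip_E z : lip (N%:R * C) (E z).
Proof.
move=> q q'; rewrite /E -sumrB (le_trans (ler_norm_sum _ _ _))//.
rewrite -mulrA mulr_natl -[X in _ *+ X](card_ord N) -sumr_const ler_sum// => i _.
rewrite (le_trans (ler_dist_dist _ _))//.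
have -> : F i z - F i q - (F i z - F i q') = F i q' - F i q by ring.
by rewrite distrC; exact: Flip.
Qed.

(** For each [z], the function [D p z + |M| * E z q + e / 4] of [q] is tame, lies above [D p] by the
    triangle inequality and [D_sep], and exceeds it by [e / 4] at [q = z]. Minima over finite nets
    approximate [D p] uniformly; their Lipschitz constant [K] depends on [e], which [tame_unif]
    allows. *)
Lemma admissible_D p : admissible (D p).
Proof.
split; [|exact: lip_D|exact: D_Zr].
apply: tame_unif; first by apply: nice_ptd; [exact: lip_D|exact: D_Zr].
move=> e e0; have [M HM] := D_sep (divr_gt0 e0 (ltr0n R 4)).
have E_ge0 z q : 0 <= E z q by rewrite sumr_ge0.
pose K := `|M| * (N%:R * C) + 1.
have K0 : 0 < K by rewrite ltr_pwDr// !mulr_ge0.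
have fin (s : seq V) : exists A, [/\ tame A, lip K A, forall q, D p q <= A q,
    forall z, Z z -> A z = A o & forall z, z \in o :: s -> A z <= D p z + e / 4].
  have hw z : [/\ tame (fun q => D p z + `|M| * E z q + e / 4),
      lip K (fun q => D p z + `|M| * E z q + e / 4),
      forall q, D p q <= D p z + `|M| * E z q + e / 4,
      forall y, Z y -> D p z + `|M| * E z y + e / 4 = D p z + `|M| * E z o + e / 4
    & D p z + `|M| * E z z + e / 4 = D p z + e / 4].
    split.
    - by apply: tame_add (tame_cst _); apply: tame_add (tame_cst _) _; exact: tame_scale.
    - move=> q q'.
      have -> : D p z + `|M| * E z q + e / 4 - (D p z + `|M| * E z q' + e / 4) =
        `|M| * (E z q - E z q') by ring.
      rewrite normrM normr_id mulrDl mul1r -mulrA ler_wpDr// ler_wpM2l//; exact: lip_E.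
    - move=> q; have := D_tri p z q; have := HM z q; rewrite -/(E z q).
      by have := ler_wpM2r (E_ge0 z q) (ler_norm M); lra.
    - by move=> y Zy; rewrite E_Zr.
    - by rewrite {1}/E big1 ?mulr0 ?addr0// => i _; rewrite subrr normr0.
  elim: s => [|z s [A [tA lA DA ZA HA]]].
    have [t1 l1 D1 Z1 e1] := hw o; eexists; split; [exact: t1|exact: l1|exact: D1|exact: Z1|].
    by move=> z; rewrite inE => /eqP ->; rewrite e1.
  have [t1 l1 D1 Z1 e1] := hw z.
  exists (fun q => Num.min (A q) (D p z + `|M| * E z q + e / 4)); split.
  - exact: tame_min.
  - move=> q q'; have := lA q q'; have := l1 q q'.
    rewrite !ler_norml => /andP[? ?] /andP[? ?]; rewrite !minEle.
    by case: ifP => ?; case: ifP => ?; apply/andP; split; lra.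
  - by move=> q; rewrite le_min DA D1.
  - by move=> y Zy; rewrite ZA// Z1.
  - move=> y; rewrite !inE ge_min => /or3P[yo|/eqP->|ys].
    + by rewrite HA// inE yo.
    + by rewrite e1 lexx orbT.
    + by rewrite HA// inE ys orbT.
have r0 : 0 < e / 4 / (L + K) by rewrite !divr_gt0// addr_gt0.
have [s Hs] := Z_net r0; have [A [tA lA DA ZA HA]] := fin s.
exists A => // q; rewrite ger0_norm ?subr_ge0//.
have [Zq|/Hs[z zs]] := pselect (Z q).
  by have := HA o; rewrite inE eqxx => /(_ isT); rewrite ZA// D_Zr//; lra.
have LK : 0 < L + K by rewrite addr_gt0.
rewrite (ltr_pdivlMr _ _ LK) (mulrC `|q - z|) => qz.
have := HA z; rewrite inE zs orbT => /(_ isT).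
by have := lA q z; have := lip_D p q z; rewrite !ler_norml => /andP[? ?] /andP[? ?]; lra.
Qed.

Lemma D_le_dist p q : D p q <= dist p q.
Proof. by have := le_dist p q (admissible_D p); rewrite Dxx subr0. Qed.

Hypothesis Z_conn : forall g : V -> R, (forall e, 0 < e -> exists2 d, 0 < d &
  forall z z', Z z -> Z z' -> `|z - z'| < d -> `|g z - g z'| <= e * `|z - z'|) ->
  forall z z', Z z -> Z z' -> g z = g z'.

Definition height := dist o.
Local Notation sg := height.

Let sg_Z z : Z z -> sg z = 0.
Proof. by move=> Zz; rewrite /sg dist_Z// distxx. Qed.

Lemma height_Z z : Z z -> height z = 0. Proof. exact: sg_Z. Qed.

Lemma height_le p : height p <= L.
Proof.
have [z Zz pz] := Z_near p; have := lip_dist o p z.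
rewrite -/(height p) -/(height z) (sg_Z Zz) subr0 => h.
by rewrite (le_trans (ler_norm _))// (le_trans h)// ler_piMr// ltW.
Qed.

(* Otherwise [height] could be raised on [W] by the barrier
   [height p + eta / 2 - dist p], contradicting its maximality. *)
Lemma perron (W : set V) p eta : metric_open W -> W p -> (forall z, Z z -> ~ W z) ->
  0 < eta -> exists q, [/\ ~ W q, adherent W q & sg q + dist p q <= sg p + eta].
Proof.
move=> oW Wp ZW eta0; apply: contrapT => H.
have {}H q : ~ W q -> adherent W q -> sg p + eta < sg q + dist p q.
  by move=> nW aW; rewrite ltNge; apply/negP => ?; apply: H; exists q.
pose g q := sg p + eta / 2 - dist p q - sg q.
have lg a b : `|g a - g b| <= 2 * L * `|a - b|.
  have := lip_dist p a b; have := lip_dist o a b; rewrite -!/(sg _) /g !ler_norml.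
  by move=> /andP[? ?] /andP[? ?]; apply/andP; split; lra.
(* At a boundary point of [W] the negated conclusion gives [g < - eta / 2]. As [g] is
   [2 * L]-Lipschitz, it is nonpositive up to distance [k] from there. *)
pose k := eta / 4 / L; have k0 : 0 < k by rewrite !divr_gt0.
have collar a b : W a -> ~ W b -> `|a - b| < k -> g a <= 0 /\ g b <= 0.
  move=> Wa nWb; rewrite ltr_pdivlMr// => ab.
  have [z [nWz aWz az bz]] := seg_exit oW Wa nWb.
  have := H z nWz aWz; have := lg a z; have := lg b z; rewrite !ler_norml /g.
  move=> /andP[_ h1] /andP[_ h2] h3.
  have i1 : 2 * L * `|a - z| <= 2 * (`|a - b| * L) by rewrite mulrAC -mulrA ler_wpM2l// ler_wpM2r// ltW.
  have i2 : 2 * L * `|b - z| <= 2 * (`|a - b| * L) by rewrite mulrAC -mulrA ler_wpM2l// ler_wpM2r// ltW.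
  by split; lra.
pose G q := Num.max 0 (g q).
have tE : tame G.
  apply: tame_max; first exact: tame_cst.
  have [t1 _ _] := admissible_dist p; have [t2 _ _] := admissible_dist o.
  by apply: tame_sub t2; apply: tame_sub t1; exact: tame_cst.
have E0 q : g q <= 0 -> G q = 0 by move=> ?; exact/max_idPl.
have collarE a b : W a -> ~ W b -> `|a - b| < k -> G a = 0 /\ G b = 0.
  by move=> Wa Wb ab; have [/E0 ? /E0 ?] := collar a b Wa Wb ab.
pose A q := sg q + if `[<W q>] then G q else 0.
(* On [W] the function [A] is the maximum of [sg] and [sg p + eta / 2 - dist p], both [L]-Lipschitz;
   close to the boundary it equals [sg] on both sides. *)
have lA : lip L A.
  move=> a b; apply: (@local_lipschitz _ _ setT R^o A L (@mid_closedT _ _)) => // e e0.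
  exists k => // {}a {}b _ _ ab.
  suff h : `|A a - A b| <= L * `|a - b|.
    by apply: (le_trans h); rewrite ler_wpM2r// lerDl ltW.
  have ba : `|b - a| < k by rewrite distrC.
  have lsg := lip_dist o a b; rewrite -!/(sg _) in lsg.
  rewrite /A; case: asboolP => Wa; case: asboolP => Wb.
  - have := lip_dist p a b; move: lsg; rewrite /G !maxEle /g !ler_norml.
    move=> /andP[? ?] /andP[? ?].
    by case: ifP => ?; case: ifP => ?; apply/andP; split; lra.
  - by rewrite (collarE a b Wa Wb ab).1 !addr0.
  - by rewrite (collarE b a Wb Wa ba).1 !addr0.
  - by rewrite !addr0.
have AZ z : Z z -> A z = A o.
  move=> Zz; rewrite /A (sg_Z Zz) (sg_Z Zo).
  by case: asboolP => [/ZW //|_]; case: asboolP => [/ZW //|_].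
have nA : nice A by exact: nice_ptd lA AZ.
have hA : admissible A.
  split => //; have [[[_ [P0 HP0]] [_ [P1 HP1]]] _ _] := admissible_dist o.
  split; (split; first by []).
    have [Q HQ] := has_prim_glue F0lip k0 tE.1.2 collarE.
    by exists (fun q => P0 q + Q q); exact: prim_add.
  have [Q HQ] := has_prim_glue F1lip k0 tE.2.2 collarE.
  by exists (fun q => P1 q + Q q); exact: prim_add.
have := le_dist o p hA; rewrite -/(sg p) /A (sg_Z Zo).
case: asboolP => // _; case: asboolP => [/ZW//|_].
have : g p <= G p by rewrite /G le_max lexx orbT.
rewrite /g distxx; lra.
Qed.

Lemma prim_const_Z A P i : (i < N)%N -> prim A (F i) P ->
  forall z z', Z z -> Z z' -> P z = P z'.
Proof.
move=> iN HP; apply: Z_conn => e e0; have [d d0 Hd] := HP e e0.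
exists d => // z z' Zz Zz' /Hd; rewrite (FZ Zz' iN) (FZ Zz iN) subrr mulr0 subr0.
by rewrite distrC.
Qed.

(** Local constancy of [P] is clear; the point is to link each [p] to [Z] below level [t]. If [P p]
    differed from [P o], [perron] applied to the open set of such points would give a boundary point
    of it still below [t], where local constancy is contradicted. *)
Lemma prim_const_sublevel A P i t : (i < N)%N -> prim A (F i) P -> 0 < t ->
  (forall q, sg q < t -> A q = 0) -> forall q, sg q < t -> P q = P o.
Proof.
move=> iN HP t0 A0.
have loc q : sg q < t -> exists2 r, 0 < r & forall v, `|v - q| < r -> sg v < t /\ P v = P q.
  move=> qt; have r0 : 0 < (t - sg q) / L by rewrite divr_gt0// subr_gt0.
  have low v : `|v - q| < (t - sg q) / L -> sg v < t.
    rewrite ltr_pdivlMr// mulrC => vq; have := lip_dist o v q.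
    by rewrite -!/(sg _) ler_norml => /andP[_ ?]; lra.
  exists ((t - sg q) / L) => // v vq; split; first exact: low.
  apply: (prim_const (Flip iN) HP (@mid_closed_ball _ _ q ((t - sg q) / L))) => //=.
    by move=> w /low /A0.
  by rewrite subrr normr0.
move=> p pt; apply: contrapT => Pp.
pose W := [set q | sg q < t /\ P q <> P o].
have oW : metric_open W.
  move=> q [/loc[r r0 Hr] Pq]; exists r => // v /Hr[vt vq].
  by split=> //; rewrite vq.
have ZW z : Z z -> ~ W z by move=> Zz [_]; apply; exact: (prim_const_Z iN HP).
have e0 : 0 < (t - sg p) / 2 by rewrite divr_gt0// subr_gt0.
have [q [nWq aWq]] := perron oW (conj pt Pp) ZW e0.
have := dist_ge0 p q => ? ?; have qt : sg q < t by lra.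
have [r r0 Hr] := loc q qt; have [v [vt Pv] vq] := aWq r r0.
by apply: nWq; split=> //; rewrite -(Hr v vq).2.
Qed.

Implicit Types (s : R) (p z a : V).

(** The component of [p] in the open set where the height exceeds [s]; the margin [d] expresses the
    strict inequality through closed superlevel sets. The alternative [a = p] serves the points of
    height at most [s], which the contraction leaves in place. *)
Definition near s p a := a = p \/ exists2 d, 0 < d & conn sg (s + d) p a.

Lemma near_conn s p a : s < sg p -> near s p a -> exists2 d, 0 < d & conn sg (s + d) p a.
Proof.
move=> sp [->|//]; exists (sg p - s); first by rewrite subr_gt0.
by apply: conn0; lra.
Qed.

Lemma near_low s p a : sg p <= s -> near s p a -> a = p.
Proof. by move=> sp [//|[d d0 /conn_start ?]]; exfalso; lra. Qed.

(* The primitive of [theta(height) dF_i], where [theta] jumps from 0 to 1 just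
   above level [s], is constant below the jump and agrees with [F_i] up to a
   constant above it. *)
Lemma near_value s p a a' z z' i : (i < N)%N -> 0 <= s -> near s p a -> near s p a' ->
  sg z <= s -> sg z' <= s -> `|F i z - F i z'| <= 2 * C * (`|a - z| + `|a' - z'|).
Proof.
move=> iN s0 na na' zs zs'; have [ps|sp] := leP (sg p) s.
  rewrite (near_low ps na) (near_low ps na') (le_trans (Flip iN z z'))//.
  have := ler_distD p z z'; rewrite (distrC z p) => h.
  have : 0 <= C * (`|p - z| + `|p - z'|) by rewrite mulr_ge0// addr_ge0.
  by have := ler_wpM2l C0 h; lra.
have [d d0 ca] := near_conn sp na; have [d' d'0 ca'] := near_conn sp na'.
pose e := Num.min d d' / 2.
have e0 : 0 < e by rewrite divr_gt0// lt_min d0.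
have ed : 2 * e <= d by rewrite /e mulrC divfK// ge_min lexx.
have ed' : 2 * e <= d' by rewrite /e mulrC divfK// ge_min lexx orbT.
have {}ca : conn sg (s + 2 * e) p a by apply: conn_le ca; lra.
have {}ca' : conn sg (s + 2 * e) p a' by apply: conn_le ca'; lra.
(* The cut-off rises from 0 at height [s + e] to 1 at height [s + 2 * e]: points of height at most
   [s] are strictly below the rise, and the paths from [p] to [a] and [a'] stay above it. *)
pose A q := Num.min 1 (Num.max 0 (e^-1 * (sg q - (s + e)))).
have tA : tame A.
  apply: tame_min; first exact: tame_cst.
  apply: tame_max; first exact: tame_cst.
  apply: tame_scale; apply: tame_sub; last exact: tame_cst.
  by have [] := admissible_dist o.
have [P HP] := tame_has_prim iN tA.
have A0 q : sg q < s + e -> A q = 0.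
  move=> qs; rewrite /A (max_idPl _) ?(min_idPr _)//.
  by rewrite pmulr_rle0 ?invr_gt0// subr_le0 ltW.
have A1 q : s + 2 * e <= sg q -> A q = 1.
  move=> qs; rewrite /A (min_idPl _)// le_max; apply/orP; right.
  by rewrite mulrC ler_pdivlMr// mul1r; lra.
have Abd q : setT q -> `|A q| <= 1.
  move=> _; rewrite ger0_norm /A; first by rewrite ge_min lexx.
  by rewrite le_min ler01 le_max lexx.
have se0 : 0 < s + e by rewrite ltr_wpDl.
have Pz : P z = P z'.
  have low := prim_const_sublevel iN HP se0 A0.
  by rewrite !low//; lra.
have chain b : conn sg (s + 2 * e) p b -> P b - F i b = P p - F i p.
  elim=> // u v _ <- uv.
  have HQ := prim_sub HP (prim_id (F i)).
  apply: (prim_const (Flip iN) HQ (@mid_closed_seg _ _ u v)) => [_ [t + <-]||].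
  - by rewrite /= in_itv/= => /andP[t0 t1]; rewrite A1 ?subrr// uv.
  - by exists 1; rewrite ?pt1//= in_itv/= lexx ler01.
  - by exists 0; rewrite ?pt0//= in_itv/= lexx ler01.
have := chain a ca; have := chain a' ca'.
have PC := prim_lip (Flip iN) HP (@mid_closedT _ _) Abd.
have := PC a z I I; have := PC a' z' I I; have := Flip iN a z; have := Flip iN a' z'.
rewrite !ler_norml => /andP[? ?] /andP[? ?] /andP[? ?] /andP[? ?] ? ?.
by apply/andP; split; lra.
Qed.

(** [z] lies on the rim of the component of [p]. If [p] itself has height at most [s], the only such
    [z] is [p]. *)
Definition hit s p z := sg z <= s /\ forall e, 0 < e -> exists2 a, near s p a & `|a - z| < e.

Lemma hit_near_value s p a z z' i : (i < N)%N -> 0 <= s -> hit s p z -> near s p a ->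
  sg z' <= s -> `|F i z - F i z'| <= 2 * C * `|a - z'|.
Proof.
move=> iN s0 [zs Hz] na zs'; rewrite -subr_le0; apply: (@le_eps _ _ (2 * C)).
  by rewrite mulr_ge0.
move=> e e0; have [b nb bz] := Hz e e0.
have := near_value iN s0 nb na zs zs'.
have : 2 * C * `|b - z| <= 2 * C * e by rewrite ler_wpM2l ?mulr_ge0// ltW.
lra.
Qed.

Lemma hit_unique s p z z' i : (i < N)%N -> 0 <= s -> hit s p z -> hit s p z' ->
  F i z = F i z'.
Proof.
move=> iN s0 hz [zs' Hz']; apply/eqP; rewrite -subr_eq0 -normr_le0.
apply: (@le_eps _ _ (2 * C)) => [|e /Hz'[a na az]]; first by rewrite mulr_ge0.
rewrite (le_trans (hit_near_value iN s0 hz na zs'))// ler_wpM2l ?mulr_ge0// ltW//.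
Qed.

Lemma near_open s p : metric_open [set a | exists2 d, 0 < d & conn sg (s + d) p a].
Proof.
move=> a [d d0 pa]; have r0 : 0 < d / 2 / L by rewrite !divr_gt0.
exists (d / 2 / L) => // b; rewrite ltr_pdivlMr// => ba.
exists (d / 2); first by rewrite divr_gt0.
have := conn_end pa => ?.
apply: (connS (conn_le _ pa)) => [|t t0 t1]; first by lra.
have := lip_dist o (pt a b t) a; rewrite -!/(sg _).
rewrite -[X in `|pt _ _ _ - X|](pt0 a b) pt_dist subr0 (ger0_norm t0) (distrC a).
have : t * `|b - a| <= `|b - a| by rewrite ler_piMl.
move=> h1; have : L * (t * `|b - a|) <= L * `|b - a| by rewrite ler_wpM2l// ltW.
by rewrite ler_norml => ? /andP[? ?]; lra.
Qed.

Lemma hit_low s p : sg p <= s -> hit s p p.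
Proof.
by move=> ps; split=> // e e0; exists p; [left|rewrite subrr normr0].
Qed.

(** [perron] applied to the component of [p] yields a boundary point [q]. Its height is at least [s]
    by adherence, and at most [s] since otherwise a short segment would put [q] into the component;
    so the cost [dist p q] is at most the drop in height plus [eta]. *)
Lemma hit_exists s p eta : 0 <= s -> 0 < eta ->
  exists2 z, hit s p z & D p z <= Num.max 0 (sg p - s) + eta.
Proof.
move=> s0 eta0; have [ps|sp] := leP (sg p) s.
  by exists p; [exact: hit_low|rewrite Dxx addr_ge0 ?le_max ?lexx// ltW].
pose W := [set a | exists2 d, 0 < d & conn sg (s + d) p a].
have Wp : W p.
  exists (sg p - s); first by rewrite subr_gt0.
  by apply: conn0; lra.
have ZW z : Z z -> ~ W z by move=> Zz [d d0 /conn_end]; rewrite (sg_Z Zz); lra.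
have [q [nWq aWq pq]] := perron (@near_open s p) Wp ZW eta0.
have sq : s <= sg q.
  rewrite -subr_le0; apply: (@le_eps _ _ L) => [|e e0]; first exact: ltW.
  have [v [d d0 /conn_end ?] vq] := aWq e e0.
  have := lip_dist o v q; rewrite -!/(sg _) ler_norml => /andP[_ ?].
  have : L * `|v - q| <= L * e by rewrite ler_pM2l// ltW.
  lra.
have qs : sg q <= s.
  rewrite leNgt; apply/negP => sq'; apply: nWq.
  have r0 : 0 < (sg q - s) / 2 / L by rewrite !divr_gt0// subr_gt0.
  have [v [d d0 pv]] := aWq _ r0; rewrite ltr_pdivlMr// => vq.
  pose c := Num.min d ((sg q - s) / 2).
  have cd : c <= d by rewrite ge_min lexx.
  have cq : c <= (sg q - s) / 2 by rewrite ge_min lexx orbT.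
  exists c; first by rewrite lt_min d0 divr_gt0// subr_gt0.
  apply: (connS (conn_le _ pv)) => [|t t0 t1]; first by lra.
  have := lip_dist o (pt v q t) q; rewrite -!/(sg _).
  rewrite -[X in `|pt _ _ _ - X|](pt1 v q) pt_dist (@ler0_norm _ (t - 1)) ?subr_le0// opprB.
  have h1 : (1 - t) * `|v - q| <= `|v - q| by rewrite ler_piMl// gerBl.
  have : L * ((1 - t) * `|v - q|) <= L * `|v - q| by rewrite ler_wpM2l// ltW.
  by rewrite ler_norml => ? /andP[? ?]; lra.
exists q; first split=> // e e0.
  by have [v Wv vq] := aWq e e0; exists v => //; right.
have := D_le_dist p q; have : sg p - s <= Num.max 0 (sg p - s) by rewrite le_max lexx orbT.
lra.
Qed.

(** Makes the contraction a flow: the value at level [s] can be computed from a rim point at level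
    [s']. If [z'] is still above [s], it is joined to the component of [p] by a short segment, so
    both have the same component above [s]. *)
Lemma hit_trans s s' p z z' : s <= s' -> hit s' p z' -> hit s z' z -> hit s p z.
Proof.
move=> ss' [zs' Hz'] [zs Hz].
have nn a : near s' p a -> near s p a.
  move=> [->|[d d0 pa]]; first by left.
  by right; exists d => //; apply: conn_le pa; rewrite lerD2r.
have [zs''|sz] := leP (sg z') s.
  suff -> : z = z' by split=> // e e0; have [a /nn na az] := Hz' e e0; exists a.
  apply/eqP; rewrite eq_sym -subr_eq0 -normr_le0; apply: (@le_eps _ _ 1) => // e e0.
  by have [a /(near_low zs'') -> az] := Hz e e0; rewrite mul1r ltW.
(* Within this radius of [z'] the height drops by less than half of [sg z' - s]. *)
have r0 : 0 < (sg z' - s) / 2 / L by rewrite !divr_gt0// subr_gt0.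
have [v /nn nv] := Hz' _ r0; rewrite ltr_pdivlMr// => vz.
have seg t : 0 <= t -> t <= 1 -> s + (sg z' - s) / 2 <= sg (pt v z' t).
  move=> t0 t1; have := lip_dist o (pt v z' t) z'; rewrite -!/(sg _).
  rewrite -[X in `|pt _ _ _ - X|](pt1 v z') pt_dist (@ler0_norm _ (t - 1)) ?subr_le0// opprB.
  have h1 : (1 - t) * `|v - z'| <= `|v - z'| by rewrite ler_piMl// gerBl.
  have : L * ((1 - t) * `|v - z'|) <= L * `|v - z'| by rewrite ler_wpM2l// ltW.
  by rewrite ler_norml => ? /andP[? ?]; lra.
have [d d0 pz] : exists2 d, 0 < d & conn sg (s + d) p z'.
  case: nv => [vp|[d d0 pv]].
    exists ((sg z' - s) / 2); first by rewrite divr_gt0// subr_gt0.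
    rewrite -vp; apply: (connS (conn0 _)) => //.
    by have := seg 0; rewrite pt0; apply.
  pose c := Num.min d ((sg z' - s) / 2).
  have cd : c <= d by rewrite ge_min lexx.
  have cq : c <= (sg z' - s) / 2 by rewrite ge_min lexx orbT.
  exists c; first by rewrite lt_min d0 divr_gt0// subr_gt0.
  apply: (connS (conn_le _ pv)) => [|t t0 t1]; first by lra.
  by have := seg t t0 t1; lra.
split=> // e e0; have [a na az] := Hz e e0; exists a => //; right.
have [d' d'0 za] := near_conn sz na.
exists (Num.min d d'); first by rewrite lt_min d0.
apply: (@conn_trans _ _ _ _ _ z').
  by apply: conn_le pz; rewrite lerD2l ge_min lexx.
by apply: conn_le za; rewrite lerD2l ge_min lexx orbT.
Qed.

End Height.
End Horizontal.

(** * Absolutely continuous functions *)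

Section Monotone.
Context (R : realType).
Notation mu := (@lebesgue_measure R).
Implicit Types (a b c d x : R) (f g : R -> R).

Lemma derivable_approx f x e : derivable f x 1 -> 0 < e ->
  exists2 r, 0 < r & forall y, `|y - x| < r ->
    `|f y - f x - derive1 f x * (y - x)| <= e * `|y - x|.
Proof.
move=> df e0.
have : (fun h : R => h^-1 *: (f (h + x) - f x)) @ 0^' --> derive1 f x.
  rewrite derive1E; move: df => /cvgP; rewrite /derive.
  set u := (fun h : R => _); set v := (fun h : R => _).
  by have -> : v = u by apply/funext => h; rewrite /u /v /= [h%:A]mulr1.
move=> /cvgrPdist_le /(_ e e0) [r /= r0 Hr].
exists r => // y yx; have [->|yx0] := eqVneq y x.
  by rewrite !subrr mulr0 subr0 normr0 mulr0.
have h0 : y - x != 0 by rewrite subr_eq0.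
have := Hr (y - x); rewrite /ball /= sub0r normrN => /(_ yx h0).
rewrite subrK => h.
have -> : f y - f x - derive1 f x * (y - x) =
    - (derive1 f x - (y - x)^-1 *: (f y - f x)) * (y - x).
  by rewrite /GRing.scale /=; field.
by rewrite normrM normrN ler_wpM2r.
Qed.

(** Cousin's covering lemma as an induction along the interval: the gauge at the supremum of the
    good points carries [G] past it. *)
Lemma cousin a b (G : R -> Prop) : a <= b -> G a ->
  (forall x, a <= x -> x <= b -> exists2 r, 0 < r & forall c d, a <= c -> c <= x ->
     x <= d -> d <= b -> x - r < c -> d < x + r -> G c -> G d) -> G b.
Proof.
move=> ab Ga H.
pose E := [set c | a <= c <= b /\ G c].
have Ea : E a by split; rewrite ?lexx.
have hE : has_sup E by split; [exists a|exists b => t [/andP[]]].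
have ca : a <= sup E by exact: sup_upper_bound.
have cb : sup E <= b by apply: ge_sup; [exists a|move=> t [/andP[]]].
have [r r0 Hr] := H _ ca cb.
have [c [/andP[ac cb'] Gc] ce] := sup_adherent r0 hE.
have cE : c <= sup E by apply: sup_upper_bound => //; split=> //; rewrite ac.
have [sb|bs] := ltP (sup E) b; last first.
  by apply: (Hr c b) => //; rewrite (le_lt_trans bs)// ltrDl.
pose d := Num.min b (sup E + r / 2).
have db : d <= b by rewrite ge_min lexx.
have dr : d <= sup E + r / 2 by rewrite ge_min lexx orbT.
have Ed : sup E < d by rewrite lt_min sb ltrDl divr_gt0.
suff /(sup_upper_bound hE) : E d by move=> ?; lra.
split; first by apply/andP; split; lra.
by apply: (Hr c d) => //; lra.
Qed.

Definition ac a b f := forall e, 0 < e -> exists2 r, 0 < r &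
  forall (N : nat) (s t : 'I_N -> R), (forall i, [/\ a <= s i, s i <= t i & t i <= b]) ->
    trivIset setT (fun i => `]s i, t i[%classic) ->
    \sum_(i < N) (t i - s i) < r -> \sum_(i < N) `|f (t i) - f (s i)| < e.

Lemma ordered_trivIset n (s t : nat -> R) :
  (forall i j, (i < j < n)%N -> t i <= s j) ->
  trivIset setT (fun i : 'I_n => `]s i, t i[%classic).
Proof.
move=> st i j _ _ [x [/=]]; rewrite !in_itv/= => /andP[xi xi'] /andP[xj xj'].
apply/val_inj/eqP; case: ltngtP => // ij.
  by have := st i j; rewrite ij ltn_ord => /(_ isT); lra.
by have := st j i; rewrite ij ltn_ord => /(_ isT); lra.
Qed.

Lemma sum_length_le n (s t : nat -> R) (U : set R) : measurable U ->
  (forall i, (i < n)%N -> s i <= t i /\ `]s i, t i[ `<=` U) ->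
  (forall i j, (i < j < n)%N -> t i <= s j) ->
  ((\sum_(i < n) (t i - s i))%:E <= mu U)%E.
Proof.
move=> mU sU st.
have -> : (\sum_(i < n) (t i - s i))%:E = mu (\big[setU/set0]_(i < n) `]s i, t i[%classic).
  rewrite measure_bigsetU_ord//; last exact: ordered_trivIset.
  rewrite -sumEFin; apply: eq_bigr => i _.
  apply: etrans (esym (lebesgue_measure_itv `]s i, t i[)); rewrite /= lte_fin.
  have [sti _] := sU i (ltn_ord i); case: ltP => // ts.
  by have -> : t i = s i; [apply/eqP; rewrite eq_le ts|rewrite subrr].
apply: le_measure; rewrite ?inE//.
  exact: bigsetU_measurable.
by rewrite -(bigcup_mkord n (fun i => `]s i, t i[%classic)) => x [i /= iN]; exact: (sU i iN).2.
Qed.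

(* The exceptional null set is covered by an open set of small measure, on
   which absolute continuity controls [f]; elsewhere the derivative does. *)
Lemma ac_ae_nondecreasing a b f g : a <= b ->
  (forall c d, a <= c -> c <= d -> d <= b -> g c <= g d) -> ac a b f ->
  {ae mu, forall t, t \in `[a, b] -> derivable (fun t => g t + f t) t 1 /\
     0 <= derive1 (fun t => g t + f t) t} -> g a + f a <= g b + f b.
Proof.
move=> ab g_mono acf [N [mN N0 HN]].
pose phi t := g t + f t; rewrite -/(phi a) -/(phi b) -subr_le0.
apply: (@le_eps _ _ (b - a + 1)) => [|e e0]; first by lra.
have [r r0 Hr] := acf e e0.
have [|U [oU NU mUr]] := @lebesgue_regularity_outer R N r mN _ r0.
  by rewrite [X in (X < _)%E]N0 ltry.
have mU : measurable U by exact: measurable_realfun.open_measurable.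
have {}mUr : (mu U < r%:E)%E.
  have -> : (mu U = mu (U `\` N) + mu (U `&` N))%E by exact: measureDI.
  have -> : mu (U `&` N) = 0%E.
    apply/eqP; rewrite -measure_le0 -N0; apply: le_measure; rewrite ?inE//.
    exact: measurableI.
  by rewrite adde0.
(* Up to [c], any decrease of [phi] is paid for by [e] per unit of length and by the variation of
   [f] over disjoint intervals inside [U]. *)
pose Good c := exists n (s t : nat -> R), [/\
  forall i, (i < n)%N -> [/\ a <= s i, s i <= t i, t i <= c & `]s i, t i[ `<=` U],
  forall i j, (i < j < n)%N -> t i <= s j &
  phi a - e * (c - a) - \sum_(i < n) `|f (t i) - f (s i)| <= phi c].
suff [n [s [t [st ord le_phi]]]] : Good b.
  have : \sum_(i < n) `|f (t i) - f (s i)| < e.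
    apply: Hr => [i||].
    - by have [] := st i (ltn_ord i).
    - exact: ordered_trivIset.
    - rewrite -lte_fin (le_lt_trans _ mUr)// sum_length_le// => i /st[_ ? _ ?].
      by split.
  lra.
apply: (cousin ab) => [|x ax xb].
  by exists 0%N, (fun=> 0), (fun=> 0); split => //; rewrite big_ord0 subrr; lra.
have [Nx|Nx] := pselect (N x).
  (* Around a point of the null set the new interval lies in [U] and joins the list; [g] cannot
     decrease on it. *)
  have [d /= d0 Hd] : nbhs x U by apply: open_nbhs_nbhs; split=> //; exact: NU.
  exists d => // c c' ac cx xc' c'b cd c'd [n [s [t [st ord le_phi]]]].
  have cc' : c <= c' by lra.
  exists n.+1, (fun i => if (i < n)%N then s i else c),
    (fun i => if (i < n)%N then t i else c'); split.
  - move=> i _; case: ifPn => [/st[? ? ? ?]|_]; first by split => //; lra.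
    split => // y; rewrite /= in_itv/= => /andP[cy yc']; apply: Hd.
    by rewrite /ball /= ltr_distlC; apply/andP; split; lra.
  - move=> i j /andP[ij]; rewrite ltnS => jn.
    have jn' := leq_trans ij jn; rewrite jn'.
    case: ifPn => [jn2|_]; first by apply: ord; rewrite ij.
    by have [] := st i jn'.
  - rewrite big_ord_recr/= ltnn; under eq_bigr => i _ do rewrite ltn_ord.
    have := g_mono c c' ac cc' c'b; have := ler_norm (- (f c' - f c)).
    have : 0 <= e * (c' - c) by rewrite mulr_ge0 ?subr_ge0// ltW.
    by rewrite normrN; rewrite /phi in le_phi *; lra.
have [dphi phi'] : derivable phi x 1 /\ 0 <= derive1 phi x.
  have h : x \in `[a, b] -> derivable phi x 1 /\ 0 <= derive1 phi x.
    by apply: contrapT => h; exact/Nx/HN.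
  by apply: h; rewrite in_itv/= ax.
have [d d0 Hd] := derivable_approx dphi e0.
exists d => // c c' ac cx xc' c'b cd c'd [n [s [t [st ord le_phi]]]].
exists n, s, t; split => //.
  by move=> i /st[? ? ? ?]; split => //; lra.
have := Hd c; have := Hd c'; rewrite (ger0_norm (_ : 0 <= c' - x)) ?subr_ge0//.
rewrite (ler0_norm (_ : c - x <= 0)) ?subr_le0//.
move=> /(_ ltac:(lra)) h1 /(_ ltac:(lra)) h2; move: h1 h2; rewrite !ler_norml.
have : 0 <= derive1 phi x * (c' - x) by rewrite mulr_ge0// subr_ge0.
have : 0 <= derive1 phi x * (x - c) by rewrite mulr_ge0// subr_ge0.
by move=> ? ? /andP[? ?] /andP[? ?]; lra.
Qed.

End Monotone.

(** * Horizontal paths *)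

Section Enorm.
Context (R : realType) (n : nat).
Implicit Types v : 'rV[R]_n.

Lemma enorm_ge0 v : 0 <= enorm v. Proof. exact: sqrtr_ge0. Qed.

Lemma enorm_sqr v : enorm v ^+ 2 = \sum_(i < n) v 0 i ^+ 2.
Proof. by rewrite sqr_sqrtr// sumr_ge0// => i _; exact: sqr_ge0. Qed.

Lemma coord_le_enorm v i : `|v 0 i| <= enorm v.
Proof.
rewrite -(@ler_pXn2r _ 2)// ?nnegrE ?enorm_ge0// enorm_sqr real_normK ?num_real//.
by rewrite (bigD1 i)//= lerDl sumr_ge0// => j _; exact: sqr_ge0.
Qed.

Lemma enorm_le_sum v : enorm v <= \sum_(i < n) `|v 0 i|.
Proof.
have S0 : 0 <= \sum_(i < n) `|v 0 i| by rewrite sumr_ge0.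
rewrite -(@ler_pXn2r _ 2)// ?nnegrE ?enorm_ge0// enorm_sqr expr2 mulr_suml.
apply: ler_sum => i _; rewrite -[X in X <= _]real_normK ?num_real// expr2 ler_wpM2l//.
by rewrite (bigD1 i)//= lerDl sumr_ge0.
Qed.

End Enorm.

(** * Speed and length of horizontal paths *)

Section Speed.
Import HBNNSimple.
Context (R : realType).
Notation mu := (@lebesgue_measure R).
Implicit Types (a b c d x : R).

(** Meant for speeds that may fail to be measurable on a null set: the integral of a nonnegative
    function is a supremum over simple functions below it, which is monotone. *)
Lemma le_lower_integral (f g : R -> \bar R) : (forall x, 0 <= f x)%E ->
  (forall x, f x <= g x)%E -> (\int[mu]_x f x <= \int[mu]_x g x)%E.
Proof.
move=> f0 fg; have g0 x : (0 <= g x)%E by exact: le_trans (f0 x) (fg x).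
rewrite !ge0_integralTE//; apply: le_ereal_sup => _ [h hf <-]; exists h => // x.
exact: le_trans (hf x) (fg x).
Qed.

Lemma ac_continuous a b (f : R -> R) : ac a b f -> forall e, 0 < e ->
  exists2 r, 0 < r & forall s t, a <= s -> s <= b -> a <= t -> t <= b ->
    `|s - t| < r -> `|f s - f t| < e.
Proof.
move=> acf e e0; have [r r0 Hr] := acf e e0; exists r => //.
have key s t : a <= s -> s <= t -> t <= b -> t - s < r -> `|f t - f s| < e.
  move=> as_ st tb ts; have := Hr 1%N (fun=> s) (fun=> t); rewrite !big_ord1; apply => //.
  by move=> i j _ _ _; rewrite !ord1.
move=> s t as_ sb at_ tb; have [st|/ltW ts] := leP s t.
  by rewrite ler0_norm ?subr_le0// opprB distrC; exact: key.
by rewrite ger0_norm ?subr_ge0//; exact: key.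
Qed.

Lemma derivable_coord n (g : R -> 'rV[R]_n) t i : derivable g t 1 ->
  derivable (fun s => g s 0 i) t 1 /\
  derive1 (fun s => g s 0 i) t = (derive1 (g : R -> 'rV[R]_n) t) 0 i.
Proof.
move=> dg; split; first by have /derivable_mxP := dg; apply.
by rewrite !derive1E derive_mx// mxE.
Qed.

(** The derivative is the pointwise limit of difference quotients of step 1/(n+1). They are taken
    for [fc], the extension of [f] by constants, which is continuous on the whole line. *)
Lemma measurable_derive1 a b (f : R -> R) (N : set R) : ac a b f -> measurable N ->
  (forall t, t \in `]a, b[ -> ~ N t -> derivable f t 1) ->
  measurable_fun (`]a, b[ `\` N) (derive1 f : R -> R).
Proof.
move=> acf mN Hd.
have [ab|ba] := leP a b; last first.
  rewrite (_ : `]a, b[%classic = set0); last by rewrite set_itv_ge// bnd_simp -leNgt ltW.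
  by rewrite set0D; exact: measurable_fun_set0.
pose cl t := Num.max a (Num.min t b).
have cl_in t : a <= cl t /\ cl t <= b.
  by rewrite /cl le_max lexx ge_max ab ge_min lexx orbT.
have cl_id t : a <= t -> t <= b -> cl t = t.
  by move=> at_ tb; rewrite /cl (min_idPl tb) (max_idPr at_).
have cl_lip s t : `|cl s - cl t| <= `|s - t|.
  rewrite /cl !maxEle !minEle.
  have := ler_norm (s - t); have := ler_norm (t - s); rewrite (distrC t).
  by do ![case: ifP]; rewrite ?subrr ?normr0// => *; rewrite ler_norml; apply/andP; split; lra.
pose fc t := f (cl t).
have fc_cont : continuous fc.
  move=> t; apply/cvgrPdist_lt => e e0; have [r r0 Hr] := ac_continuous acf e0.
  exists r => //= s; rewrite /ball /= => st; have [? ?] := cl_in s; have [? ?] := cl_in t.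
  by apply: Hr => //; exact: le_lt_trans (cl_lip _ _) st.
pose q (n : nat) t := n.+1%:R * (fc (t + n.+1%:R^-1) - fc t).
have mq n : measurable_fun (`]a, b[ `\` N) (q n).
  apply: (@measurable_funS _ _ _ _ setT) => //.
  apply: continuous_measurable_fun => t; rewrite /q.
  apply: cvgM; first exact: cvg_cst.
  apply: cvgB; last exact: fc_cont.
  apply: (cvg_comp (fun s => s + n.+1%:R^-1) fc); last exact: fc_cont.
  by apply: cvgD; [exact: cvg_id|exact: cvg_cst].
apply: (measurable_fun_cvg mq) => t [/= tab Nt]; have df := Hd t tab Nt.
move: tab; rewrite in_itv/= => /andP[at_ tb].
apply/cvgrPdist_le => e e0; have [r r0 Hr] := derivable_approx df e0.
have m0 : 0 < Num.min r (b - t) by rewrite lt_min r0 subr_gt0.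
near=> n.
have n0 : 0 < n.+1%:R^-1 :> R by rewrite invr_gt0.
have : n.+1%:R^-1 < Num.min r (b - t).
  near: n; exact: (near_infty_natSinv_lt (PosNum m0)).
rewrite lt_min => /andP[nr nb].
have l1 : a <= t + n.+1%:R^-1 by rewrite ltW// ltr_wpDr// ltW.
have l2 : t + n.+1%:R^-1 <= b by rewrite addrC -lerBrDr ltW.
rewrite /q /fc (cl_id t (ltW at_) (ltW tb)) (cl_id (t + n.+1%:R^-1) l1 l2).
have := Hr (t + n.+1%:R^-1); rewrite addrAC subrr add0r (gtr0_norm n0) => /(_ nr) h.
have -> : derive1 f t - n.+1%:R * (f (t + n.+1%:R^-1) - f t) =
  - ((f (t + n.+1%:R^-1) - f t - derive1 f t * n.+1%:R^-1) * n.+1%:R).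
  by field.
rewrite normrN normrM normr_nat -ler_pdivlMr ?ltr0n//; exact: h.
Unshelve. all: by end_near. Qed.

Variable k : nat.
Implicit Types g : R -> jet_space R k.

Definition coord g (i : nat) (t : R) : R := g t 0 (inord i).

Lemma ac_coord a b g i : absolutely_continuous a b g -> ac a b (coord g i).
Proof.
move=> acg e /acg[r r0 Hr]; exists r => // N s t st tI /(Hr N s t st tI).
apply: le_lt_trans; apply: ler_sum => j _.
by rewrite (le_trans _ (coord_le_enorm _ (inord i)))// !mxE.
Qed.

Lemma horizontal_coord g t : horizontal (g t) (derive1 (g : R -> 'rV[R]_k.+2) t) ->
  derivable (g : R -> 'rV[R]_k.+2) t 1 ->
  [/\ forall i, derivable (coord g i) t 1,
      hnorm (derive1 (g : R -> 'rV[R]_k.+2) t) =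
        Num.sqrt (derive1 (coord g 0) t ^+ 2 + derive1 (coord g 1) t ^+ 2)
    & forall i, (0 < i)%N -> (i.+1 < k.+2)%N ->
        derive1 (coord g i.+1) t = derive1 (coord g 0) t * coord g i t].
Proof.
move=> [al [be E]] dg.
have cE i : derive1 (coord g i) t = (derive1 (g : R -> 'rV[R]_k.+2) t) 0 (inord i).
  by have [_ <-] := derivable_coord (inord i) dg.
have i0 : inord 0 = idx_x k by apply/val_inj; rewrite /= inordK.
have i1 : inord 1 = idx_uk k by apply/val_inj; rewrite /= inordK.
have d0 : derive1 (coord g 0) t = al.
  by rewrite cE E !mxE i0/= mulr1 mulr0 addr0.
split.
- by move=> i; have [] := derivable_coord (inord i) dg.
- by rewrite /hnorm !cE i0 i1.
- move=> i i_gt0 ik; rewrite cE d0 E !mxE /coord.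
  have -> : inord i.+1 == idx_x k = false by apply/eqP => /(congr1 val); rewrite /= inordK.
  have -> : inord i.+1 == idx_uk k = false.
    by apply/eqP => /(congr1 val); rewrite /= inordK//= => -[]/eqP; rewrite -leqn0 leqNgt i_gt0.
  by rewrite andbF mulr0 addr0 inordK.
Qed.

(** On the exceptional null set [derive1] has uncontrolled values. Setting the speed to 0 there and
    at the end points gives a measurable function with integral at most the length. *)
Lemma speed_representative a b g : horizontal_path a b g -> exists h : R -> R,
  [/\ measurable_fun setT h, forall t, 0 <= h t,
      {ae mu, forall t, t \in `[a, b] -> h t = hnorm (derive1 (g : R -> 'rV[R]_k.+2) t)},
      forall t, ~ t \in `[a, b] -> h t = 0
    & (\int[mu]_t (h t)%:E <= path_length a b g)%E].
Proof.
move=> [ab acg [N [mN N0 HN]]].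
have Hg t : t \in `[a, b] -> ~ N t -> derivable (g : R -> 'rV[R]_k.+2) t 1 /\
    horizontal (g t) (derive1 (g : R -> 'rV[R]_k.+2) t).
  by move=> tab nt; move: tab; apply: contrapT => h; exact/nt/HN.
have sub t : t \in `]a, b[ -> t \in `[a, b].
  by rewrite !in_itv/= => /andP[/ltW -> /ltW ->].
pose S : set R := `]a, b[ `\` N.
have mS : measurable S by apply: measurableD.
pose h0 t := Num.sqrt (derive1 (coord g 0) t ^+ 2 + derive1 (coord g 1) t ^+ 2).
have h0E t : S t -> h0 t = hnorm (derive1 (g : R -> 'rV[R]_k.+2) t).
  by move=> [/sub /Hg H /H[dg hg]]; have [_ -> _] := horizontal_coord hg dg.
have mh0 : measurable_fun S h0.
  have ms : measurable_fun setT (@Num.sqrt R).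
    exact: continuous_measurable_fun (@sqrt_continuous R).
  apply: (measurableT_comp ms).
  have md i : measurable_fun S (derive1 (coord g i) : R -> R).
    apply: measurable_derive1 mN _; first exact: ac_coord.
    by move=> t /sub/Hg H /H[dg hg]; have [] := horizontal_coord hg dg.
  by apply: measurable_funD; apply: measurable_funX.
exists (h0 \_ S); split.
- exact/(measurable_restrictT _ _).1.
- by move=> t; rewrite patchE; case: ifP => // _; exact: sqrtr_ge0.
- have neg : mu.-negligible (N `|` ([set a] `|` [set b])).
    apply: negligibleU; first by exists N; split.
    have neg1 c : mu.-negligible [set c].
      by exists [set c]; split => //; exact: lebesgue_measure_set1.
    exact: negligibleU.
  apply: negligibleS neg => t /= Ht; apply: contrapT => /not_orP[Nt /not_orP[ta tb]].
  apply: Ht => tab.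
  have St : S t.
    split=> //=; move: tab; rewrite !in_itv/= !le_eqVlt.
    by move=> /andP[/predU1P[/esym/ta[]|->] /predU1P[/tb[]|->]].
  by rewrite patchE mem_set// h0E.
- move=> t tab; rewrite patchE memNset// => -[/sub h _]; exact: tab h.
rewrite /path_length [leRHS]integral_mkcond; apply: le_lower_integral => t.
  by rewrite patchE; case: ifP => // _; rewrite lee_fin sqrtr_ge0.
rewrite !patchE; case: ifPn => [/set_mem St|_].
  have [/sub ? _] := St; rewrite h0E// mem_set//.
by case: ifP => // _; rewrite lee_fin sqrtr_ge0.
Qed.

(** Converse use of [speed_representative]: every simple function below the speed is almost
    everywhere below [h]. *)
Lemma path_length_le a b g (h : R -> R) : measurable_fun setT h -> (forall t, 0 <= h t) ->
  {ae mu, forall t, t \in `[a, b] -> hnorm (derive1 (g : R -> 'rV[R]_k.+2) t) <= h t} ->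
  (path_length a b g <= \int[mu]_t (h t)%:E)%E.
Proof.
move=> mh h0 ae; rewrite /path_length integral_mkcond ge0_integralTE; last first.
  by move=> t; rewrite patchE; case: ifP => // _; rewrite lee_fin sqrtr_ge0.
apply: ge_ereal_sup => _ [f Hf <-]; rewrite -integralT_nnsfun.
apply: ae_ge0_le_integral => //=.
- by move=> t _; rewrite lee_fin; exact: fun_ge0.
- exact/measurable_EFinP/measurable_funP.
- by move=> t _; rewrite lee_fin.
- exact/measurable_EFinP.
move: ae; apply: negligibleS => t /=; apply: contra_not => Ht _; apply: (le_trans (Hf t)); rewrite patchE.
case: ifPn => [/set_mem tab|_]; first by rewrite lee_fin; exact: Ht.
by rewrite lee_fin.
Qed.

End Speed.

(** * Growth of coordinates along a horizontal path *)

Section Increments.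
Context (R : realType).
Notation mu := (@lebesgue_measure R).
Implicit Types (a b c d x : R).

Lemma cumulative (h : R -> R) l : measurable_fun setT h -> (forall t, 0 <= h t) ->
  (\int[mu]_t (h t)%:E <= l%:E)%E ->
  exists F : R -> R, [/\ forall x y, x <= y -> F x <= F y,
    forall x, 0 <= F x <= l &
    {ae mu, forall x, derivable F x 1 /\ derive1 F x = h x}].
Proof.
move=> mh h0 hl.
have ih : mu.-integrable setT (EFin \o h).
  apply/integrableP; split; first exact/measurable_EFinP.
  apply: (@le_lt_trans _ _ (\int[mu]_t (h t)%:E)%E); last by rewrite (le_lt_trans hl)// ltry.
  rewrite le_eqVlt; apply/orP; left; apply/eqP.
  by apply: eq_integral => x _ /=; rewrite ger0_norm.
have ihD (D : set R) : measurable D -> mu.-integrable D (EFin \o h).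
  by move=> mD; exact: integrableS ih.
pose F x := (\int[mu]_(t in [set` `]-oo, x]]) (h t))%R.
have FE x : (F x)%:E = (\int[mu]_(t in `]-oo, x]) (h t)%:E)%E.
  by rewrite /F /Rintegral fineK//; apply: integrable_fin_num => //; exact: ihD.
exists F; split.
- move=> x y xy; rewrite -lee_fin !FE; apply: ge0_subset_integral => //=.
  + by apply: (@measurable_funS _ _ _ _ setT) => //; exact/measurable_EFinP.
  + by move=> t _; rewrite lee_fin.
  + by move=> t /=; rewrite !in_itv/= => /le_trans; apply.
- move=> x; rewrite -!lee_fin !FE; apply/andP; split.
    by apply: integral_ge0 => t _; rewrite lee_fin.
  apply: le_trans hl; apply: ge0_subset_integral => //=.
  + exact/measurable_EFinP.
  + by move=> t _; rewrite lee_fin.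
- apply: FTC1Ny => [y|]; first exact: ihD.
  by have := integrable_locally measurableT ih; rewrite patch_setT.
Qed.

Lemma ac_sub a b c d f : ac a b f -> a <= c -> d <= b -> ac c d f.
Proof.
move=> acf ca db e /acf[r r0 Hr]; exists r => // N s t st; apply: Hr => i.
by have [? ? ?] := st i; split => //; lra.
Qed.

Lemma ac_opp a b f : ac a b f -> ac a b (fun t => - f t).
Proof.
move=> acf e /acf[r r0 Hr]; exists r => // N s t st tI /(Hr N s t st tI).
by apply: le_lt_trans; apply: ler_sum => i _; rewrite -opprD normrN.
Qed.

Lemma ac_combine a b f g (c : R) : ac a b f -> ac a b g -> ac a b (fun t => f t - c * g t).
Proof.
move=> acf acg e e0; have c1 : 0 < `|c| + 1 by rewrite ltr_pwDr.
have [r r0 Hr] := acf (e / 2) (divr_gt0 e0 (ltr0n R 2)).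
have [r' r'0 Hr'] := acg (e / 2 / (`|c| + 1)) ltac:(by rewrite !divr_gt0).
exists (Num.min r r') => [|N s t st tI]; first by rewrite lt_min r0.
rewrite lt_min => /andP[/(Hr N s t st tI) h1 /(Hr' N s t st tI)].
rewrite ltr_pdivlMr// => h2.
have : \sum_(i < N) `|f (t i) - c * g (t i) - (f (s i) - c * g (s i))| <=
    \sum_(i < N) `|f (t i) - f (s i)| + (\sum_(i < N) `|g (t i) - g (s i)|) * (`|c| + 1).
  rewrite mulr_suml -big_split/=; apply: ler_sum => i _.
  have -> : f (t i) - c * g (t i) - (f (s i) - c * g (s i)) =
    (f (t i) - f (s i)) - c * (g (t i) - g (s i)) by ring.
  rewrite (le_trans (ler_normB _ _))// lerD2l normrM mulrC ler_wpM2l// lerDl//.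
lra.
Qed.

Variable k : nat.
Implicit Types g : R -> jet_space R k.
Notation speed g t := (hnorm (derive1 (g : R -> 'rV[R]_k.+2) t)).

(** With [F] the cumulative length, [K * F + f] and [K * F - f] have nonnegative derivatives almost
    everywhere, so [ac_ae_nondecreasing] applies with the monotone part [K * F], whose total
    increase is at most [K * l]. *)
Lemma increment_le a b g l (f : R -> R) K c : horizontal_path a b g ->
  (path_length a b g <= l%:E)%E -> ac a b f -> 0 <= K -> a <= c -> c <= b ->
  (forall t, t \in `[a, b] -> derivable (g : R -> 'rV[R]_k.+2) t 1 ->
     horizontal (g t) (derive1 (g : R -> 'rV[R]_k.+2) t) ->
     derivable f t 1 /\ `|derive1 f t| <= K * speed g t) ->
  `|f c - f a| <= K * l.
Proof.
move=> hg gl acf K0 ac_ cb Hf.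
have [h [mh h0 hE _ hl]] := speed_representative hg.
have [F [Fmono F0 FE]] := cumulative mh h0 (le_trans hl gl).
have acc : ac a c f by apply: ac_sub acf _ cb.
case: (hg) => _ _ hae.
have ae3 : {ae mu, forall t, t \in `[a, c] ->
    [/\ derivable F t 1, derivable f t 1 & `|derive1 f t| <= K * derive1 F t]}.
  have : mu.-negligible (~` [set t | t \in `[a, b] -> h t = speed g t] `|`
     (~` [set t | derivable F t 1 /\ derive1 F t = h t] `|`
     ~` [set t | t \in `[a, b] -> derivable (g : R -> 'rV[R]_k.+2) t 1 /\
        horizontal (g t) (derive1 (g : R -> 'rV[R]_k.+2) t)])).
    by apply: negligibleU => //; apply: negligibleU.
  apply: negligibleS => t; rewrite -!setCI /=; apply: contra_not => -[h1 [[h2 h3] h4]] tac.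
  have tab : t \in `[a, b].
    by move: tac; rewrite !in_itv/= => /andP[-> /le_trans ->].
  have [dg hgt] := h4 tab; have [? ?] := Hf t tab dg hgt.
  by split => //; rewrite h3 h1.
have key (f' : R -> R) : ac a c f' -> {ae mu, forall t, t \in `[a, c] ->
    [/\ derivable F t 1, derivable f' t 1 & `|derive1 f' t| <= K * derive1 F t]} ->
    f' a - f' c <= K * l.
  move=> acf' ae'.
  have := @ac_ae_nondecreasing R a c f' (fun t => K * F t) ac_.
  have Fm x y : a <= x -> x <= y -> y <= c -> K * F x <= K * F y.
    by move=> _ xy _; rewrite ler_wpM2l// Fmono.
  move=> /(_ Fm acf') H.
  have {}H : K * F a + f' a <= K * F c + f' c.
    apply: H; move: ae'; apply: negligibleS => t /=; apply: contra_not => H /H[dF df' le].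
    have dKF : derivable (fun t => K * F t) t 1 by exact: derivableM (derivable_cst _ _ _) dF.
    split; first exact: derivableD.
    rewrite derive1E deriveD// -!derive1E.
    have -> : derive1 (fun t => K * F t) t = K * derive1 F t.
      rewrite derive1E deriveM//= derive_cst.
      by rewrite derive1E /GRing.scale /= mulr0 addr0.
    by move: le; rewrite ler_norml => /andP[? _]; lra.
  have /andP[? ?] := F0 a; have /andP[? ?] := F0 c.
  have : K * F c <= K * l by rewrite ler_wpM2l.
  have : 0 <= K * F a by rewrite mulr_ge0.
  lra.
rewrite ler_norml; apply/andP; split; first by have := key f acc ae3; lra.
suff : (- f a) - (- f c) <= K * l by lra.
apply: (key (fun t => - f t) (ac_opp acc)).
move: ae3; apply: negligibleS => t /=; apply: contra_not => H /H[dF df le]; split => //.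
  exact: derivableN.
have -> : derive1 (fun t => - f t) t = - derive1 f t by rewrite !derive1E deriveN.
by rewrite normrN.
Qed.

Definition jet_coord (p : jet_space R k) (i : nat) : R := p 0 (inord i).

(** The source of all second-order estimates. Subtracting x times the initial value of coordinate
    [i] from coordinate [i.+1] leaves a function whose derivative is x' times the increment of
    coordinate [i]; this is at most [C * l] times the speed and integrates to [C * l ^+ 2]. *)
Lemma coord_bound (M : R) : 0 <= M -> exists C, 0 <= C /\ forall a b g l, horizontal_path a b g ->
  (path_length a b g <= l%:E)%E -> l <= M ->
  (forall i, (i < k.+2)%N -> `|jet_coord (g a) i| <= M) ->
  (forall i, (i < k.+2)%N -> `|jet_coord (g b) i - jet_coord (g a) i| <= C * l) /\
  (forall i, (0 < i)%N -> (i.+1 < k.+2)%N ->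
     `|jet_coord (g b) i.+1 - jet_coord (g a) i.+1 -
       jet_coord (g a) i * (jet_coord (g b) 0 - jet_coord (g a) 0)| <= C * l ^+ 2).
Proof.
(* A coordinate is bounded by [M + C i * l], hence by [(2 * M + 1) * C i] as [l <= M] and
   [1 <= C i]; this bounds the rate of change of the next coordinate. *)
move=> M0; pose C i := (2 * M + 1) ^+ i.
have C1 i : 1 <= C i by rewrite exprn_ege1//; lra.
have C0 i : 0 <= C i by exact: le_trans ler01 (C1 i).
have Cmono i : (i < k.+2)%N -> C i <= C k.+2.
  move=> /ltnW ik; have h : 1 <= 2 * M + 1 by lra.
  exact: (ler_weXn2l h ik).
exists (C k.+2); split; first exact: C0.
move=> a b g l hg gl lM gM.
have [ab acg _] := hg.
have l0 : 0 <= l.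
  by rewrite -lee_fin (le_trans _ gl)// integral_ge0// => t _; rewrite lee_fin sqrtr_ge0.
have speed_ge t : horizontal (g t) (derive1 (g : R -> 'rV[R]_k.+2) t) ->
    derivable (g : R -> 'rV[R]_k.+2) t 1 ->
    `|derive1 (coord g 0) t| <= speed g t /\ `|derive1 (coord g 1) t| <= speed g t.
  move=> h1 h2; have [_ -> _] := horizontal_coord h1 h2.
  by split; rewrite -[X in X <= _]sqrtr_sqr ler_wsqrtr// ?lerDl ?lerDr sqr_ge0.
have key i : (i < k.+2)%N -> forall c, a <= c -> c <= b ->
    `|coord g i c - coord g i a| <= C i * l.
  elim: i => [|[|i] IH] ik c ac_ cb.
  - apply: (increment_le hg gl) => //; first exact: ac_coord.
    move=> t tab dg hgt; have [dc _ _] := horizontal_coord hgt dg; split => //.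
    by rewrite /C expr0 mul1r; have [] := speed_ge t hgt dg.
  - apply: (increment_le hg gl) => //; first exact: ac_coord.
    move=> t tab dg hgt; have [dc _ _] := horizontal_coord hgt dg; split => //.
    have [_ h] := speed_ge t hgt dg; apply: (le_trans h).
    by rewrite ler_peMl ?sqrtr_ge0.
  - apply: (increment_le hg gl) => //; first exact: ac_coord.
    move=> t tab dg hgt; have [dc _ E] := horizontal_coord hgt dg; split => //.
    rewrite E// normrM mulrC ler_pM//; last by have [] := speed_ge t hgt dg.
    move: tab; rewrite in_itv/= => /andP[at_ tb].
    have h1 := IH (ltnW ik) t at_ tb; have h2 := gM i.+1 (ltnW ik).
    rewrite -[coord g i.+1 t](subrK (coord g i.+1 a)) (le_trans (ler_normD _ _))//.
    rewrite /C exprS -/(C i.+1).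
    have : C i.+1 * l <= C i.+1 * M by rewrite ler_wpM2l.
    have : M <= C i.+1 * M by rewrite ler_peMl.
    rewrite /jet_coord -/(coord g i.+1 a) in h2.
    have := C1 i.+1; lra.
split=> [i ik|i i0 ik].
  have := key i ik b ab (lexx _); rewrite /jet_coord -!/(coord _ _ _) => h.
  by rewrite (le_trans h)// ler_wpM2r// Cmono.
rewrite /jet_coord -!/(coord _ _ _).
have := @increment_le a b g l (fun t => coord g i.+1 t - coord g i a * coord g 0 t)
  (C i * l) b hg gl (ac_combine _ (ac_coord _ acg) (ac_coord _ acg)).
have Cl : 0 <= C i * l by rewrite mulr_ge0.
move=> /(_ Cl ab (lexx _)) H.
have -> : coord g i.+1 b - coord g i.+1 a - coord g i a * (coord g 0 b - coord g 0 a) =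
  coord g i.+1 b - coord g i a * coord g 0 b - (coord g i.+1 a - coord g i a * coord g 0 a).
  by ring.
rewrite (le_trans (H _))//; last first.
  by rewrite expr2 mulrA !ler_wpM2r// Cmono// ltnW.
move=> t tab dg hgt; have [dc _ E] := horizontal_coord hgt dg.
have dm : derivable (fun t => coord g i a * coord g 0 t) t 1.
  exact: derivableM (derivable_cst _ _ _) (dc 0%N).
split; first exact: derivableB.
rewrite derive1E deriveB// -!derive1E E//.
have -> : derive1 (fun t => coord g i a * coord g 0 t) t = coord g i a * derive1 (coord g 0) t.
  by rewrite derive1E deriveM//= derive_cst derive1E /GRing.scale /= mulr0 addr0.
rewrite mulrC -mulrBl normrM ler_pM//; last by have [] := speed_ge t hgt dg.
move: tab; rewrite in_itv/= => /andP[at_ tb].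
exact: key (ltnW ik) t at_ tb.
Qed.

End Increments.

Section EnormTriangle.
Context (R : realType) (n : nat).
Implicit Types u v : 'rV[R]_n.

Lemma enorm_eq0 v : enorm v = 0 -> v = 0.
Proof.
move=> v0; apply/rowP => i; rewrite mxE; apply/eqP; rewrite -normr_le0 -v0.
exact: coord_le_enorm.
Qed.

Lemma enormD u v : enorm (u + v) <= enorm u + enorm v.
Proof.
have [/enorm_eq0->|u0] := eqVneq (enorm u) 0; first by rewrite add0r lerDr enorm_ge0.
have [/enorm_eq0->|v0] := eqVneq (enorm v) 0; first by rewrite addr0 lerDl enorm_ge0.
have {}u0 : 0 < enorm u by rewrite lt_neqAle eq_sym u0 enorm_ge0.
have {}v0 : 0 < enorm v by rewrite lt_neqAle eq_sym v0 enorm_ge0.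
rewrite -(@ler_pXn2r _ 2)// ?nnegrE ?addr_ge0 ?enorm_ge0//.
rewrite [X in X <= _]enorm_sqr sqrrD; have := enorm_sqr u; have := enorm_sqr v.
set a := enorm u in u0 *; set b := enorm v in v0 * => eb ea; rewrite ea eb.
have h : \sum_(i < n) (u 0 i * v 0 i) <= a * b.
  rewrite -(ler_pM2l (_ : 0 < 2 :> R))//.
  have -> : 2 * (a * b) = (b / a) * a ^+ 2 + (a / b) * b ^+ 2.
    by field; rewrite !gt_eqF.
  rewrite ea eb !mulr_sumr -big_split/=; apply: ler_sum => i _.
  have -> : b / a * u 0 i ^+ 2 + a / b * v 0 i ^+ 2 = 2 * (u 0 i * v 0 i) +
      (b * u 0 i - a * v 0 i) ^+ 2 / (a * b) by field; rewrite !gt_eqF.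
  by rewrite lerDl divr_ge0 ?sqr_ge0// mulr_ge0// ltW.
have -> : \sum_(i < n) (u + v) 0 i ^+ 2 =
   \sum_(i < n) u 0 i ^+ 2 + (\sum_(i < n) u 0 i * v 0 i) *+ 2 + \sum_(i < n) v 0 i ^+ 2.
  rewrite -sumrMnl -!big_split/=; apply: eq_bigr => i _.
  by rewrite !mxE sqrrD.
by rewrite lerD2r lerD2l lerMn2r.
Qed.

End EnormTriangle.

(** * Translation of paths, concatenation and the triangle inequality *)

Section Shift.
Context (R : realType).
Notation mu := (@lebesgue_measure R).

Let shift_fun (d : R) : measurableTypeR R -> measurableTypeR R := fun t => t - d.

Let measurable_shift d : measurable_fun setT (shift_fun d).
Proof.
apply: continuous_measurable_fun => t.
by apply: cvgB; [exact: cvg_id|exact: cvg_cst].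
Qed.

Lemma lebesgue_measure_shift (d : R) (A : set R) : measurable A ->
  mu [set t | A (t - d)] = mu A.
Proof.
pose f : {mfun measurableTypeR R >-> measurableTypeR R} :=
  HB.pack (shift_fun d) (isMeasurableFun.Build _ _ _ _ _ (measurable_shift d)).
move=> mA; rewrite [RHS](@lebesgue_measure_unique R (pushforward mu f))// => _ [[x y] _ <-] /=.
rewrite /pushforward.
have -> : f @^-1` `]x, y] = `]x + d, y + d]%classic.
  apply/seteqP; split => t /=; rewrite !in_itv/= /shift_fun => /andP[? ?]; apply/andP; split; lra.
have e1 := lebesgue_measure_itv `]x, y]; have e2 := lebesgue_measure_itv `]x + d, y + d].
apply: etrans e1 _; apply: etrans (esym e2); rewrite /= !lte_fin ltrD2r.
by case: ifP => // _; congr EFin; ring.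
Qed.

Lemma negligible_shift (d : R) (A : set R) : mu.-negligible A ->
  mu.-negligible [set t | A (t - d)].
Proof.
move=> [B [mB B0 AB]]; exists [set t | B (t - d)]; split.
- by have := measurable_shift d measurableT mB; rewrite setTI.
- by rewrite lebesgue_measure_shift.
- by move=> t /AB.
Qed.

Lemma integral_shift (d : R) (h : R -> R) : measurable_fun setT h -> (forall t, 0 <= h t) ->
  (\int[mu]_t (h (t - d))%:E = \int[mu]_t (h t)%:E)%E.
Proof.
move=> mh h0.
have := @ge0_integral_pushforward _ _ _ _ R _ (measurable_shift d) mu setT (EFin \o h).
move=> /(_ measurableT) H.
rewrite preimage_setT in H; rewrite -H; first last.
- by move=> y _ /=; rewrite lee_fin.
- exact/measurable_EFinP.
pose f : {mfun measurableTypeR R >-> measurableTypeR R} :=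
  HB.pack (shift_fun d) (isMeasurableFun.Build _ _ _ _ _ (measurable_shift d)).
apply: (@eq_measure_integral _ _ _ _ mu (pushforward mu f)) => A mA _.
exact: lebesgue_measure_shift.
Qed.

End Shift.

Section Concat.
Context (R : realType) (k : nat).
Notation mu := (@lebesgue_measure R).
Implicit Types (a b c d : R) (g : R -> jet_space R k) (p q r : jet_space R k).
Notation D1 g t := (derive1 (g : R -> 'rV[R]_k.+2) t).

Lemma derivable_shift g d t : derivable (g : R -> 'rV[R]_k.+2) (t - d) 1 ->
  derivable ((fun s => g (s - d)) : R -> 'rV[R]_k.+2) t 1.
Proof.
have E : (fun h : R => h^-1 *: (((fun s => g (s - d) : 'rV[R]_k.+2) \o shift t) (h *: 1) - g (t - d))) =
    (fun h : R => h^-1 *: (((g : R -> 'rV[R]_k.+2) \o shift (t - d)) (h *: 1) - g (t - d))).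
  by apply/funext => h /=; rewrite addrA.
by rewrite /derivable E.
Qed.

Lemma derive1_shift g d t : D1 (fun s => g (s - d)) t = D1 g (t - d).
Proof.
have E : (fun h : R => h^-1 *: ((g (h + t - d) : 'rV[R]_k.+2) - g (t - d))) =
    (fun h : R => h^-1 *: ((g (h + (t - d)) : 'rV[R]_k.+2) - g (t - d))).
  by apply/funext => h /=; rewrite addrA.
by rewrite /derive1 E.
Qed.

Lemma near_eq_horizontal g g' t : (\near t, (g : R -> 'rV[R]_k.+2) t = g' t) ->
  derivable (g : R -> 'rV[R]_k.+2) t 1 /\ horizontal (g t) (D1 g t) ->
  (derivable (g' : R -> 'rV[R]_k.+2) t 1 /\ horizontal (g' t) (D1 g' t)) /\ D1 g' t = D1 g t.
Proof.
move=> gg' [dg hg].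
have E : D1 g' t = D1 g t.
  by rewrite !derive1E; apply/esym; exact: near_eq_derive gg'.
split=> //; rewrite E; split; first exact: near_eq_derivable gg' dg.
by rewrite -(nbhs_singleton gg').
Qed.

Lemma trivIset_subitv (N : nat) (s t s' t' : 'I_N -> R) d :
  (forall i x, s' i < x -> x < t' i -> s i < x + d /\ x + d < t i) ->
  trivIset setT (fun i => `]s i, t i[%classic) -> trivIset setT (fun i => `]s' i, t' i[%classic).
Proof.
move=> H tI i j _ _ [x [/=]]; rewrite !in_itv/= => /andP[? ?] /andP[? ?].
have [? ?] := H i x ltac:(by []) ltac:(by []); have [? ?] := H j x ltac:(by []) ltac:(by []).
by apply: (tI i j I I); exists (x + d); split; rewrite /= in_itv/=; apply/andP.
Qed.

Lemma horizontal_concat a b c d g1 g2 : horizontal_path a b g1 -> horizontal_path c d g2 ->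
  g1 b = g2 c -> exists a' b' g, [/\ horizontal_path a' b' g, g a' = g1 a, g b' = g2 d
    & (path_length a' b' g <= path_length a b g1 + path_length c d g2)%E].
Proof.
move=> h1 h2 bc; have [ab ac1 ae1] := h1; have [cd ac2 ae2] := h2.
have [e ebc] : exists e, e = b - c by exists (b - c).
exists a, (d + e).
pose g t := if t < b then g1 t else g2 (t - e).
have bde : b <= d + e by lra.
(* Writing [g] as a sum of two clamped pieces splits each increment into one of [g1] and one of
   [g2], so intervals straddling the junction need no special treatment. *)
have gE t : g t = g1 (Num.min t b) + g2 (Num.max t b - e) - g1 b.
  rewrite /g; case: ltP => tb; last by rewrite [RHS]addrAC subrr add0r.
  by rewrite ebc subKr -bc addrK.
have gb : g b = g1 b by rewrite /g ltxx ebc subKr.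
have acg : absolutely_continuous a (d + e) g.
  move=> eps eps0; have [r1 r10 Hr1] := ac1 (eps / 2) (divr_gt0 eps0 (ltr0n R 2)).
  have [r2 r20 Hr2] := ac2 (eps / 2) (divr_gt0 eps0 (ltr0n R 2)).
  exists (Num.min r1 r2) => [|N s t st tI]; first by rewrite lt_min r10.
  rewrite lt_min => /andP[l1 l2].
  pose s1 i := Num.min (s i) b; pose t1 i := Num.min (t i) b.
  pose s2 i := Num.max (s i) b - e; pose t2 i := Num.max (t i) b - e.
  have i1 : \sum_(i < N) enorm (g1 (t1 i) - g1 (s1 i)) < eps / 2.
    apply: Hr1 => [i||].
    - have [? ? ?] := st i; rewrite /s1 /t1 !minEle.
      by case: ifP => ?; case: ifP => ?; split => //; lra.
    - apply: (@trivIset_subitv N s t _ _ 0 _ tI) => i x; rewrite addr0 /s1 /t1 !minEle.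
      by case: ifP => ?; case: ifP => ? ? ?; split => //; lra.
    - apply: le_lt_trans l1; apply: ler_sum => i _.
      have [? ? ?] := st i; rewrite /s1 /t1 !minEle.
      by case: ifP => ?; case: ifP => ?; lra.
  have i2 : \sum_(i < N) enorm (g2 (t2 i) - g2 (s2 i)) < eps / 2.
    apply: Hr2 => [i||].
    - have [? ? ?] := st i; rewrite /s2 /t2 !maxEle.
      by case: ifP => ?; case: ifP => ?; split => //; lra.
    - apply: (@trivIset_subitv N s t _ _ e _ tI) => i x; rewrite /s2 /t2 !maxEle.
      by case: ifP => ?; case: ifP => ? ? ?; split => //; lra.
    - apply: le_lt_trans l2; apply: ler_sum => i _.
      have [? ? ?] := st i; rewrite /s2 /t2 !maxEle.
      by case: ifP => ?; case: ifP => ?; lra.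
  apply: (@le_lt_trans _ _ (\sum_(i < N) enorm (g1 (t1 i) - g1 (s1 i)) +
    \sum_(i < N) enorm (g2 (t2 i) - g2 (s2 i)))); last by lra.
  rewrite -big_split/=; apply: ler_sum => i _; rewrite !gE -/(t1 i) -/(s1 i) -/(t2 i) -/(s2 i).
  rewrite (le_trans _ (enormD _ _))// le_eqVlt; apply/orP; left; apply/eqP; congr enorm.
  by rewrite opprB [LHS]addrA subrK opprD addrACA.
have neg : mu.-negligible (~` [set t | t \in `[a, b] -> derivable (g1 : R -> 'rV[R]_k.+2) t 1 /\
      horizontal (g1 t) (D1 g1 t)] `|` (~` [set t | t - e \in `[c, d] ->
      derivable (g2 : R -> 'rV[R]_k.+2) (t - e) 1 /\
      horizontal (g2 (t - e)) (D1 g2 (t - e))] `|` [set b])).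
  apply: negligibleU; first exact: ae1.
  apply: negligibleU; last by exists [set b]; split => //; exact: lebesgue_measure_set1.
  exact: (negligible_shift e ae2).
have key t : t \in `[a, d + e] -> ~ (~` [set t | t \in `[a, b] -> derivable (g1 : R -> 'rV[R]_k.+2) t 1 /\
      horizontal (g1 t) (D1 g1 t)] `|` (~` [set t | t - e \in `[c, d] ->
      derivable (g2 : R -> 'rV[R]_k.+2) (t - e) 1 /\
      horizontal (g2 (t - e)) (D1 g2 (t - e))] `|` [set b])) t ->
    (derivable (g : R -> 'rV[R]_k.+2) t 1 /\ horizontal (g t) (D1 g t)) /\
    ((t \in `[a, b] /\ D1 g t = D1 g1 t) \/ (t - e \in `[c, d] /\ D1 g t = D1 g2 (t - e))).
  rewrite in_itv/= => /andP[at_ te] /not_orP[/contrapT/= H1 /not_orP[/contrapT/= H2 tb]].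
  have [ltb|ltb|//] := ltgtP t b.
    have tab : t \in `[a, b] by rewrite in_itv/= at_ ltW.
    have [|? E] := @near_eq_horizontal g1 g t _ (H1 tab).
      near=> s; have sb : s < b by near: s; exact: lt_nbhsl.
      by rewrite /g sb.
    by split=> //; left.
  have tcd : t - e \in `[c, d] by rewrite in_itv/=; apply/andP; split; lra.
  have [dg2 hg2] := H2 tcd.
  have [||? E] := @near_eq_horizontal (fun s => g2 (s - e)) g t.
  - near=> s; have bs : b < s by near: s; exact: lt_nbhsr.
    by rewrite /g ltNge (ltW bs).
  - by split; [exact: derivable_shift|rewrite derive1_shift].
  - by split=> //; right; split=> //; rewrite E derive1_shift.
have hg : horizontal_path a (d + e) g.
  split; [exact: le_trans bde|exact: acg|].
  apply: negligibleS neg => t; apply: contra_notP => nt /=.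
  by move=> tI; have [] := key t tI nt.
exists g; split => //.
- rewrite /g; case: ltP => // ba; have -> : a = b by apply/eqP; rewrite eq_le ab.
  by rewrite bc ebc subKr.
- rewrite /g ltNge bde/=; congr g2; lra.
have [k1 [mk1 k10 k1E k1Z k1l]] := speed_representative h1.
have [k2 [mk2 k20 k2E k2Z k2l]] := speed_representative h2.
have mk2s : measurable_fun setT ((fun t : R => k2 (t - e)) : R -> R).
  have ms : measurable_fun setT ((fun t : R => t - e) : R -> R).
    apply: continuous_measurable_fun => t.
    by apply: cvgB; [exact: cvg_id|exact: cvg_cst].
  exact: (measurableT_comp mk2 ms).
(* The comparison passes through measurable representatives, for which the integral is additive and
   invariant under translation. *)
apply: (@le_trans _ _ (\int[mu]_t (k1 t + k2 (t - e))%:E)%E).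
  apply: path_length_le.
  - exact: measurable_funD.
  - by move=> t; rewrite addr_ge0.
  have neg2 : mu.-negligible ((~` [set t | t \in `[a, b] -> k1 t = hnorm (D1 g1 t)]) `|`
      [set t | (~` [set t | t \in `[c, d] -> k2 t = hnorm (D1 g2 t)]) (t - e)]).
    by apply: negligibleU => //; exact: negligible_shift.
  apply: negligibleS (negligibleU neg neg2) => t; apply: contra_notP.
  move=> /not_orP[n1 /not_orP[/contrapT/= n2 /contrapT/= n3]] /= tI.
  have [_ [[tI' ->]|[tI' ->]]] := key t tI n1.
    by rewrite -n2// lerDl.
  by rewrite -n3// lerDr.
have m1 : measurable_fun setT (EFin \o k1) by exact/measurable_EFinP.
have m2 : measurable_fun setT (EFin \o (fun t : R => k2 (t - e))) by exact/measurable_EFinP.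
have p1 (t : R) : setT t -> (0 <= (k1 t)%:E)%E by rewrite lee_fin.
have p2 (t : R) : setT t -> (0 <= (k2 (t - e))%:E)%E by rewrite lee_fin.
have := @ge0_integralD _ _ R mu setT measurableT _ _ p1 m1 p2 m2 => /= ->.
have S := integral_shift e mk2 k20.
apply: leeD; first exact: k1l.
apply: (@le_trans _ _ (\int[mu]_t (k2 t)%:E)%E); last exact: k2l.
by rewrite le_eqVlt; apply/orP; left; apply/eqP; exact: S.
Unshelve. all: by end_near. Qed.

Lemma path_length_ge0 a b g : (0 <= path_length a b g)%E.
Proof. by apply: integral_ge0 => t _; rewrite lee_fin sqrtr_ge0. Qed.

Lemma dcc_ge0 p q : (0 <= dcc p q)%E.
Proof. by apply: le_ereal_inf_tmp => _ [a [b [g [_ _ _ ->]]]]; exact: path_length_ge0. Qed.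

Lemma dcc_refl p : dcc p p = 0%E.
Proof.
apply/eqP; rewrite eq_le dcc_ge0 andbT; apply: ereal_inf_lbound.
exists 0, 0, (fun=> p).
have E t : D1 (fun=> p) t = 0 by rewrite derive1E derive_cst.
split => //.
  split => //.
    move=> e e0; exists 1 => // N s t _ _ _; rewrite big1// => i _.
    by rewrite subrr /enorm big1 ?sqrtr0// => j _; rewrite mxE expr0n.
  apply: aeW => t _; split; first exact: derivable_cst.
  by rewrite E; exists 0, 0; rewrite !scale0r addr0.
rewrite /path_length; under eq_integral do rewrite E /hnorm !mxE expr0n/= addr0 sqrtr0.
by rewrite integral0.
Qed.

Lemma dcc_tri p q r : (dcc p r <= dcc p q + dcc q r)%E.
Proof.
have [->|n1] := eqVneq (dcc p q) +oo%E; first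
  by rewrite addye ?leey// gt_eqF// (lt_le_trans _ (dcc_ge0 _ _))// ltNy0.
have [->|n2] := eqVneq (dcc q r) +oo%E; first
  by rewrite addey ?leey// gt_eqF// (lt_le_trans _ (dcc_ge0 _ _))// ltNy0.
have f1 : dcc p q \is a fin_num by rewrite ge0_fin_numE ?dcc_ge0// ltey.
have f2 : dcc q r \is a fin_num by rewrite ge0_fin_numE ?dcc_ge0// ltey.
apply/lee_addgt0Pr => e e0; have e20 : 0 < e / 2 by rewrite divr_gt0.
have [_ [a [b [g1 [h1 g1a g1b ->]]]] l1] := lb_ereal_inf_adherent e20 f1.
have [_ [c [d [g2 [h2 g2c g2d ->]]]] l2] := lb_ereal_inf_adherent e20 f2.
have [|a' [b' [g [hg ga gb gl]]]] := horizontal_concat h1 h2; first by rewrite g1b g2c.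
apply: (@le_trans _ _ (path_length a' b' g)).
  by apply: ereal_inf_lbound; exists a', b', g; rewrite ga gb.
apply: (le_trans gl); apply: (le_trans (leeD (ltW l1) (ltW l2))).
by rewrite -!/(dcc _ _) addeACA -EFinD -splitr.
Qed.

End Concat.

(** * Collapsing the unit ball onto the sphere *)

Section RowNorm.
Context (R : realType) (n : nat).
Implicit Types u v p q : 'rV[R]_n.

Lemma coord_le_norm v i : `|v 0 i| <= `|v|.
Proof.
rewrite [leRHS]/Num.Def.normr/= mx_normrE.
exact: (le_bigmax _ (fun ij : 'I_1 * 'I_n => `|v ij.1 ij.2|) (0, i)).
Qed.

Lemma norm_le v x : 0 <= x -> (forall i, `|v 0 i| <= x) -> `|v| <= x.
Proof.
move=> x0 H; rewrite [leLHS]/Num.Def.normr/= mx_normrE.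
by apply: bigmax_le => // -[i j] _; rewrite ord1.
Qed.

Lemma enorm_le_norm v : enorm v <= n%:R * `|v|.
Proof.
rewrite (le_trans (enorm_le_sum v))// mulr_natl -[X in _ *+ X](card_ord n) -sumr_const.
by apply: ler_sum => i _; exact: coord_le_norm.
Qed.

Lemma enormZ (c : R) v : enorm (c *: v) = `|c| * enorm v.
Proof.
have cv0 : 0 <= `|c| * enorm v by rewrite mulr_ge0// enorm_ge0.
apply/eqP; rewrite -(@eqrXn2 _ 2)// ?enorm_ge0//.
rewrite exprMn !enorm_sqr real_normK ?num_real// mulr_sumr; apply/eqP.
by apply: eq_bigr => i _; rewrite mxE exprMn.
Qed.

Lemma enormN v : enorm (- v) = enorm v.
Proof. by rewrite -scaleN1r enormZ normrN normr1 mul1r. Qed.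

Definition normalize v := (enorm v)^-1 *: v.

Lemma enorm_normalize v : 0 < enorm v -> enorm (normalize v) = 1.
Proof. by move=> v0; rewrite enormZ gtr0_norm ?invr_gt0// mulVf// gt_eqF. Qed.

Lemma normalize_id v : enorm v = 1 -> normalize v = v.
Proof. by move=> v1; rewrite /normalize v1 invr1 scale1r. Qed.

Lemma normalizeZ (c : R) v : 0 < c -> normalize (c *: v) = normalize v.
Proof.
move=> c0; rewrite /normalize enormZ (gtr0_norm c0) scalerA invfM mulrAC mulVf ?mul1r//.
by rewrite gt_eqF.
Qed.

Lemma normalize_lip c p q : 0 < c -> c <= enorm p -> c <= enorm q ->
  enorm (normalize p - normalize q) <= 2 / c * enorm (p - q).
Proof.
move=> c0 cp cq.
have p0 : 0 < enorm p by exact: lt_le_trans cp.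
have q0 : 0 < enorm q by exact: lt_le_trans cq.
have -> : normalize p - normalize q =
    (enorm p)^-1 *: (p - q) + ((enorm p)^-1 * (enorm q)^-1 * (enorm q - enorm p)) *: q.
  rewrite /normalize scalerBr -addrA; congr (_ + _); rewrite -!scaleNr -scalerDl.
  by congr (_ *: _); field; rewrite !gt_eqF.
have dist : `|enorm q - enorm p| <= enorm (p - q).
  rewrite ler_norml; apply/andP; split.
    have := enormD (p - q) q; rewrite subrK; lra.
  have := enormD (q - p) p; rewrite subrK -(enormN (q - p)) opprB; lra.
rewrite (le_trans (enormD _ _))// !enormZ !normrM !normfV (gtr0_norm p0) (gtr0_norm q0).
have -> : (enorm p)^-1 / enorm q * `|enorm q - enorm p| * enorm q =
  (enorm p)^-1 * `|enorm q - enorm p| by field; rewrite !gt_eqF.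
have ip : (enorm p)^-1 <= c^-1 by rewrite lef_pV2.
have ip0 : 0 <= (enorm p)^-1 by rewrite invr_ge0 ltW.
have h1 := ler_pM ip0 (enorm_ge0 (p - q)) ip (lexx _).
have h2 := ler_pM ip0 (normr_ge0 _) ip dist.
lra.
Qed.

End RowNorm.

Section Collapse.
Context (R : realType) (m : nat) (m0 : (0 < m)%N).
Implicit Types (v : 'rV[R]_m) (y : 'rV[R]_m.+1).

(* The cone coordinates of the collapse map: the unit ball of the sup norm is
   mapped onto the sphere, its boundary and exterior going to the base point. *)
Definition cut v : R := Num.min `|v| 1.

Definition cone v : 'rV[R]_m.+1 := \row_j (if unlift ord0 j is Some i
  then 2 * (1 - cut v) * v 0 i else 2 * cut v - 1).

Definition collapse v := normalize (cone v).

Lemma cone0 v : cone v 0 ord0 = 2 * cut v - 1.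
Proof. by rewrite mxE unlift_none. Qed.

Lemma coneS v i : cone v 0 (lift ord0 i) = 2 * (1 - cut v) * v 0 i.
Proof. by rewrite mxE liftK. Qed.

Lemma cut_ge0 v : 0 <= cut v. Proof. by rewrite le_min normr_ge0 ler01. Qed.
Lemma cut_le1 v : cut v <= 1. Proof. by rewrite ge_min lexx orbT. Qed.
Lemma cut_id v : `|v| <= 1 -> cut v = `|v|. Proof. by move=> ?; exact/min_idPl. Qed.
Lemma cut_far v : 1 <= `|v| -> cut v = 1. Proof. by move=> ?; exact/min_idPr. Qed.

Lemma cut_lip v v' : `|cut v - cut v'| <= `|v - v'|.
Proof.
have := ler_dist_dist v v'; rewrite /cut !minEle !ler_norml => /andP[? ?].
by case: ifP => ?; case: ifP => ?; apply/andP; split; lra.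
Qed.

Lemma cone_lb_tail v : 2 * (1 - cut v) * `|v| <= enorm (cone v).
Proof.
have c0 : 0 <= 2 * (1 - cut v) by have := cut_le1 v; lra.
rewrite -{1}(ger0_norm c0) -normrZ; apply: norm_le => [|i]; first exact: enorm_ge0.
by rewrite mxE -coneS; exact: coord_le_enorm.
Qed.

(** If the first coordinate is below 1/3 in absolute value, [cut v] lies between 1/3 and 2/3, and
    the tail has norm above 4/9. *)
Lemma cone_lb v : 3^-1 <= enorm (cone v).
Proof.
have := cone_lb_tail v; have := coord_le_enorm (cone v) ord0; rewrite cone0.
have := cut_ge0 v; have := cut_le1 v; have : cut v <= `|v| by rewrite ge_min lexx.
set t := cut v; set e := enorm _ => h1 h2 h3; rewrite ler_norml => /andP[h4 h5] h6.
rewrite leNgt; apply/negP => e3.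
have : 2 * (1 - t) * t <= 2 * (1 - t) * `|v| by rewrite ler_wpM2l//; lra.
nra.
Qed.

Lemma cone_gt0 v : 0 < enorm (cone v).
Proof. by rewrite (lt_le_trans _ (cone_lb v))// invr_gt0. Qed.

Lemma cone_lip v v' : `|cone v - cone v'| <= 4 * `|v - v'|.
Proof.
have d0 := normr_ge0 (v - v').
apply: norm_le => [|j]; first by rewrite mulr_ge0.
have cl := cut_lip v v'.
have aux (a b : 'rV[R]_m) i : `|a| <= 1 -> `|cut a - cut b| <= `|v - v'| ->
    `|a 0 i - b 0 i| <= `|v - v'| ->
    `|(1 - cut a) * a 0 i - (1 - cut b) * b 0 i| <= 2 * `|v - v'|.
  move=> a1 ab1 ab2.
  have -> : (1 - cut a) * a 0 i - (1 - cut b) * b 0 i =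
      (1 - cut b) * (a 0 i - b 0 i) - (cut a - cut b) * a 0 i by ring.
  rewrite (le_trans (ler_normB _ _))// !normrM mulr2n mulrDl mul1r; apply: lerD.
    have : `|1 - cut b| <= 1.
      by rewrite ger0_norm ?subr_ge0 ?cut_le1// gerBl cut_ge0.
    by move=> h; have := ler_pM (normr_ge0 _) (normr_ge0 _) h ab2; rewrite mul1r.
  have ai : `|a 0 i| <= 1 by rewrite (le_trans (coord_le_norm _ _)).
  by have := ler_pM (normr_ge0 _) (normr_ge0 _) ab1 ai; rewrite mulr1.
rewrite !mxE; case: unliftP => [i _|_].
  have vi : `|v 0 i - v' 0 i| <= `|v - v'| by have := coord_le_norm (v - v') i; rewrite !mxE.
  have -> : 2 * (1 - cut v) * v 0 i - 2 * (1 - cut v') * v' 0 i =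
    2 * ((1 - cut v) * v 0 i - (1 - cut v') * v' 0 i) by ring.
  rewrite normrM ger0_norm//.
  suff : `|(1 - cut v) * v 0 i - (1 - cut v') * v' 0 i| <= 2 * `|v - v'| by lra.
  have [v1|v1] := leP `|v| 1; first exact: aux.
  have [v'1|v'1] := leP `|v'| 1.
    by rewrite distrC; apply: aux => //; rewrite distrC.
  rewrite (cut_far (ltW v1)) (cut_far (ltW v'1)) subrr !mul0r subrr normr0.
    by rewrite mulr_ge0.
have -> : 2 * cut v - 1 - (2 * cut v' - 1) = 2 * (cut v - cut v') by ring.
rewrite normrM ger0_norm//; lra.
Qed.

(** The factor 24 is 6 from normalizing vectors of norm at least 1/3, times 4 from [cone_lip];
    [m.+1] compares the Euclidean norm with the sup norm. *)
Lemma collapse_lip v v' :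
  enorm (collapse v - collapse v') <= 24 * m.+1%:R * `|v - v'|.
Proof.
rewrite (le_trans (normalize_lip _ (cone_lb v) (cone_lb v')))//.
have h1 := enorm_le_norm (cone v - cone v'); have h2 := cone_lip v v'.
rewrite invrK; have := ler_wpM2l (ler0n R m.+1) h2; lra.
Qed.

Lemma collapse_sphere v : enorm (collapse v) = 1.
Proof. by apply: enorm_normalize; exact: cone_gt0. Qed.

Notation base := (delta_mx 0 0 : 'rV[R]_m.+1).

Lemma enorm_base : enorm base = 1.
Proof. by have := sphere_base_subproof R m; rewrite inE. Qed.

Lemma collapse_far v : 1 <= `|v| -> collapse v = base.
Proof.
move=> v1; rewrite /collapse; have -> : cone v = base.
  apply/rowP => j; rewrite !mxE cut_far// eqxx/=.
  case: unliftP => [i ->|->]; first by rewrite subrr mulr0 mul0r.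
  by rewrite mulr1 mulr1n; lra.
by rewrite normalize_id// enorm_base.
Qed.

Lemma collapse_inj v v' : `|v| < 1 -> collapse v = collapse v' -> v = v'.
Proof.
move=> v1 E.
have [l l_def] : exists l, l = enorm (cone v') / enorm (cone v) by eexists.
have l0 : 0 < l by rewrite l_def divr_gt0// cone_gt0.
have {}E : cone v' = l *: cone v.
  rewrite l_def -scalerA -/(normalize (cone v)) -/(collapse v) E /collapse /normalize.
  by rewrite scalerA mulfV ?scale1r// gt_eqF// cone_gt0.
have E0 : 2 * cut v' - 1 = l * (2 * cut v - 1) by rewrite -!cone0 E mxE.
have ES : (1 - cut v') *: v' = (l * (1 - cut v)) *: v.
  apply/rowP => i; have := congr1 (fun y => y 0 (lift ord0 i)) E.
  rewrite !mxE !liftK; lra.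
have [v'1|v'1] := ltP `|v'| 1; last first.
  have t'1 := cut_far v'1; move: ES E0; rewrite t'1 subrr scale0r => /esym/eqP.
  rewrite scaler_eq0 mulf_eq0 (gt_eqF l0)/= subr_eq0 (cut_id (ltW v1)) eq_sym (lt_eqF v1)/=.
  by move=> /eqP ->; rewrite normr0 => ?; exfalso; lra.
have EN : (1 - `|v'|) * `|v'| = l * (1 - `|v|) * `|v|.
  have := congr1 (fun x : 'rV[R]_m => `|x|) ES.
  rewrite /= (normrZ (1 - cut v')) (normrZ (l * (1 - cut v))) (cut_id (ltW v1)) (cut_id (ltW v'1)).
  have p1 : 0 <= 1 - `|v'| by rewrite subr_ge0 ltW.
  have p2 : 0 <= l * (1 - `|v|) by rewrite mulr_ge0 ?subr_ge0// ltW.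
  by rewrite (ger0_norm p1) (ger0_norm p2).
move: E0 ES; rewrite (cut_id (ltW v1)) (cut_id (ltW v'1)) => E0 ES.
set t := `|v| in v1 E0 EN ES; set t' := `|v'| in v'1 E0 EN ES.
have t0 : 0 <= t by exact: normr_ge0.
have t'0 : 0 <= t' by exact: normr_ge0.
(* Eliminating [l] between [E0] and [EN] leaves an equation in [t] and [t'] that factors as [t' - t]
   times a positive number. *)
have tt : t' = t.
  have : (t' - t) * ((1 - t) * (1 - t') + t * t') = 0.
    have -> : (t' - t) * ((1 - t) * (1 - t') + t * t') =
      (2 * t' - 1) * ((1 - t) * t) - (2 * t - 1) * ((1 - t') * t') by ring.
    by rewrite E0 EN; ring.
  move/eqP; rewrite mulf_eq0 => /orP[|/eqP h]; first by rewrite subr_eq0 => /eqP.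
  have : 0 < (1 - t) * (1 - t') by rewrite mulr_gt0 ?subr_gt0.
  have : 0 <= t * t' by rewrite mulr_ge0.
  lra.
have l1 : l = 1.
  have [t00|t00] := eqVneq t 0; first by move: E0; rewrite tt t00; lra.
  have h : (1 - t) * t != 0 by rewrite mulf_neq0// subr_eq0 gt_eqF.
  by apply: (mulIf h); rewrite mul1r mulrA -EN tt.
have h : 1 - t != 0 by rewrite subr_eq0 gt_eqF.
by move: ES; rewrite tt l1 mul1r => /(scalerI h).
Qed.

Lemma collapse_surj y : enorm y = 1 -> exists v, collapse v = y.
Proof.
move=> y1; have [yb|yb] := eqVneq y base.
  exists (const_mx 1); rewrite yb; apply: collapse_far.
  have := coord_le_norm (const_mx 1 : 'rV[R]_m) (Ordinal m0).
  by rewrite mxE normr1.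
pose a := y 0 ord0; pose w : 'rV[R]_m := \row_i y 0 (lift ord0 i).
pose W := `|w|; pose h := Num.sqrt (a ^+ 2 + W ^+ 2).
have W0 : 0 <= W by exact: normr_ge0.
have h2 : h ^+ 2 = a ^+ 2 + W ^+ 2 by rewrite sqr_sqrtr// addr_ge0// sqr_ge0.
have h0 : 0 <= h by exact: sqrtr_ge0.
have yE j : y 0 j = if unlift ord0 j is Some i then w 0 i else a.
  by case: unliftP => [i ->|->]; rewrite ?mxE.
have WA : W = 0 -> a < 0.
  move=> /eqP; rewrite normr_eq0 => /eqP w0.
  have a2 : a ^+ 2 = 1.
    have := enorm_sqr y; rewrite y1 expr1n big_ord_recl/= big1 ?addr0 => [<-//|i _].
    by rewrite yE liftK w0 mxE expr0n.
  rewrite ltNge; apply/negP => a0; move/eqP: yb; apply.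
  apply/rowP => j; rewrite yE !mxE eqxx/=; case: unliftP => [i ->|->].
    by rewrite w0 mxE.
  by apply/eqP; rewrite eqxx -(@eqrXn2 _ 2)// a2 expr1n.
have ha : a <= h.
  have [a0|a0] := ltP a 0; first by rewrite (le_trans (ltW a0)).
  by rewrite -(@ler_pXn2r _ 2) ?nnegrE// h2 lerDl sqr_ge0.
(* For [v = S^-1 *: w], of norm [W / S], the vector [cone v] is proportional to [y] when
   [(2 * W - S) * S = 2 * a * (S - W)]. This quadratic equation in [S] is solved by [h - a + W],
   since [h ^+ 2 = a ^+ 2 + W ^+ 2]. *)
pose S := h - a + W.
have S0 : 0 < S.
  have [/WA a0|Wn] := eqVneq W 0; first by rewrite /S; lra.
  have : 0 < W by rewrite lt_neqAle eq_sym Wn.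
  by rewrite /S; lra.
have hpos : 0 < h.
  rewrite lt_neqAle h0 andbT eq_sym; apply/eqP => hz.
  have : a ^+ 2 + W ^+ 2 = 0 by rewrite -h2 hz expr0n.
  move/eqP; rewrite paddr_eq0 ?sqr_ge0// !sqrf_eq0 => /andP[/eqP az /eqP /WA].
  by rewrite az ltxx.
pose v := S^-1 *: w; exists v.
have nv : `|v| = W / S by rewrite normrZ normfV (gtr0_norm S0) mulrC.
have nv1 : `|v| <= 1 by rewrite nv ler_pdivrMr// mul1r /S; lra.
have ct : cut v = W / S by rewrite cut_id.
have ha' : 0 < h - a.
  rewrite lt_neqAle subr_ge0 ha andbT eq_sym subr_eq0; apply/eqP => hea.
  have : W ^+ 2 = 0 by move: h2; rewrite hea; lra.
  by move/eqP; rewrite sqrf_eq0 => /eqP /WA; lra.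
pose l := 2 * (h - a) / (S ^+ 2).
have l0 : 0 < l by rewrite divr_gt0 ?exprn_gt0// mulr_gt0.
suff E : cone v = l *: y.
  by rewrite /collapse E normalizeZ// normalize_id.
apply/rowP => j; rewrite [RHS]mxE yE mxE ct; case: unliftP => [i _|_].
  rewrite mxE /l; have -> : h - a = S - W by rewrite /S; ring.
  by field; rewrite gt_eqF.
have -> : 2 * (W / S) - 1 = (2 * W - S) * S / S ^+ 2 by field; rewrite gt_eqF.
rewrite /l [RHS]mulrAC; congr (_ / _).
have -> : (2 * W - S) * S = W ^+ 2 - (h - a) ^+ 2 by rewrite /S; ring.
have -> : W ^+ 2 = h ^+ 2 - a ^+ 2 by rewrite h2; ring.
by ring.
Qed.

End Collapse.

Lemma lip_continuous (R : realType) (V : normedModType R) (f : V -> R) K :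
  lip K f -> continuous f.
Proof.
move=> fK p; apply/cvgrPdist_lt => e e0; have K1 : 0 < `|K| + 1 by rewrite ltr_pwDr.
apply/nbhs_ballP; exists (e / (`|K| + 1)) => /=; first by rewrite divr_gt0.
move=> q; rewrite -ball_normE /ball_ /= ltr_pdivlMr// => pq.
rewrite (le_lt_trans (fK p q))// (le_lt_trans _ pq)// mulrC ler_wpM2l//.
by rewrite (le_trans (ler_norm K))// lerDl.
Qed.

(** Where [f] is at least [e], the function [g] is positive, hence bounded below by compactness, and
    [M] is a bound of [f] divided by that minimum; elsewhere [e] alone suffices. *)
Lemma compact_separation (T : topologicalType) (R : realType) (A : set T) (f g : T -> R) :
  compact A -> continuous f -> continuous g -> (forall x, 0 <= g x) ->
  (forall x, g x = 0 -> f x <= 0) ->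
  forall e, 0 < e -> exists M, forall x, A x -> f x <= M * g x + e.
Proof.
move=> cA cf cg g0 gf e e0; pose K := A `&` [set x | e <= f x].
have cK : compact K.
  apply: compact_closedI => //.
  have -> : [set x | e <= f x] = f @^-1` [set t | e <= t] by [].
  by apply: closed_comp => [x _|]; [exact: cf|exact: closed_ge].
have [K0|/set0P K0] := eqVneq K set0.
  exists 0 => x Ax; rewrite mul0r add0r leNgt; apply/negP => fx.
  have : K x by split=> //=; exact: ltW.
  by rewrite K0.
have [c /set_mem[Ac fc] Hc] := compact_EVT_min K0 cK (continuous_subspaceT cg).
have A0 : A !=set0 by exists c.
have [b _ Hb] := compact_EVT_max A0 cA (continuous_subspaceT cf).
have gc0 : 0 < g c.
  rewrite lt_neqAle g0 andbT eq_sym; apply/eqP => /gf; rewrite /= in fc; lra.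
exists (`|f b| / g c) => x Ax; have [fx|fx] := leP e (f x).
  have := Hb x; rewrite inE => /(_ Ax) h1; have := Hc x; rewrite inE => /(_ (conj Ax fx)) h2.
  have : `|f b| / g c * g c <= `|f b| / g c * g x by rewrite ler_wpM2l// divr_ge0// ltW.
  rewrite divfK ?gt_eqF// => h3; have := ler_norm (f b); lra.
have : 0 <= `|f b| / g c * g x by rewrite mulr_ge0// divr_ge0// ltW.
lra.
Qed.

(** * The exterior of the unit ball *)

Section Exterior.
Context (R : realType) (m : nat).
Notation V := 'rV[R]_m.
Notation Z := [set v : V | 1 <= `|v|].

Lemma ball_compact : compact [set v : V | `|v| <= 1].
Proof.
apply: bounded_closed_compact.
  by exists 1; split => // M M1 v /= v1; rewrite (le_trans v1)// ltW.
have -> : [set v : V | `|v| <= 1] = (fun v : V => `|v|) @^-1` [set t : R | t <= 1] by [].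
apply: closed_comp => [x _|]; last exact: closed_le.
exact: norm_continuous.
Qed.

Lemma exterior_net e : 0 < e -> exists s : seq V, forall q, ~ Z q ->
  exists2 z, z \in s & `|q - z| < e.
Proof.
move=> e0; have := ball_compact; rewrite compact_cover => cB.
have [||D' _ H] := cB V setT (fun z : V => ball z e).
- by move=> z _; exact: pseudometric_normed_Zmodule.ball_open.
- by move=> v _; exists v => //; exact: ballxx.
exists (enum_fset D') => q /negP; rewrite -ltNge => q1.
have [z zD] := H q (ltW q1); rewrite -ball_normE /ball_ /= => zq.
by exists z; [exact: zD|rewrite distrC].
Qed.

Hypothesis m0 : (0 < m)%N.

Lemma norm_const1 : `|const_mx 1 : V| = 1.
Proof.
apply/eqP; rewrite eq_le; apply/andP; split.
  by apply: norm_le => // i; rewrite mxE normr1.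
by have := coord_le_norm (const_mx 1 : V) (Ordinal m0); rewrite mxE normr1.
Qed.

Lemma exterior_near (p : V) : exists2 z, Z z & `|p - z| <= 1.
Proof.
have [p1|p1] := leP 1 `|p|; first by exists p => //; rewrite subrr normr0.
have [->|p0] := eqVneq p 0.
  by exists (const_mx 1); rewrite /= ?sub0r ?normrN norm_const1.
have np : 0 < `|p| by rewrite normr_gt0.
exists (`|p|^-1 *: p) => /=.
  by rewrite normrZ ger0_norm ?invr_ge0// mulVf ?gt_eqF.
have h : 1 - `|p|^-1 <= 0 by rewrite subr_le0 invf_ge1// ltW.
rewrite -{1}(scale1r p) -scalerBl normrZ (ler0_norm h) opprB mulrBl mulVf ?gt_eqF// mul1r.
Qed.

End Exterior.

Section ExteriorConnected.
Context (R : realType) (m : nat) (m1 : (1 < m)%N).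
Notation V := 'rV[R]_m.
Notation Z := [set v : V | 1 <= `|v|].

(** For the sup norm, [Z] is a union of half-spaces [1 <= s * v 0 i] with [s] a sign. On each of
    them [g] is constant by bisection, half-spaces of different coordinates meet, and two of the
    same coordinate are linked through another one, which exists because [1 < m]. *)
Lemma exterior_connected (g : V -> R) : (forall e, 0 < e -> exists2 d, 0 < d &
    forall z z', Z z -> Z z' -> `|z - z'| < d -> `|g z - g z'| <= e * `|z - z'|) ->
  forall z z', Z z -> Z z' -> g z = g z'.
Proof.
move=> H.
pose half (i : 'I_m) (s : R) : set V := [set v | 1 <= s * v 0 i].
have halfZ i s : `|s| = 1 -> half i s `<=` Z.
  move=> s1 v /= h; rewrite (le_trans h)// (le_trans (ler_norm _))//.
  by rewrite normrM s1 mul1r coord_le_norm.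
have half_mid i s : mid_closed (half i s).
  by move=> p q; rewrite /half /= /mid !mxE; lra.
have half_const i s v w : `|s| = 1 -> half i s v -> half i s w -> g v = g w.
  move=> s1 hv hw; apply/eqP; rewrite -subr_eq0 -normr_le0 -(mul0r `|v - w|).
  apply: (@local_lipschitz _ _ (half i s) R^o g 0) hv hw; first exact: half_mid.
  move=> e /H[d d0 Hd]; exists d => // p q hp hq pq; rewrite add0r.
  by apply: Hd => //; apply: (halfZ i s).
have in_half v : Z v -> exists i s, `|s| = 1 /\ half i s v.
  move=> /= v1; have : mx_norm v != 0 by rewrite gt_eqF// (lt_le_trans _ v1).
  move=> /mx_norm_neq0[[j i] /=]; rewrite ord1 => vi.
  have {}v1 : 1 <= `|v 0 i| by rewrite -vi.
  have [v0|v0] := leP 0 (v 0 i).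
    by exists i, 1; rewrite normr1 /half /= mul1r -(ger0_norm v0).
  by exists i, (-1); rewrite normrN normr1 /half /= mulN1r -(ltr0_norm v0).
have cross i j s t v w : i != j -> `|s| = 1 -> `|t| = 1 -> half i s v -> half j t w ->
    g v = g w.
  move=> ij s1 t1 hv hw.
  pose c : V := \row_l (if l == i then s else if l == j then t else 0).
  have sq (x : R) : `|x| = 1 -> x * x = 1.
    by move=> x1; rewrite -expr2 -real_normK ?num_real// x1 expr1n.
  have hc : half i s c by rewrite /half /= mxE eqxx sq.
  have hc' : half j t c by rewrite /half /= mxE eq_sym (negbTE ij) eqxx sq.
  by rewrite (half_const i s v c)// (half_const j t c w).
move=> z z' /in_half[i [s [s1 hz]]] /in_half[j [t [t1 hz']]].
have [ij|ij] := eqVneq i j; last exact: cross hz hz'.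
have [l li] : exists l : 'I_m, l != i.
  have [i0|i0] := eqVneq (val i) 0%N.
    by exists (Ordinal m1); rewrite -val_eqE /= i0.
  by exists (Ordinal (ltnW m1)); rewrite -val_eqE /= eq_sym.
have hw : half l 1 (const_mx 1) by rewrite /half /= mxE mulr1.
rewrite (cross i l s 1 z (const_mx 1))// ?normr1// 1?eq_sym//.
by apply: (cross l j 1 t) => //; rewrite ?normr1// -ij.
Qed.

End ExteriorConnected.

Section Fiber.
Context (R : realType) (m : nat) (m0 : (0 < m)%N).
Notation V := 'rV[R]_m.

(** The base point has a whole exterior as preimage, so closeness of images only gives closeness to
    some point of the fiber. On the part of the closed ball at distance at least [e] from the fiber,
    the distance of the image to [y] has a positive minimum; [d'] deals with the exterior. *)
Lemma collapse_fiber (y : 'rV[R]_m.+1) e : enorm y = 1 -> 0 < e ->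
  exists2 d, 0 < d & forall v : V, enorm (collapse v - y) < d ->
    exists2 z, collapse z = y & `|v - z| < e.
Proof.
move=> y1 e0.
pose f (v : V) := enorm (collapse v - y).
have f_gt0 v : collapse v <> y -> 0 < f v.
  move=> vy; rewrite lt_neqAle enorm_ge0 andbT eq_sym; apply/eqP => /enorm_eq0 /eqP.
  by rewrite subr_eq0 => /eqP.
have lf : lip (24 * m.+1%:R) f.
  move=> v w; rewrite ler_norml; have h := collapse_lip v w; apply/andP; split.
    have := enormD (collapse w - collapse v) (collapse v - y).
    rewrite addrA subrK -(enormN (collapse w - _)) opprB /f; lra.
  have := enormD (collapse v - collapse w) (collapse w - y).
  rewrite addrA subrK /f; lra.
pose K := [set v : V | `|v| <= 1] `&` \bigcap_(z in [set z | collapse z = y]) [set v | e <= `|v - z|].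
have cK : compact K.
  apply: compact_closedI; first exact: ball_compact.
  apply: closed_bigI => z _.
  have -> : [set v : V | e <= `|v - z|] = (fun v : V => `|v - z|) @^-1` [set t : R | e <= t] by [].
  apply: closed_comp => [x _|]; last exact: closed_ge.
  apply: (@lip_continuous _ _ _ 1) => v w; rewrite mul1r (le_trans (ler_dist_dist _ _))//.
  by rewrite opprB addrA subrK.
have [d d0 Hd] : exists2 d, 0 < d & forall v, K v -> d <= f v.
  have [K0|/set0P K0] := eqVneq K set0; first by exists 1 => // v; rewrite K0.
  have [|c /set_mem [c1 cz] Hc] := compact_EVT_min K0 cK (f := f).
    by apply: continuous_subspaceT; exact: lip_continuous lf.
  exists (f c) => [|v Kv]; last by apply: Hc; rewrite inE.
  by apply: f_gt0 => cy; have := cz c cy; rewrite /= subrr normr0; lra.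
have [d' d'0 Hd'] : exists2 d', 0 < d' & y <> delta_mx 0 0 -> d' <= enorm (delta_mx 0 0 - y).
  have [yb|/eqP yb] := eqVneq y (delta_mx 0 0); first by exists 1.
  exists (enorm (delta_mx 0 0 - y)) => //.
  rewrite -(collapse_far (v := const_mx 1)); last by rewrite norm_const1.
  apply: f_gt0; rewrite collapse_far; last by rewrite norm_const1.
  exact/nesym.
exists (Num.min d d') => [|v]; first by rewrite lt_min d0.
rewrite lt_min => /andP[vd vd'].
have [v1|v1] := leP `|v| 1.
  apply: contrapT => nz; have : K v.
    split=> // z zy /=; rewrite leNgt; apply/negP => vz; apply: nz.
    by exists z.
  by move=> /Hd; rewrite leNgt vd.
have [vy|vy] := pselect (collapse v = y); first by exists v; rewrite ?subrr ?normr0.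
exfalso; move: vd'; rewrite collapse_far ?ltW// => h.
have : d' <= enorm (delta_mx 0 0 - y).
  by apply: Hd' => yb; apply: vy; rewrite collapse_far ?ltW.
by rewrite leNgt h.
Qed.

End Fiber.

(** * The lifted map *)

Section JetDistance.
Context (R : realType) (k : nat).
Implicit Types p q : jet_space R k.

Lemma jet_ext p q : (forall i, (i < k.+2)%N -> jet_coord p i = jet_coord q i) -> p = q.
Proof.
by move=> H; apply/rowP => i; have := H i (ltn_ord i); rewrite /jet_coord inord_val.
Qed.

Lemma dcc_coord (M : R) : 0 <= M -> exists2 C, 0 <= C & forall p q l,
  (dcc p q < l%:E)%E -> l <= M -> (forall i, (i < k.+2)%N -> `|jet_coord p i| <= M) ->
  (forall i, (i < k.+2)%N -> `|jet_coord q i - jet_coord p i| <= C * l) /\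
  (forall i, (0 < i)%N -> (i.+1 < k.+2)%N ->
     `|jet_coord q i.+1 - jet_coord p i.+1 -
       jet_coord p i * (jet_coord q 0 - jet_coord p 0)| <= C * l ^+ 2).
Proof.
move=> /(coord_bound k)[C [C0 HC]]; exists C => // p q l pq lM pM.
have [_ [a [b [g [hg ga gb ->]]]] gl] := ereal_inf_lt pq.
by rewrite -ga -gb; apply: (HC a b g l) => //; [exact: ltW|rewrite ga].
Qed.

Lemma dcc_eq0 p q : dcc p q = 0%E -> p = q.
Proof.
move=> pq; apply/esym/jet_ext => i ik; apply/eqP; rewrite -subr_eq0 -normr_le0.
have M0 : 0 <= `|(p : 'rV[R]_k.+2)| + 1 by rewrite addr_ge0.
have [C C0 HC] := dcc_coord M0; apply: (@le_eps _ _ C) => // e e0.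
pose l := Num.min e 1; have l0 : 0 < l by rewrite lt_min e0 ltr01.
have [|||h _] := HC p q l.
- by rewrite pq lte_fin.
- by rewrite (@le_trans _ _ 1)// ?ge_min ?lexx ?orbT// lerDr.
- by move=> j _; rewrite (le_trans (coord_le_norm _ _))// lerDl.
by rewrite (le_trans (h i ik))// ler_wpM2l// ge_min lexx.
Qed.

End JetDistance.

Section LiftedMap.
Context (R : realType) (m k : nat) (f : sphere R m -> jet_space R k) (L0 : R).
Hypothesis m0 : (0 < m)%N.
Hypothesis fL : forall p q, (dcc (f p) (f q) <= (L0 * sphere_dist p q)%:E)%E.
Notation V := 'rV[R]_m.
Implicit Types (v w : V).

Definition ball_lift v : sphere R m :=
  exist (fun p => p \in sphere R m) (collapse v) (mem_set (collapse_sphere v)).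

Definition lifted v := f (ball_lift v).
Definition lifted_coord i v := jet_coord (lifted v) i.

Lemma lifted_eq v w : collapse v = collapse w -> lifted v = lifted w.
Proof. by move=> vw; congr f; exact: val_inj. Qed.

Lemma dcc_lifted_sphere v w :
  (dcc (lifted v) (lifted w) <= (`|L0| * enorm (collapse v - collapse w))%:E)%E.
Proof.
apply: (le_trans (fL _ _)); rewrite lee_fin ler_wpM2r ?enorm_ge0//.
exact: ler_norm.
Qed.

(** The summand 1 makes the constant positive and the inequality of [dcc_lifted_lt] strict, so that
    a path shorter than this multiple of [|v - w|] exists. *)
Definition lifted_lip : R := (`|L0| + 1) * (24 * m.+1%:R).

Lemma lifted_lip_gt0 : 0 < lifted_lip.
Proof. by rewrite !mulr_gt0 ?ltr_pwDr// ltr0n. Qed.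

Lemma dcc_lifted v w : (dcc (lifted v) (lifted w) <= (lifted_lip * `|v - w|)%:E)%E.
Proof.
apply: (le_trans (dcc_lifted_sphere v w)); rewrite lee_fin /lifted_lip -mulrA.
by rewrite ler_pM ?enorm_ge0 ?lerDl// collapse_lip.
Qed.

Lemma dcc_lifted_lt v w : v != w -> (dcc (lifted v) (lifted w) < (lifted_lip * `|v - w|)%:E)%E.
Proof.
move=> vw; apply: (le_lt_trans (dcc_lifted_sphere v w)); rewrite lte_fin.
have vw0 : 0 < `|v - w| by rewrite normr_gt0 subr_eq0.
apply: (@le_lt_trans _ _ (`|L0| * (24 * m.+1%:R * `|v - w|))).
  by rewrite ler_wpM2l// collapse_lip.
by rewrite /lifted_lip -[ltRHS]mulrA ltr_pM2r ?ltrDl// !mulr_gt0.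
Qed.

Lemma dcc_lifted_bound v w : (dcc (lifted v) (lifted w) <= (`|L0| * 2)%:E)%E.
Proof.
apply: (le_trans (dcc_lifted_sphere v w)); rewrite lee_fin ler_wpM2l//.
have := enormD (collapse v) (- collapse w); rewrite enormN !collapse_sphere; lra.
Qed.

Lemma dcc_lifted_fin v w : dcc (lifted v) (lifted w) \is a fin_num.
Proof. by rewrite ge0_fin_numE ?dcc_ge0// (le_lt_trans (dcc_lifted v w))// ltry. Qed.

(** The constant of [dcc_coord] depends on a bound of the coordinates at the starting point. It is
    used once from [x0], with the diameter of the image, to bound all coordinates, and once more
    from arbitrary points at small scale. *)
Lemma lifted_coord_bounds : exists C : R, [/\
  forall i, (i < k.+2)%N -> forall v, `|lifted_coord i v| <= C,
  forall i, (i < k.+2)%N -> lip C (lifted_coord i) &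
  forall i, (0 < i)%N -> (i.+1 < k.+2)%N -> forall v w,
  `|lifted_coord i.+1 w - lifted_coord i.+1 v -
    lifted_coord i v * (lifted_coord 0 w - lifted_coord 0 v)| <= C * `|v - w| ^+ 2].
Proof.
pose x0 := lifted 0.
pose M1 := `|(x0 : 'rV[R]_k.+2)| + (`|L0| * 2 + 1).
have l10 : 0 <= `|L0| * 2 + 1 by rewrite addr_ge0// mulr_ge0.
have M10 : 0 <= M1 by rewrite addr_ge0.
have [C1 C10 HC1] := dcc_coord k M10.
pose M2 := `|(x0 : 'rV[R]_k.+2)| + C1 * (`|L0| * 2 + 1).
have M20 : 0 <= M2 by rewrite addr_ge0// mulr_ge0.
have bd i : (i < k.+2)%N -> forall v, `|lifted_coord i v| <= M2.
  move=> ik v; have [|||h _] := HC1 x0 (lifted v) (`|L0| * 2 + 1).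
  - by rewrite (le_lt_trans (dcc_lifted_bound 0 v))// lte_fin ltrDl.
  - by rewrite lerDr.
  - by move=> j _; rewrite (le_trans (coord_le_norm _ _))// lerDl.
  rewrite -[lifted_coord i v](subrK (jet_coord x0 i)) addrC (le_trans (ler_normD _ _))//.
  by rewrite lerD ?h// coord_le_norm.
have M30 : 0 <= M2 + 1 by rewrite addr_ge0.
have [C2 C20 HC2] := dcc_coord k M30.
(* [C2] serves the scale [l <= 1]; for [l > 1] the coordinate bound [M2] alone gives [2 * M2] and
   [2 * M2 + 2 * M2 ^+ 2]. *)
pose B := C2 + 2 * M2 + 2 * M2 ^+ 2; pose K := lifted_lip.
have K0 : 0 < K := lifted_lip_gt0.
have M22 : 0 <= M2 ^+ 2 by exact: sqr_ge0.
have B0 : 0 <= B by rewrite /B; lra.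
have key v w : (forall i, (i < k.+2)%N -> `|lifted_coord i w - lifted_coord i v| <= B * (K * `|v - w|)) /\
    (forall i, (0 < i)%N -> (i.+1 < k.+2)%N ->
     `|lifted_coord i.+1 w - lifted_coord i.+1 v -
       lifted_coord i v * (lifted_coord 0 w - lifted_coord 0 v)| <= B * (K * `|v - w|) ^+ 2).
  have [->|vw] := eqVneq v w.
    split=> [i _|i _ _]; first by rewrite !subrr !normr0 !mulr0.
    by rewrite !subrr mulr0 subr0 !normr0 mulr0 expr0n mulr0.
  pose l := K * `|v - w|; rewrite -/l.
  have l0 : 0 <= l by rewrite mulr_ge0// ltW.
  have l20 : 0 <= l ^+ 2 by exact: sqr_ge0.
  have [l1|l1] := leP l 1.
    have [|||h1 h2] := HC2 (lifted v) (lifted w) l.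
    - exact: dcc_lifted_lt.
    - by rewrite (le_trans l1)// lerDr.
    - by move=> i ik; rewrite (le_trans (bd i ik v))// lerDl.
    have CB : C2 <= B by rewrite /B; lra.
    split=> [i ik|i i0 ik]; first by rewrite (le_trans (h1 i ik))// ler_wpM2r.
    by rewrite (le_trans (h2 i i0 ik))// ler_wpM2r.
  have diff i : (i < k.+2)%N -> `|lifted_coord i w - lifted_coord i v| <= 2 * M2.
    move=> ik; rewrite (le_trans (ler_normB _ _))//.
    by have := bd i ik v; have := bd i ik w; lra.
  have l21 : 1 <= l ^+ 2 by rewrite exprn_ege1// ltW.
  split=> [i ik|i i0 ik].
    rewrite (le_trans (diff i ik))//; have : 2 * M2 <= B by rewrite /B; lra.
    by move=> h; rewrite (le_trans h)// ler_peMr// ltW.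
  rewrite (le_trans (ler_normB _ _))// normrM.
  have h1 := diff _ ik; have h2 := ler_pM (normr_ge0 _) (normr_ge0 _) (bd i (ltnW ik) v) (diff 0%N (ltn0Sn _)).
  have h3 : 2 * M2 + M2 * (2 * M2) <= B by rewrite /B expr2; lra.
  rewrite (le_trans (lerD h1 h2))// (le_trans h3)// ler_peMr//.
have KK : 0 <= B * K ^+ 2 by rewrite mulr_ge0// sqr_ge0.
have BK : 0 <= B * K by rewrite mulr_ge0// ltW.
exists (B * K + B * K ^+ 2 + M2); split.
- by move=> i ik v; rewrite (le_trans (bd i ik v))// lerDr addr_ge0.
- move=> i ik v w; rewrite distrC (le_trans ((key v w).1 i ik))// mulrA ler_wpM2r//.
  by rewrite -addrA lerDl addr_ge0.
- move=> i i0 ik v w; rewrite (le_trans ((key v w).2 i i0 ik))// exprMn mulrA ler_wpM2r ?sqr_ge0//.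
  by rewrite addrAC lerDr addr_ge0.
Qed.

(** Adding both orders lets one bound control [dcc] in either order, without reversing paths; it
    explains the factor 2 in [lifted_dist_lip]. *)
Definition lifted_dist v w : R :=
  fine (dcc (lifted v) (lifted w)) + fine (dcc (lifted w) (lifted v)).

Lemma fine_dcc_ge0 v w : 0 <= fine (dcc (lifted v) (lifted w)).
Proof. by rewrite fine_ge0// dcc_ge0. Qed.

Lemma fine_dcc_tri u v w : fine (dcc (lifted u) (lifted w)) <=
  fine (dcc (lifted u) (lifted v)) + fine (dcc (lifted v) (lifted w)).
Proof.
rewrite -fineD ?dcc_lifted_fin// fine_le ?dcc_tri//; first exact: dcc_lifted_fin.
by rewrite fin_numD !dcc_lifted_fin.
Qed.

Lemma fine_dcc_lip v w : fine (dcc (lifted v) (lifted w)) <= lifted_lip * `|v - w|.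
Proof. by rewrite -lee_fin fineK ?dcc_lifted_fin// dcc_lifted. Qed.

Lemma lifted_dist_ge0 v w : 0 <= lifted_dist v w.
Proof. by rewrite addr_ge0// fine_dcc_ge0. Qed.

Lemma lifted_dist_tri u v w : lifted_dist u w <= lifted_dist u v + lifted_dist v w.
Proof.
by have := fine_dcc_tri u v w; have := fine_dcc_tri w v u; rewrite /lifted_dist; lra.
Qed.

Lemma lifted_dist_lip v w : lifted_dist v w <= 2 * lifted_lip * `|v - w|.
Proof.
have := fine_dcc_lip v w; have := fine_dcc_lip w v; rewrite (distrC w v) /lifted_dist; lra.
Qed.

Lemma lifted_dist_eq v v' w w' : lifted v = lifted v' -> lifted w = lifted w' ->
  lifted_dist v w = lifted_dist v' w'.
Proof. by rewrite /lifted_dist => -> ->. Qed.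

Let retract v : V := if `|v| <= 1 then v else const_mx 1.

Let lifted_retract v : lifted (retract v) = lifted v.
Proof.
rewrite /retract; case: leP => // v1; apply: lifted_eq.
have c1 : 1 <= `|const_mx 1 : V| by rewrite norm_const1.
by rewrite (collapse_far (ltW v1)) (collapse_far c1).
Qed.

Let retract_le1 v : `|retract v| <= 1.
Proof. by rewrite /retract; case: ifP => // _; rewrite norm_const1. Qed.

(** A compactness argument on the product of two closed unit balls; [retract] moves all points there
    without changing [lifted]. *)
Lemma lifted_dist_sep e : 0 < e -> exists M, forall v w,
  lifted_dist v w <= M * (\sum_(i < k.+2) `|lifted_coord i v - lifted_coord i w|) + e.
Proof.
move=> e0; have [C [Cbd Clip _]] := lifted_coord_bounds.
pose fD (x : V * V) := lifted_dist x.1 x.2.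
pose gD (x : V * V) := \sum_(i < k.+2) `|lifted_coord i x.1 - lifted_coord i x.2|.
have K0 := lifted_lip_gt0.
have le1 (x : V * V) : `|x.1| <= `|x| by rewrite prod_normE le_max lexx.
have le2 (x : V * V) : `|x.2| <= `|x| by rewrite prod_normE le_max lexx orbT.
have fc : continuous fD.
  apply: (@lip_continuous _ _ _ (4 * lifted_lip)) => x y.
  have := lifted_dist_tri x.1 y.1 x.2; have := lifted_dist_tri y.1 y.2 x.2.
  have := lifted_dist_tri y.1 x.1 y.2; have := lifted_dist_tri x.1 x.2 y.2.
  have := lifted_dist_lip x.1 y.1; have := lifted_dist_lip y.1 x.1.
  have := lifted_dist_lip x.2 y.2; have := lifted_dist_lip y.2 x.2.
  rewrite (distrC y.1) (distrC y.2) /fD.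
  have h1 : 2 * lifted_lip * `|x.1 - y.1| <= 2 * lifted_lip * `|x - y|.
    by rewrite ler_wpM2l ?(le1 (x - y))// mulr_ge0// ltW.
  have h2 : 2 * lifted_lip * `|x.2 - y.2| <= 2 * lifted_lip * `|x - y|.
    by rewrite ler_wpM2l ?(le2 (x - y))// mulr_ge0// ltW.
  by move=> *; rewrite ler_norml; apply/andP; split; lra.
have gc : continuous gD.
  apply: (@lip_continuous _ _ _ (k.+2%:R * (2 * C))) => x y.
  rewrite /gD -sumrB (le_trans (ler_norm_sum _ _ _))//.
  rewrite -mulrA mulr_natl -[X in _ *+ X](card_ord k.+2) -sumr_const ler_sum// => i _.
  rewrite (le_trans (ler_dist_dist _ _))//.
  have C0 : 0 <= C by rewrite (le_trans _ (Cbd 0%N (ltn0Sn _) 0)).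
  have i1 := Clip i (ltn_ord i) x.1 y.1; have i2 := Clip i (ltn_ord i) x.2 y.2.
  have j1 : C * `|x.1 - y.1| <= C * `|x - y| by rewrite ler_wpM2l// (le1 (x - y)).
  have j2 : C * `|x.2 - y.2| <= C * `|x - y| by rewrite ler_wpM2l// (le2 (x - y)).
  move: i1 i2; rewrite !ler_norml => /andP[? ?] /andP[? ?]; apply/andP; split; lra.
have cK := compact_setX (@ball_compact R m) (@ball_compact R m).
have g0 x : 0 <= gD x by rewrite sumr_ge0.
have gf x : gD x = 0 -> fD x <= 0.
  move=> /eqP; rewrite psumr_eq0// => /allP gx.
  have E : lifted x.1 = lifted x.2.
    apply: jet_ext => i ik; have := gx (Ordinal ik) (mem_index_enum _).
    by rewrite /= normr_eq0 subr_eq0 => /eqP.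
  by rewrite /fD /lifted_dist E dcc_refl /= addr0.
have [M HM] := compact_separation cK fc gc g0 gf e0.
exists M => v w; have := HM (retract v, retract w).
rewrite /fD /gD /= (lifted_dist_eq (lifted_retract v) (lifted_retract w)).
rewrite /lifted_coord !lifted_retract; apply.
by split; exact: retract_le1.
Qed.

End LiftedMap.

(** * Contraction along the height *)

Section Arc.
Context (R : realType) (n : nat) (y y' : 'rV[R]_n).
Hypothesis y1 : enorm y = 1.
Hypothesis yy' : enorm (y - y') <= 2^-1.

Definition arc t := normalize (pt y y' t).

Let pt_sub s t : enorm (pt y y' s - pt y y' t) = `|s - t| * enorm (y - y').
Proof.
rewrite /pt opprD addrACA subrr add0r -scalerBl enormZ.
by rewrite -(enormN (y' - y)) opprB.
Qed.

Lemma arc_lb t : 0 <= t -> t <= 1 -> 2^-1 <= enorm (pt y y' t).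
Proof.
move=> t0 t1; have := pt_sub 0 t; rewrite pt0 sub0r normrN ger0_norm// => h.
have := enormD (y - pt y y' t) (pt y y' t); rewrite subrK y1 h.
have := yy'.
have : t * enorm (y - y') <= enorm (y - y') by rewrite ler_piMl// enorm_ge0.
lra.
Qed.

Lemma arc_norm t : 0 <= t -> t <= 1 -> enorm (arc t) = 1.
Proof. by move=> t0 t1; apply: enorm_normalize; have := arc_lb t0 t1; lra. Qed.

Lemma arc_lip s t : 0 <= s -> s <= 1 -> 0 <= t -> t <= 1 ->
  enorm (arc s - arc t) <= 4 * (`|s - t| * enorm (y - y')).
Proof.
move=> s0 s1 t0 t1; rewrite -pt_sub.
have h : 0 < 2^-1 :> R by rewrite invr_gt0.
have := normalize_lip h (arc_lb s0 s1) (arc_lb t0 t1).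
by rewrite invrK (_ : 2 * 2 = 4)//; ring.
Qed.

Lemma arc0 : arc 0 = y. Proof. by rewrite /arc pt0 normalize_id. Qed.

Lemma arc1 : enorm y' = 1 -> arc 1 = y'.
Proof. by move=> y'1; rewrite /arc pt1 normalize_id. Qed.

End Arc.

Section Contraction.
Context (R : realType) (m k : nat) (f : sphere R m -> jet_space R k) (L0 : R).
Hypothesis m1 : (1 < m)%N.
Hypothesis k0 : (0 < k)%N.
Hypothesis fL : forall p q, (dcc (f p) (f q) <= (L0 * sphere_dist p q)%:E)%E.
Notation V := 'rV[R]_m.
Notation Z := [set v : V | 1 <= `|v|].
Notation o := (const_mx 1 : V).
Notation L := (2 * lifted_lip m L0).
Notation F := (lifted_coord f).
Notation sg := (height F L Z o).
Notation Hit := (hit F L Z o).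
Notation Near := (near F L Z o).
Notation D := (lifted_dist f).

Let m0 : (0 < m)%N. Proof. exact: ltnW. Qed.
Let L_gt0 : 0 < L. Proof. by rewrite mulr_gt0// lifted_lip_gt0. Qed.
Let Zo : Z o. Proof. by rewrite /= norm_const1. Qed.

Let lifted_Z z : Z z -> lifted f z = lifted f o.
Proof. by move=> z1; apply: lifted_eq; rewrite !collapse_far// norm_const1. Qed.

Let FZ z i : Z z -> (i < k.+2)%N -> F i z = F i o.
Proof. by move=> /lifted_Z zo _; rewrite /lifted_coord zo. Qed.

Let Znear := @exterior_near R m m0.
Let Znet := @exterior_net R m.
Let Zconn := @exterior_connected R m m1.
Let N3 : (2 < k.+2)%N. Proof. by rewrite !ltnS. Qed.

Let sg_Z z : Z z -> sg z = 0.
Proof. by move=> Zz; apply: height_Z. Qed.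

Lemma contraction_hit s p e : 0 <= s -> 0 < e ->
  exists2 z, Hit s p z & D p z <= Num.max 0 (sg p - s) + e.
Proof.
have [C [Cbd Clip Chor]] := lifted_coord_bounds fL.
apply: (hit_exists N3 Cbd Clip Chor) => //.
- exact: lifted_dist_ge0.
- exact: (lifted_dist_tri fL).
- exact: (lifted_dist_lip fL).
- exact: (lifted_dist_sep m0 fL).
Qed.

Lemma contraction_dist p q : D p q <= dist F L Z o p q.
Proof.
have [C [Cbd Clip Chor]] := lifted_coord_bounds fL.
apply: (D_le_dist N3 Cbd Clip Chor) => //.
- exact: lifted_dist_ge0.
- exact: (lifted_dist_tri fL).
- exact: (lifted_dist_lip fL).
- exact: (lifted_dist_sep m0 fL).
Qed.

Lemma contraction_unique s p z z' : 0 <= s -> Hit s p z -> Hit s p z' ->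
  lifted f z = lifted f z'.
Proof.
move=> s0 hz hz'; have [C [Cbd Clip Chor]] := lifted_coord_bounds fL.
apply: jet_ext => i ik.
exact: (hit_unique N3 Cbd Clip Chor L_gt0 Zo FZ Znear Znet Zconn ik s0 hz hz').
Qed.

Lemma contraction_near : exists2 C, 0 <= C & forall s p a z z' i,
  (i < k.+2)%N -> 0 <= s ->
  Hit s p z -> Near s p a -> sg z' <= s -> `|F i z - F i z'| <= C * `|a - z'|.
Proof.
have [C [Cbd Clip Chor]] := lifted_coord_bounds fL.
exists (2 * C) => [|s p a z z' i ik s0 hz na zs'].
  by rewrite mulr_ge0// (le_trans _ (Cbd 0%N (ltn0Sn _) 0)).
exact: (hit_near_value N3 Cbd Clip Chor L_gt0 Zo FZ Znear Znet Zconn ik s0 hz na zs').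
Qed.

Variable psi : 'rV[R]_m.+1 -> V.
Hypothesis psiK : forall y, enorm y = 1 -> collapse (psi y) = y.

Let sg_le_far (v : V) s : 0 <= s -> s < sg v -> `|v| < 1.
Proof.
by move=> s0 sv; rewrite ltNge; apply/negP => /sg_Z v0; move: sv; rewrite v0 ltNge s0.
Qed.

(* Follow the arc from [y] to [y'] until it leaves the component of
   [psi y] in the superlevel set: the exit point takes the contracted value. *)
Lemma exit_point y y' s z : enorm y = 1 -> enorm y' = 1 -> enorm (y - y') <= 2^-1 ->
  0 <= s -> Hit s (psi y) z ->
  (forall z', Hit s (psi y') z' -> lifted f z = lifted f z') \/
  exists2 v, lifted f z = lifted f v & enorm (collapse v - y) <= 4 * enorm (y - y').
Proof.
move=> y1 y'1 yy' s0 hz; have [ps|sp] := leP (sg (psi y)) s.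
  right; exists (psi y); last first.
      rewrite psiK// subrr /enorm big1 ?sqrtr0 ?mulr_ge0// => i _.
      by rewrite mxE expr0n.
  by apply: contraction_unique hz _ => //; exact: hit_low.
pose T t := exists2 d, 0 < d & conn sg (s + d) (psi y) (psi (arc y y' t)).
have near_arc t : 0 <= t -> t <= 1 -> enorm (arc y y' t) = 1 by exact: arc_norm.
have T0 : T 0.
  rewrite /T arc0//; exists (sg (psi y) - s); first by rewrite subr_gt0.
  by apply: conn0; lra.
(* If the arc ends in the component of [psi y], then [psi y'] has the same component, and rim points
   of one are rim points of the other. *)
have [T1|T1] := pselect (T 1).
  left => z' [zs' Hz']; apply: contraction_unique hz _ => //; split=> // e e0.
  have [a na az] := Hz' e e0; exists a => //; right.
  move: T1; rewrite /T arc1// => -[d d0 c].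
  have sp' : s < sg (psi y') by have := conn_end c; lra.
  have [d' d'0 c'] := near_conn sp' na.
  exists (Num.min d d'); first by rewrite lt_min d0.
  by apply: (@conn_trans _ _ _ _ _ (psi y')); [apply: conn_le c|apply: conn_le c'];
    rewrite lerD2l ge_min lexx ?orbT.
(* [psi] is only a section and may jump at the base point, so [psi (arc y y' u)] approaches some
   point [w] of the fiber over [arc y y' t], not necessarily [psi (arc y y' t)]. *)
have near_t e t : 0 < e -> 0 <= t -> t <= 1 -> exists2 r, 0 < r & forall u, 0 <= u -> u <= 1 ->
    `|u - t| < r -> exists2 w, collapse w = arc y y' t & `|psi (arc y y' u) - w| < e.
  move=> e0 t0 t1; have [d d0 Hd] := collapse_fiber m0 (near_arc t t0 t1) e0.
  exists (d / 4) => [|u u0 u1 ut]; first by rewrite divr_gt0.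
  apply: Hd; rewrite psiK ?near_arc//.
  rewrite (le_lt_trans (arc_lip y1 yy' u0 u1 t0 t1))//.
  have : `|u - t| * enorm (y - y') <= `|u - t| * 1 by rewrite ler_wpM2l//; lra.
  lra.
have [|t [t0 t1 nT HT]] := first_exit T0 T1.
  move=> t t0 t1 [d d0 c].
  have vt : `|psi (arc y y' t)| < 1 by apply: (sg_le_far s0); have := conn_end c; lra.
  have [r r0 Hr] := @near_open R V F L Z o L_gt0 s (psi y) _ (ex_intro2 _ _ d d0 c).
  have [r' r'0 Hr'] := near_t r t r0 t0 t1; exists r' => // u u0 u1 ut.
  have [w wt uw] := Hr' u u0 u1 ut.
  have E : psi (arc y y' t) = w by apply: collapse_inj => //; rewrite wt psiK ?near_arc.
  by apply: Hr; rewrite E.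
right; pose v := psi (arc y y' t); have t0' := ltW t0.
have approach e : 0 < e -> exists2 u, T u & exists2 w, collapse w = arc y y' t &
    `|psi (arc y y' u) - w| < e.
  move=> e0; have [r r0 Hr] := near_t e t e0 t0' t1.
  pose u := Num.max 0 (t - r / 2).
  have ut : u < t by rewrite gt_max t0/= ltrBlDr ltrDl divr_gt0.
  have u0 : 0 <= u by rewrite le_max lexx.
  have ur : t - r / 2 <= u by rewrite le_max lexx orbT.
  exists u; first exact: HT.
  by apply: Hr => //; [lra|rewrite ltr0_norm ?subr_lt0//; lra].
have vE w : collapse w = arc y y' t -> `|v| < 1 -> w = v.
  by move=> wt v1; apply/esym/collapse_inj => //; rewrite wt psiK ?near_arc.
(* Above level [s] the exit point would have a neighborhood inside its own component, containing
   [psi (arc y y' u)] for an earlier [u]; it would then still belong to the component of [psi y]. *)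
have sv : sg v <= s.
  rewrite leNgt; apply/negP => sv; apply: nT.
  have v1 := sg_le_far s0 sv.
  have cv : conn sg (s + (sg v - s)) v v by apply: conn0; lra.
  have sv0 : 0 < sg v - s by rewrite subr_gt0.
  have [|r r0 Hr] := @near_open R V F L Z o L_gt0 s v v; first by exists (sg v - s).
  have [u [d d0 cu] [w wt uw]] := approach r r0.
  rewrite (vE w wt v1) in uw; have [d' d'0 cu'] := Hr _ uw.
  exists (Num.min d d'); first by rewrite lt_min d0.
  apply: (@conn_trans _ _ _ _ _ (psi (arc y y' u))).
    by apply: conn_le cu; rewrite lerD2l ge_min lexx.
  by apply/conn_sym; apply: conn_le cu'; rewrite lerD2l ge_min lexx orbT.
have sw w : collapse w = arc y y' t -> sg w <= s.
  move=> wt; have [v1|v1] := ltP `|v| 1; first by rewrite (vE w wt v1).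
  have [w1|w1] := ltP `|w| 1; last by rewrite sg_Z.
  have vw : collapse w = collapse v by rewrite wt psiK ?near_arc.
  by move: v1; rewrite -(collapse_inj w1 vw) leNgt w1.
exists v; last first.
  rewrite /v psiK ?near_arc// -{2}(arc0 y' y1).
  rewrite (le_trans (arc_lip y1 yy' t0' t1 (lexx _) ler01))//.
  by rewrite subr0 (ger0_norm t0') ler_wpM2l// ler_piMl ?enorm_ge0.
have [C C0 HC] := contraction_near; apply: jet_ext => i ik.
apply/eqP; rewrite -subr_eq0 -normr_le0; apply: (@le_eps _ _ C) => // e e0.
have [u Tu [w wt uw]] := approach e e0.
have -> : lifted f v = lifted f w by apply: lifted_eq; rewrite wt psiK ?near_arc.
have := HC s (psi y) (psi (arc y y' u)) z w i ik s0 hz (or_intror Tu) (sw w wt).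
move=> /le_trans; apply; rewrite ler_wpM2l//; exact: ltW.
Qed.

(** [H s p] is the value of [lifted] on the rim of the component of [p] above [s]. The rim point [z]
    is an arbitrary choice, and [contraction_unique] makes the value independent of it. *)
Lemma contraction_exists : exists H : R -> V -> jet_space R k, [/\
  forall s s' p, 0 <= s -> s <= s' -> (dcc (H s p) (H s' p) <= (s' - s)%:E)%E /\
    (dcc (H s' p) (H s p) <= (s' - s)%:E)%E,
  forall s y y', 0 <= s -> enorm y = 1 -> enorm y' = 1 ->
    (dcc (H s (psi y)) (H s (psi y')) <= (`|L0| * (9 * enorm (y - y')))%:E)%E,
  forall s p, 0 <= s -> L <= s \/ 1 <= `|p| -> H s p = lifted f p &
  forall p, H 0 p = lifted f o].
Proof.
have ex (x : R * V) : exists z, 0 <= x.1 -> Hit x.1 x.2 z.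
  have [x0|x0] := leP 0 x.1; last by exists o.
  by have [z hz _] := contraction_hit x.2 x0 ltr01; exists z.
have [z hz] := choice ex; exists (fun s p => lifted f (z (s, p))); split.
- move=> s s' p s0 ss'; have s'0 := le_trans s0 ss'.
  have hz' := hz (s', p) s'0; have hzs := hz (s, p) s0; rewrite /= in hz' hzs.
  suff h : D (z (s', p)) (z (s, p)) <= s' - s.
    have h1 := fine_dcc_ge0 f (z (s', p)) (z (s, p)).
    have h2 := fine_dcc_ge0 f (z (s, p)) (z (s', p)).
    rewrite /lifted_dist in h.
    by split; rewrite -(fineK (dcc_lifted_fin fL _ _)) lee_fin; lra.
  rewrite -subr_le0; apply: (@le_eps _ _ 1) => // e e0; rewrite mul1r lerBlDr addrC.
  (* The rim at level [s] is reached from the rim point at level [s'], whose height is at most [s'],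
     so the cost is at most the drop [s' - s] up to [e]. *)
  have [z2 hz2 h2] := contraction_hit (z (s', p)) s0 e0.
  have -> : D (z (s', p)) (z (s, p)) = D (z (s', p)) z2.
    apply: lifted_dist_eq => //; apply: contraction_unique hzs _ => //.
    exact: hit_trans hz' hz2.
  rewrite (le_trans h2)// lerD2r ge_max subr_ge0 ss'/= lerD2r; exact: hz'.1.
- move=> s y y' s0 y1 y'1; have hy := hz (s, psi y) s0; have hy' := hz (s, psi y') s0.
  rewrite /= in hy hy'.
  (* For points more than 1/2 apart the diameter bound [|L0| * 2] is enough. *)
  have [far|close] := ltP 2^-1 (enorm (y - y')).
    rewrite (le_trans (dcc_lifted_bound fL _ _))// lee_fin ler_wpM2l//; lra.
  have close' : enorm (y' - y) <= 2^-1 by rewrite -enormN opprB.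
  have e0 := enorm_ge0 (y - y').
  have b0 : 0 <= `|L0| * (9 * enorm (y - y')) by rewrite !mulr_ge0.
  have [E|[v Ev hv]] := exit_point y1 y'1 close s0 hy.
    by rewrite (E _ hy') dcc_refl lee_fin.
  have [E|[v' Ev' hv']] := exit_point y'1 y1 close' s0 hy'.
    by rewrite -(E _ hy) dcc_refl lee_fin.
  rewrite Ev Ev'.
  rewrite (le_trans (dcc_lifted_sphere fL _ _))// lee_fin ler_wpM2l//.
  (* The constant 9 is 4 + 1 + 4: from the first exit point to [y], from [y] to [y'], and from [y']
     to the second exit point. *)
  have -> : collapse v - collapse v' = (collapse v - y) + (y - y' - (collapse v' - y')).
    by rewrite opprB addrA addrA addrA subrK subrK.
  rewrite (le_trans (enormD _ _))//; have := enormD (y - y') (- (collapse v' - y')).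
  have yE : enorm (y' - y) = enorm (y - y') by rewrite -enormN opprB.
  rewrite enormN; rewrite yE in hv'; lra.
- move=> s p s0 ps; apply: contraction_unique (hz (s, p) s0) _ => //; apply: hit_low.
  case: ps => [Ls|/sg_Z ->//]; exact/le_trans/Ls/height_le.
- move=> p; have hzp := hz (0, p) (lexx _); rewrite /= in hzp.
  (* [D o] is dominated by the height, which is at most 0 at a rim point of level 0. *)
  have h : D o (z (0, p)) <= 0 by rewrite (le_trans (contraction_dist _ _))//; exact: hzp.1.
  have h1 := fine_dcc_ge0 f o (z (0, p)).
  have h2 := fine_dcc_ge0 f (z (0, p)) o.
  rewrite /lifted_dist in h.
  apply: dcc_eq0; apply/eqP; rewrite -(fineK (dcc_lifted_fin fL _ _)) eqe.
  by rewrite eq_le h2 andbT; lra.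
Qed.

End Contraction.

(** * Lipschitz homotopies *)

Section LipschitzHomotopy.
Context (R : realType) (m : nat) (T : Type) (d : T -> T -> \bar R) (x0 : T).
Implicit Types (f g h : sphere R m -> T) (t u : unit_interval R).

Lemma sphere_le_cylinder (p q : sphere R m * unit_interval R) :
  sphere_dist p.1 q.1 <= cylinder_dist p q.
Proof.
rewrite -[leLHS]ger0_norm ?enorm_ge0// -sqrtr_sqr ler_wsqrtr// lerDl; exact: sqr_ge0.
Qed.

Lemma interval_le_cylinder (p q : sphere R m * unit_interval R) :
  `|val p.2 - val q.2| <= cylinder_dist p q.
Proof. by rewrite -sqrtr_sqr ler_wsqrtr// lerDr sqr_ge0. Qed.

Lemma unit_intervalP (t : unit_interval R) : 0 <= val t /\ val t <= 1.
Proof. by case: t => t /= ti; move: (ti); rewrite inE /unit_interval /= in_itv/= => /andP[]. Qed.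

Lemma unit_interval_mem (t : R) : 0 <= t -> t <= 1 -> t \in unit_interval R.
Proof. by move=> t0 t1; rewrite inE /unit_interval /= in_itv/= t0. Qed.

Definition to_unit (t : R) : unit_interval R :=
  match pselect (t \in unit_interval R) with
  | left tI => exist (fun t : R => t \in unit_interval R) t tI
  | right _ => exist (fun t : R => t \in unit_interval R) 0 (unit_interval_mem (lexx _) ler01)
  end.

Lemma to_unitE (t : R) : 0 <= t -> t <= 1 -> val (to_unit t) = t.
Proof.
by move=> t0 t1; rewrite /to_unit; case: pselect => // /(_ (unit_interval_mem t0 t1)).
Qed.

Lemma cylinder_dist_scale (p q p' q' : sphere R m) t u t' u' :
  sphere_dist p' q' <= sphere_dist p q -> `|val t' - val u'| <= 2 * `|val t - val u| ->
  cylinder_dist (p', t') (q', u') <= 2 * cylinder_dist (p, t) (q, u).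
Proof.
move=> pq tu; rewrite -[2](ger0_norm (ler0n R 2)) -sqrtr_sqr -sqrtrM ?sqr_ge0//.
rewrite ler_wsqrtr// mulrDr lerD//=.
  rewrite (@le_trans _ _ (sphere_dist p q ^+ 2))//.
    by rewrite ler_sqr ?nnegrE ?enorm_ge0.
  by rewrite ler_peMl ?sqr_ge0// exprn_ege1// ler1n.
rewrite -exprMn -[leLHS]real_normK ?num_real// -[leRHS]real_normK ?num_real// normrM (ger0_norm (ler0n R 2)).
by rewrite ler_sqr ?nnegrE ?mulr_ge0.
Qed.

Lemma lipschitz_homotopic_sym f g :
  lipschitz_homotopic d x0 f g -> lipschitz_homotopic d x0 g f.
Proof.
move=> [H [[L HL] H0 H1 Hb]]; pose flip t := to_unit (1 - val t).
have flipE t : val (flip t) = 1 - val t.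
  by have [? ?] := unit_intervalP t; rewrite to_unitE//; lra.
exists (fun x => H (x.1, flip x.2)); split.
- exists L => -[p t] [q u]; rewrite (le_trans (HL _ _))//= lee_fin.
  rewrite /cylinder_dist /= !flipE.
  by rewrite (_ : (1 - val t - (1 - val u)) ^+ 2 = (val t - val u) ^+ 2)//; ring.
- by move=> p t t0; rewrite /= H1// flipE t0 subr0.
- by move=> p t t1; rewrite /= H0// flipE t1 subrr.
- by move=> t; exact: Hb.
Qed.

Hypothesis d_tri : forall x y z, (d x z <= d x y + d y z)%E.

Lemma lipschitz_homotopic_trans f g h : lipschitz_homotopic d x0 f g ->
  lipschitz_homotopic d x0 g h -> lipschitz_homotopic d x0 f h.
Proof.
move=> [H [[L HL] H0 H1 Hb]] [K [[M KM] K0 K1 Kb]].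
pose J (x : sphere R m * unit_interval R) := if val x.2 <= 2^-1
  then H (x.1, to_unit (2 * val x.2)) else K (x.1, to_unit (2 * val x.2 - 1)).
pose N := `|L| + `|M|; have N0 : 0 <= N by exact: addr_ge0.
have HN p q C : cylinder_dist p q <= C -> (d (H p) (H q) <= (N * C)%:E)%E.
  move=> pqC; rewrite (le_trans (HL p q))// lee_fin.
  have c0 : 0 <= cylinder_dist p q by exact: sqrtr_ge0.
  rewrite (@le_trans _ _ (N * cylinder_dist p q))// ?ler_wpM2l//.
  by rewrite ler_wpM2r// (le_trans (ler_norm _))// lerDl.
have KN p q C : cylinder_dist p q <= C -> (d (K p) (K q) <= (N * C)%:E)%E.
  move=> pqC; rewrite (le_trans (KM p q))// lee_fin.
  have c0 : 0 <= cylinder_dist p q by exact: sqrtr_ge0.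
  rewrite (@le_trans _ _ (N * cylinder_dist p q))// ?ler_wpM2l//.
  by rewrite ler_wpM2r// (le_trans (ler_norm _))// lerDr.
have E1 t : val t <= 2^-1 -> val (to_unit (2 * val t)) = 2 * val t.
  by have [? ?] := unit_intervalP t => ?; rewrite to_unitE//; lra.
have E2 t : 2^-1 < val t -> val (to_unit (2 * val t - 1)) = 2 * val t - 1.
  by have [? ?] := unit_intervalP t => ?; rewrite to_unitE//; lra.
have u0 : val (to_unit 0) = 0 by rewrite to_unitE.
have u1 : val (to_unit 1) = 1 by rewrite to_unitE.
have sphere_refl p : @sphere_dist R m p p = 0.
  by rewrite /sphere_dist subrr /enorm big1 ?sqrtr0// => i _; rewrite mxE expr0n.
have meet p : H (p, to_unit 1) = K (p, to_unit 0) by rewrite H1// K0.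
exists J; split.
- exists (N * 4) => -[p t] [q u]; rewrite /J /=.
  have c0 : 0 <= cylinder_dist (p, t) (q, u) by exact: sqrtr_ge0.
  have four C : C = N * (2 * cylinder_dist (p, t) (q, u)) ->
      (C%:E <= (N * 4 * cylinder_dist (p, t) (q, u))%:E)%E.
    by move=> ->; rewrite lee_fin -mulrA ler_wpM2l// ler_wpM2r// ler_nat.
  have twice := cylinder_dist_scale (q := q) (p := p) (t := t) (u := u).
  have [t2|t2] := leP (val t) 2^-1; have [u2|u2] := leP (val u) 2^-1.
  + rewrite (le_trans (HN _ _ _ (twice _ _ _ _ (lexx _) _)))// ?four// !E1//.
    by rewrite -mulrBr normrM ger0_norm.
  + rewrite (le_trans (d_tri _ (H (p, to_unit 1)) _))//.
    have h1 : (d (H (p, to_unit (2 * val t))) (H (p, to_unit 1)) <=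
        (N * (2 * cylinder_dist (p, t) (q, u)))%:E)%E.
      apply: HN; apply: twice; first by rewrite sphere_refl enorm_ge0.
      by rewrite E1// u1 ler0_norm ?ltr0_norm; lra.
    have h2 : (d (H (p, to_unit 1)) (K (q, to_unit (2 * val u - 1)%R)) <=
        (N * (2 * cylinder_dist (p, t) (q, u)))%:E)%E.
      rewrite meet; apply: KN; apply: twice => //.
      by rewrite E2// u0 ler0_norm ?ltr0_norm; lra.
    rewrite (le_trans (leeD h1 h2))// -EFinD lee_fin le_eqVlt; apply/orP; left.
    by apply/eqP; ring.
  + rewrite (le_trans (d_tri _ (H (q, to_unit 1)) _))//.
    have h1 : (d (H (q, to_unit 1)) (H (q, to_unit (2 * val u))) <=
        (N * (2 * cylinder_dist (p, t) (q, u)))%:E)%E.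
      apply: HN; apply: twice; first by rewrite sphere_refl enorm_ge0.
      by rewrite E1// u1 ger0_norm ?gtr0_norm; lra.
    have h2 : (d (K (p, to_unit (2 * val t - 1)%R)) (H (q, to_unit 1)) <=
        (N * (2 * cylinder_dist (p, t) (q, u)))%:E)%E.
      rewrite meet; apply: KN; apply: twice => //.
      by rewrite E2// u0 ger0_norm ?gtr0_norm; lra.
    rewrite (le_trans (leeD h2 h1))// -EFinD lee_fin le_eqVlt; apply/orP; left.
    by apply/eqP; ring.
  + rewrite (le_trans (KN _ _ _ (twice _ _ _ _ (lexx _) _)))// ?four// !E2//.
    rewrite (_ : 2 * val t - 1 - (2 * val u - 1) = 2 * (val t - val u)); last by ring.
    by rewrite normrM ger0_norm.
- by move=> p t t0; rewrite /J /= t0 invr_ge0 ler0n H0 ?mulr0 ?u0.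
- move=> p t t1; rewrite /J /= t1 leNgt invf_lt1 ?ltr1n//= K1// to_unitE//; lra.
- by move=> t; rewrite /J /=; case: ifP => _; [exact: Hb|exact: Kb].
Qed.

End LipschitzHomotopy.

Section Nullhomotopy.
Context (R : realType) (m k : nat) (x0 : jet_space R k).
Hypothesis m1 : (1 < m)%N.
Hypothesis k0 : (0 < k)%N.
Implicit Types f g : sphere R m -> jet_space R k.

Lemma nullhomotopic f : based_lipschitz (@dcc R k) x0 f ->
  lipschitz_homotopic (@dcc R k) x0 f (fun=> x0).
Proof.
move=> [[L0 fL] fb]; have m0 := ltnW m1.
have ex (y : 'rV[R]_m.+1) : exists v : 'rV[R]_m, enorm y = 1 -> collapse v = y.
  have [y1|y1] := pselect (enorm y = 1); last by exists 0.
  by have [v vy] := collapse_surj m0 y1; exists v.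
have [psi psiK] := choice ex.
have [H [Hs Hy Htop H0]] := contraction_exists m1 k0 fL psiK.
have o1 : 1 <= `|const_mx 1 : 'rV[R]_m| by rewrite norm_const1.
have liftE p : lifted f (psi (val p)) = f p.
  congr f; apply: val_inj; rewrite /= psiK//.
  by case: p => p /= hp; move: (hp); rewrite inE.
have base_o : lifted f (const_mx 1) = x0.
  by rewrite -fb; congr f; apply: val_inj; rewrite /= collapse_far.
pose S := 2 * lifted_lip m L0.
have S0 : 0 < S by rewrite mulr_gt0// lifted_lip_gt0.
have unit_S (t : unit_interval R) : 0 <= (1 - val t) * S.
  by have [_ t1] := unit_intervalP t; rewrite mulr_ge0 ?subr_ge0// ltW.
have norm1 (p : sphere R m) : enorm (val p) = 1 by case: p => p /= hp; move: (hp); rewrite inE.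
exists (fun x => H ((1 - val x.2) * S) (psi (val x.1))); split.
- exists (`|L0| * 9 + S) => -[p t] [q u] /=.
  have h1 : (dcc (H ((1 - val t) * S)%R (psi (val p))) (H ((1 - val u) * S)%R (psi (val p))) <=
      (S * cylinder_dist (p, t) (q, u))%:E)%E.
    have := interval_le_cylinder (p, t) (q, u); rewrite /= => tu.
    apply: (@le_trans _ _ (S * `|val t - val u|)%:E); last by rewrite lee_fin ler_wpM2l// ltW.
    have [le_tu|lt_ut] := leP (val t) (val u).
      have le_s : (1 - val u) * S <= (1 - val t) * S by rewrite (ler_wpM2r (ltW S0))// lerB.
      rewrite (le_trans (Hs _ _ _ (unit_S u) le_s).2)// lee_fin.
      by rewrite ler0_norm ?subr_le0// le_eqVlt; apply/orP; left; apply/eqP; ring.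
    have le_s : (1 - val t) * S <= (1 - val u) * S by rewrite (ler_wpM2r (ltW S0))// lerB// ltW.
    rewrite (le_trans (Hs _ _ _ (unit_S t) le_s).1)// lee_fin.
    by rewrite gtr0_norm ?subr_gt0// le_eqVlt; apply/orP; left; apply/eqP; ring.
  have h2 := Hy _ _ _ (unit_S u) (norm1 p) (norm1 q).
  rewrite (le_trans (dcc_tri _ (H ((1 - val u) * S) (psi (val p))) _))//.
  rewrite (le_trans (leeD h1 h2))// -EFinD lee_fin [leRHS]mulrDl [leLHS]addrC lerD2r -mulrA ler_wpM2l//.
  by rewrite ler_wpM2l// (sphere_le_cylinder (p, t) (q, u)).
- move=> p t t0; rewrite /= t0 subr0 mul1r Htop ?liftE//; [exact: ltW|by left].
- by move=> p t t1; rewrite /= t1 subrr mul0r H0.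
- move=> t; rewrite /= Htop ?unit_S//; first by rewrite -fb -liftE.
  (* If [psi] sent the base point inside the open ball, injectivity of [collapse] there would
     identify its image with [const_mx 1], which has norm 1. *)
  right; rewrite leNgt; apply/negP => lt1; move: (lt1).
  rewrite (collapse_inj (v' := const_mx 1) lt1) ?psiK ?enorm_base ?collapse_far//.
  by rewrite ltNge o1.
Qed.

Lemma jet_lipschitz_pi_trivial : lipschitz_pi_trivial m (@dcc R k) x0.
Proof.
have bc : based_lipschitz (@dcc R k) x0 (fun _ : sphere R m => x0).
  by split=> //; exists 0 => p q; rewrite dcc_refl mul0r.
have full f : based_lipschitz (@dcc R k) x0 f ->
    lipschitz_class (@dcc R k) x0 f = [set g | based_lipschitz (@dcc R k) x0 g].
  move=> bf; apply/seteqP; split => g; first by case.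
  move=> bg; split=> //; apply: lipschitz_homotopic_trans (nullhomotopic bf) _.
    exact: dcc_tri.
  exact/lipschitz_homotopic_sym/nullhomotopic.
apply/seteqP; split => [_ [f bf <-]|_ ->]; last by exists (fun=> x0).
by rewrite /= !full.
Qed.

End Nullhomotopy.

Theorem corollary3p10 (R : realType) (m k : nat) (hm : (2 <= m)%N)
    (hk : (1 <= k)%N) (x0 : jet_space R k) :
  lipschitz_pi_trivial m (@dcc R k) x0.
Proof. exact: jet_lipschitz_pi_trivial. Qed.
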